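(* Let $D_N=\mathrm{diag}(d_1,\ldots,d_N)$ be an $N\times N$ diagonal matrix of rank $N$ with $d_1,\ldots,d_N>0$. Let $1\le L<N$ and let $X$ be an $N\times L$ complex Gaussian random matrix with independent and identically distributed entries with zero mean and variance $1$. Then $$\int_{\Omega_{L,N}}\mathrm{Tr}\big((\Phi^{*}D_N\Phi)^{-1}\big)\,d\phi=(N-L)\cdot\frac{\det(G)}{\det(\Delta(D_N))}$$ and $$\mu:=\mathbb{E}\Big[\mathrm{Tr}\big((X^{*}D_NX)^{-1}\big)\Big]=\frac{\det(G)}{\det(\Delta(D_N))},$$ where $\Delta(D_N)$ is the Vandermonde matrix associated to $D_N$ (the $N\times N$ matrix whose $(j,i)$ entry is $d_i^{N-j}$), and $G$ is the matrix constructed by replacing the $L$-th row of $\Delta(D_N)$ by the row $$\Big(d_1^{N-(L+1)}\log(d_1),\ldots,d_N^{N-(L+1)}\log(d_N)\Big).$$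
   Context: $\Omega_{L,N}=\{\Phi\in\mathbb{C}^{N\times L}:\Phi^{*}\Phi=I_L\}$ is the Stiefel manifold, and $d\phi$ is the isotropic (Haar) probability measure on it, i.e. the probability measure invariant under left multiplication by $N\times N$ unitary matrices. $A^*$ is the conjugate transpose and $\mathrm{Tr}$ is the non-normalized trace. *)

(* Defs.v *)
From HB Require Import structures.
From mathcomp Require Import all_boot all_order all_algebra.
From mathcomp Require Import spectral.
From mathcomp Require Import complex.
From mathcomp Require Import all_classical all_reals all_analysis.

Set Implicit Arguments.
Unset Strict Implicit.
Unset Printing Implicit Defensive.

Import Order.TTheory GRing.Theory Num.Theory.
Import numFieldNormedType.Exports.

Local Open Scope classical_set_scope.
Local Open Scope ring_scope.
Local Open Scope complex_scope.
Local Open Scope sesquilinear_scope.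

(* The Borel sigma-algebra of C is transported from R * R by z |-> (Re z, Im z);
   a space of matrices carries the product sigma-algebra, generated by the
   coordinate maps, which for complex entries is again the Borel one. *)

Section complex_measurable.
Variable R : realType.

HB.instance Definition _ := isPointed.Build R[i] 0.

Definition complex_coords (z : R[i]) : R * R := (complex.Re z, complex.Im z).

Definition complex_borel : set (set R[i]) :=
  <<s preimage_set_system [set: R[i]] complex_coords measurable >>.

Let complex_borel0 : complex_borel set0.
Proof. exact: (@sigma_algebra0 _ setT). Qed.

Let complex_borelC A : complex_borel A -> complex_borel (~` A).
Proof. exact: sigma_algebraC. Qed.

Let complex_borel_bigcup (F : (set R[i])^nat) :
  (forall k, complex_borel (F k)) -> complex_borel (\bigcup_k F k).
Proof. exact: sigma_algebra_bigcup. Qed.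

HB.instance Definition _ := @isMeasurable.Build default_measure_display
  R[i] complex_borel complex_borel0 complex_borelC complex_borel_bigcup.

End complex_measurable.

Section matrix_measurable.
Context d (T : measurableType d) (m n : nat).

Definition matrix_sigma_algebra : set (set 'M[T]_(m, n)) :=
  <<s \bigcup_(ij in [set: 'I_m * 'I_n])
        preimage_set_system [set: 'M[T]_(m, n)]
          (fun M : 'M[T]_(m, n) => M ij.1 ij.2) measurable >>.

Let matrix_sigma_algebra0 : matrix_sigma_algebra set0.
Proof. exact: (@sigma_algebra0 _ setT). Qed.

Let matrix_sigma_algebraC A :
  matrix_sigma_algebra A -> matrix_sigma_algebra (~` A).
Proof. exact: sigma_algebraC. Qed.

Let matrix_sigma_algebra_bigcup (F : (set 'M[T]_(m, n))^nat) :
  (forall k, matrix_sigma_algebra (F k)) ->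
  matrix_sigma_algebra (\bigcup_k F k).
Proof. exact: sigma_algebra_bigcup. Qed.

HB.instance Definition _ := @isMeasurable.Build d 'M[T]_(m, n)
  matrix_sigma_algebra matrix_sigma_algebra0 matrix_sigma_algebraC
  matrix_sigma_algebra_bigcup.

End matrix_measurable.

Section complex_integral.
Context d (T : measurableType d) (R : realType).
Variables (mu : {measure set T -> \bar R}) (D : set T) (f : T -> R[i]).

Definition cintegrable : Prop :=
  mu.-integrable D (fun x => (complex.Re (f x))%:E) /\
  mu.-integrable D (fun x => (complex.Im (f x))%:E).

(* As with Rintegral, only meaningful for integrable functions. *)
Definition cintegral : R[i] :=
  Rintegral mu D (fun x => complex.Re (f x)) +i*
  Rintegral mu D (fun x => complex.Im (f x)).

End complex_integral.

Section gaussian.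
Context d (T : measurableType d) (R : realType) (P : probability T R).

(* Circularly symmetric: the real and imaginary parts are independent real
   Gaussians of mean 0 and variance 1/2, so that E |Z|^2 = 1.  The second
   parameter of normal_prob is the standard deviation. *)
Definition standard_complex_gaussian (Z : T -> R[i]) : Prop :=
  forall A B : set R, measurable A -> measurable B ->
    P [set t | A (complex.Re (Z t)) /\ B (complex.Im (Z t))] =
    (normal_prob 0 (Num.sqrt (2^-1)) A * normal_prob 0 (Num.sqrt (2^-1)) B)%E.

Definition mutually_independent d' (T' : measurableType d') (I : finType)
    (Z : I -> T -> T') : Prop :=
  forall (J : {set I}) (B : I -> set T'), (forall i, measurable (B i)) ->
    P (\bigcap_(i in [set` J]) (Z i @^-1` B i)) =
    (\prod_(i in J) P (Z i @^-1` B i))%E.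

Definition complex_gaussian_matrix (N L : nat)
    (X : {RV P >-> 'M[R[i]]_(N, L)}) : Prop :=
  (forall i j, standard_complex_gaussian (fun t => X t i j)) /\
  mutually_independent (fun (ij : 'I_N * 'I_L) t => X t ij.1 ij.2).

End gaussian.

Section stiefel.
Variables (R : realType) (N L : nat).

Definition stiefel : set 'M[R[i]]_(N, L) :=
  [set Phi | Phi^t* *m Phi = 1%:M].

(* The isotropic measure is seen as a probability measure on all N x L
   matrices that gives full mass to the Stiefel manifold. *)
Definition isotropic (phi : probability 'M[R[i]]_(N, L) R) : Prop :=
  phi stiefel = 1%E /\
  forall U : 'M[R[i]]_N, U \is unitarymx ->
    forall A : set 'M[R[i]]_(N, L), measurable A ->
      phi ((fun Phi => U *m Phi) @^-1` A) = phi A.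

End stiefel.

Arguments stiefel : clear implicits.

Section formula.
Variables (R : realType) (N L : nat) (d : 'I_N -> R).

Definition Dmx : 'M[R[i]]_N := diag_mx (\row_i (d i)%:C).

(* invmx is the identity on singular matrices; for d > 0 the matrix inverted
   here is singular only when A has rank less than L. *)
Definition trace_inv (A : 'M[R[i]]_(N, L)) : R[i] :=
  \tr (invmx (A^t* *m Dmx *m A)).

(* Rows are numbered from 0, so row j is the (j+1)-st row. *)
Definition vandermonde : 'M[R]_N := \matrix_(j, i) d i ^+ (N - j.+1).

Definition Gmx : 'M[R]_N :=
  \matrix_(j, i) if j.+1 == L then d i ^+ (N - L.+1) * ln (d i)
                 else vandermonde j i.

End formula.

(* Main.v *)
(* Write W = X^* D X.  Since the law of X is invariant under unitary matrices on
   both sides, E[det(X^* A X) / det(s + W)] reduces to an integral over a single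
   Gaussian column, hence to the integral over r >= 0 of e^{-sr} times an explicit
   rational function of r.  For A = D it is 1 - s \int e^{-sr} Q(r) dr; letting s
   tend to 0 shows that W is almost surely invertible and that E Tr(W^{-1}) is the
   integral of Q, whose partial fraction coefficients are cofactors of the
   Vandermonde matrix.  For A = D + e_i e_i^*, summing over i and letting s tend
   to 0 gives E Tr(X^* X W^{-1}) = (N - L) E Tr(W^{-1}).
   This last expectation is the integral over the Stiefel manifold.  A square
   Gaussian matrix is G = T U with T lower triangular and U unitary, and
   K(G) = U^* D U satisfies K(G V) = V^* K(G) V for unitary V.  Hence
   E_G Tr((Phi^* K(G) Phi)^{-1}) does not depend on the point Phi of the manifold.
   Integrating it over Phi gives the Haar integral, by left invariance; writing
   X = Phi A, which turns it into E_G Tr(X^* X (X^* K(G) X)^{-1}), and integrating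
   over X gives E Tr(X^* X W^{-1}). *)

From HB Require Import structures.
Require Import Defs.
From mathcomp Require Import all_boot all_order all_algebra.
From mathcomp Require Import spectral complex.
From mathcomp Require Import all_classical all_reals all_analysis.
From mathcomp Require Import perm measurable_realfun ring lra zify.

Set Implicit Arguments.
Unset Strict Implicit.
Unset Printing Implicit Defensive.

Import Order.TTheory GRing.Theory Num.Theory.
Import numFieldNormedType.Exports.

Local Open Scope classical_set_scope.
Local Open Scope ring_scope.
Local Open Scope complex_scope.

(** * Measurability of matrix operations *)

(** Every integrand is nonnegative, so Tonelli and monotone convergence carry the argument, and
    integrability is read off at the end. Using ratios of determinants with s > 0 avoids inverting W
    before it is known to be invertible. The reduction to one column: 1/det(s + W) is s^-L times the
    Gaussian average over z of exp(-z^* W z / s). Right unitary invariance turns X z into the first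
    column of X times a scalar of modulus |z|, and integrating z out leaves (s + q)^-L, where q is
    the quadratic form of D at that column. Given the column, the determinant in the numerator is a
    multiple of the determinant for a Schur complement, whose mean is an elementary symmetric
    function of the eigenvalues. A gamma integral for (s + q)^-L introduces r, after which the
    average over the column is explicit. On the Haar side K(G) has to be measurable in G, so it is
    assembled from the orthogonal projections onto the spans of leading rows of G, which are
    rational in the entries of G and their conjugates where G is invertible, and not from the factor
    U itself. *)

Lemma measurable_entry d' (S : measurableType d') m n (i : 'I_m) (j : 'I_n) :
  measurable_fun setT (fun M : 'M[S]_(m, n) => M i j).
Proof.
move=> _ B mB; rewrite setTI; apply: sub_sigma_algebra.
by exists (i, j) => //=; exists B => //; rewrite setTI.
Qed.

Lemma measurable_complex_coords (R : realType) :
  measurable_fun setT (@complex_coords R).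
Proof.
move=> _ B mB; rewrite setTI; apply: sub_sigma_algebra.
by exists B => //; rewrite setTI.
Qed.

Section measurability.
Context d (T : measurableType d).

Lemma measurable_matrixP d' (S : measurableType d') m n (f : T -> 'M[S]_(m, n)) :
  measurable_fun setT f <->
  forall i j, measurable_fun setT (fun t => f t i j).
Proof.
split=> [mf i j|mf].
  exact: (measurableT_comp (measurable_entry i j) mf).
pose G := \bigcup_(ij in [set: 'I_m * 'I_n])
  preimage_set_system [set: 'M[S]_(m, n)] (fun M => M ij.1 ij.2) measurable.
apply: (@measurability _ _ _ _ _ _ G) => //.
move=> _ [_ [[i j] _ /= [B mB <-]] <-].
by rewrite setTI; apply: (mf i j).
Qed.

Variable R : realType.
Implicit Types f g : T -> R[i].

Lemma measurable_complexP f :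
  measurable_fun setT f <->
  measurable_fun setT (fun t => complex.Re (f t)) /\
  measurable_fun setT (fun t => complex.Im (f t)).
Proof.
split=> [mf|[mr mi]].
  have mc : measurable_fun setT (fun t => complex_coords (f t)).
    exact: (measurableT_comp (@measurable_complex_coords R) mf).
  by split; [exact: (measurableT_comp measurable_fst mc)|
             exact: (measurableT_comp measurable_snd mc)].
apply: (@measurability _ _ _ _ _ _
  (preimage_set_system [set: R[i]] (@complex_coords R) measurable)) => //.
move=> _ [_ [B mB <-] <-]; rewrite setTI.
have mc : measurable_fun setT (fun t => complex_coords (f t)).
  exact: measurable_fun_pair.
by have := mc measurableT _ mB; rewrite setTI.
Qed.

Lemma measurable_cRe f : measurable_fun setT f ->
  measurable_fun setT (fun t => complex.Re (f t)).
Proof. by case/measurable_complexP. Qed.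

Lemma measurable_cIm f : measurable_fun setT f ->
  measurable_fun setT (fun t => complex.Im (f t)).
Proof. by case/measurable_complexP. Qed.

Lemma measurable_cD f g : measurable_fun setT f -> measurable_fun setT g ->
  measurable_fun setT (fun t => f t + g t).
Proof.
move=> /measurable_complexP[fr fi] /measurable_complexP[gr gi].
apply/measurable_complexP; split.
  rewrite (_ : (fun t => _) = (fun t => complex.Re (f t) + complex.Re (g t))).
    exact: measurable_funD.
  by apply/funext => t; rewrite raddfD.
rewrite (_ : (fun t => _) = (fun t => complex.Im (f t) + complex.Im (g t))).
  exact: measurable_funD.
by apply/funext => t; rewrite raddfD.
Qed.

Lemma measurable_cM f g : measurable_fun setT f -> measurable_fun setT g ->
  measurable_fun setT (fun t => f t * g t).
Proof.
move=> /measurable_complexP[fr fi] /measurable_complexP[gr gi].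
apply/measurable_complexP; split.
  rewrite (_ : (fun t => _) = (fun t => complex.Re (f t) * complex.Re (g t) -
    complex.Im (f t) * complex.Im (g t))).
    by apply: measurable_funB; apply: measurable_funM.
  by apply/funext => t; case: (f t) (g t) => a b [c e].
rewrite (_ : (fun t => _) = (fun t => complex.Re (f t) * complex.Im (g t) +
  complex.Im (f t) * complex.Re (g t))).
  by apply: measurable_funD; apply: measurable_funM.
by apply/funext => t; case: (f t) (g t) => a b [c e].
Qed.

Lemma measurable_cJ f : measurable_fun setT f ->
  measurable_fun setT (fun t => (f t)^*%C).
Proof.
move=> /measurable_complexP[fr fi]; apply/measurable_complexP; split.
  by rewrite (_ : (fun t => _) = (fun t => complex.Re (f t)))//;
    apply/funext => t; case: (f t).
rewrite (_ : (fun t => _) = (fun t => - complex.Im (f t))).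
  exact: measurable_funN.
by apply/funext => t; case: (f t).
Qed.

Lemma measurable_invr (h : T -> R) : measurable_fun setT h ->
  measurable_fun setT (fun t => (h t)^-1).
Proof.
move=> mh.
rewrite (_ : (fun t => _) = (fun t => if h t == 0 then 0 else (h t)^-1)); last first.
  by apply/funext => t; case: eqP => // ->; rewrite invr0.
rewrite (_ : (fun t => _) = (fun x : R => if x == 0 then 0 else x^-1) \o h)//.
apply: measurableT_comp => //.
apply: measurable_fun_if => //.
- exact: measurable_fun_eqr.
- rewrite setTI (_ : _ @^-1` _ = [set x : R | x != 0]); last first.
    by apply/seteqP; split => x /=; case: eqP.
  apply: open_continuous_measurable_fun; first exact: open_neq.
  by move=> x; rewrite inE/= => x0; exact: inv_continuous.
Qed.

Lemma measurable_cV f : measurable_fun setT f ->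
  measurable_fun setT (fun t => (f t)^-1).
Proof.
move=> /measurable_complexP[fr fi].
have mn : measurable_fun setT (fun t => ((complex.Re (f t)) ^+ 2 + (complex.Im (f t)) ^+ 2)^-1).
  by apply: measurable_invr; apply: measurable_funD; apply: measurable_funX.
apply/measurable_complexP; split.
  rewrite (_ : (fun t => _) = (fun t => complex.Re (f t) *
      ((complex.Re (f t)) ^+ 2 + (complex.Im (f t)) ^+ 2)^-1)).
    exact: measurable_funM.
  by apply/funext => t; case: (f t).
rewrite (_ : (fun t => _) = (fun t => - (complex.Im (f t) *
    ((complex.Re (f t)) ^+ 2 + (complex.Im (f t)) ^+ 2)^-1))).
  by apply: measurable_funN; exact: measurable_funM.
by apply/funext => t; case: (f t).
Qed.

Lemma measurable_csum (I : Type) (s : seq I) (P : pred I) (h : I -> T -> R[i]) :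
  (forall i, measurable_fun setT (h i)) ->
  measurable_fun setT (fun t => \sum_(i <- s | P i) h i t).
Proof.
move=> mh; elim: s => [|x s IH].
  rewrite (_ : (fun t => _) = cst 0); first exact: measurable_cst.
  by apply/funext => t; rewrite big_nil.
case Px : (P x); last first.
  rewrite (_ : (fun t => _) = (fun t => \sum_(i <- s | P i) h i t))//.
  by apply/funext => t; rewrite big_cons Px.
rewrite (_ : (fun t => _) = (fun t => h x t + \sum_(i <- s | P i) h i t)).
  exact: measurable_cD.
by apply/funext => t; rewrite big_cons Px.
Qed.

Lemma measurable_cprod (I : Type) (s : seq I) (P : pred I) (h : I -> T -> R[i]) :
  (forall i, measurable_fun setT (h i)) ->
  measurable_fun setT (fun t => \prod_(i <- s | P i) h i t).
Proof.
move=> mh; elim: s => [|x s IH].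
  rewrite (_ : (fun t => _) = cst 1); first exact: measurable_cst.
  by apply/funext => t; rewrite big_nil.
case Px : (P x); last first.
  rewrite (_ : (fun t => _) = (fun t => \prod_(i <- s | P i) h i t))//.
  by apply/funext => t; rewrite big_cons Px.
rewrite (_ : (fun t => _) = (fun t => h x t * \prod_(i <- s | P i) h i t)).
  exact: measurable_cM.
by apply/funext => t; rewrite big_cons Px.
Qed.

Lemma measurable_real_sum (I : Type) (s : seq I) (P : pred I) (h : I -> T -> R) :
  (forall i, measurable_fun setT (h i)) ->
  measurable_fun setT (fun t => \sum_(i <- s | P i) h i t).
Proof.
move=> mh; elim: s => [|x s IH].
  rewrite (_ : (fun t => _) = cst 0); first exact: measurable_cst.
  by apply/funext => t; rewrite big_nil.
case Px : (P x); last first.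
  rewrite (_ : (fun t => _) = (fun t => \sum_(i <- s | P i) h i t))//.
  by apply/funext => t; rewrite big_cons Px.
rewrite (_ : (fun t => _) = (fun t => h x t + \sum_(i <- s | P i) h i t)).
  exact: measurable_funD.
by apply/funext => t; rewrite big_cons Px.
Qed.

Lemma measurable_mxM m n p (f : T -> 'M[R[i]]_(m, n)) (g : T -> 'M[R[i]]_(n, p)) :
  measurable_fun setT f -> measurable_fun setT g ->
  measurable_fun setT (fun t => f t *m g t).
Proof.
move=> /measurable_matrixP mf /measurable_matrixP mg.
apply/measurable_matrixP => i j.
rewrite (_ : (fun t => _) = (fun t => \sum_k f t i k * g t k j)); last first.
  by apply/funext => t; rewrite mxE.
by apply: measurable_csum => k; exact: measurable_cM.
Qed.

Lemma measurable_mxD m n (f g : T -> 'M[R[i]]_(m, n)) :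
  measurable_fun setT f -> measurable_fun setT g ->
  measurable_fun setT (fun t => f t + g t).
Proof.
move=> /measurable_matrixP mf /measurable_matrixP mg.
apply/measurable_matrixP => i j.
rewrite (_ : (fun t => _) = (fun t => f t i j + g t i j)); last first.
  by apply/funext => t; rewrite mxE.
exact: measurable_cD.
Qed.

Lemma measurable_mxN m n (f : T -> 'M[R[i]]_(m, n)) :
  measurable_fun setT f -> measurable_fun setT (fun t => - f t).
Proof.
move=> /measurable_matrixP mf.
apply/measurable_matrixP => i j.
rewrite (_ : (fun t => _) = (fun t => -1 * f t i j)).
  by apply: measurable_cM => //; exact: measurable_cst.
by apply/funext => t; rewrite !mxE mulN1r.
Qed.

Lemma measurable_mxtC m n (f : T -> 'M[R[i]]_(m, n)) :
  measurable_fun setT f -> measurable_fun setT (fun t => (f t)^t* )%sesqui.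
Proof.
move=> /measurable_matrixP mf.
apply/measurable_matrixP => i j.
rewrite (_ : (fun t => _) = (fun t => (f t j i)^*%C)); last first.
  by apply/funext => t; rewrite !mxE.
exact: measurable_cJ.
Qed.

Lemma measurable_det n (f : T -> 'M[R[i]]_n) :
  measurable_fun setT f -> measurable_fun setT (fun t => \det (f t)).
Proof.
move=> /measurable_matrixP mf; rewrite /determinant.
apply: measurable_csum => s; apply: measurable_cM; first exact: measurable_cst.
by apply: measurable_cprod => i; exact: mf.
Qed.

Lemma measurable_trace n (f : T -> 'M[R[i]]_n) :
  measurable_fun setT f -> measurable_fun setT (fun t => \tr (f t)).
Proof.
move=> /measurable_matrixP mf; rewrite /mxtrace.
by apply: measurable_csum => i; exact: mf.
Qed.

(** Cramer's rule where the determinant is nonzero; elsewhere [invmx] returns its argument, so the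
    function is glued from two measurable pieces. *)
Lemma measurable_invmx n (f : T -> 'M[R[i]]_n) :
  measurable_fun setT f -> measurable_fun setT (fun t => invmx (f t)).
Proof.
move=> mf; apply/measurable_matrixP => i j.
have md := measurable_det mf.
rewrite (_ : (fun t => _) = (fun t => if [&& complex.Re (\det (f t)) == 0 & complex.Im (\det (f t)) == 0]
   then f t i j else (\det (f t))^-1 * cofactor (f t) j i)).
  apply: measurable_fun_ifT => //.
  - apply: measurable_and => /=.
      by apply: measurable_fun_eqr; [exact: measurable_cRe|exact: measurable_cst].
    by apply: measurable_fun_eqr; [exact: measurable_cIm|exact: measurable_cst].
  - by move/measurable_matrixP : mf; exact.
  - apply: measurable_cM; first exact: measurable_cV.
    rewrite /cofactor; apply: measurable_cM; first exact: measurable_cst.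
    apply: measurable_det; apply/measurable_matrixP => k l.
    rewrite (_ : (fun t => _) = (fun t => f t (lift j k) (lift i l))); last first.
      by apply/funext => t; rewrite !mxE.
    by move/measurable_matrixP : mf; exact.
apply/funext => t; rewrite /invmx unitmxE unitfE.
have -> : [&& complex.Re (\det (f t)) == 0 & complex.Im (\det (f t)) == 0] = (\det (f t) == 0).
  by rewrite eq_complex.
by case: eqP => //= _; rewrite !mxE.
Qed.

End measurability.

Section push.
Context d d' (T : measurableType d) (T' : measurableType d') (R : realType).
Variables (P : probability T R) (f : T -> T') (mf : measurable_fun setT f).

Definition push : probability T' R :=
  let X : {mfun T >-> T'} := HB.pack f (isMeasurableFun.Build _ _ _ _ f mf) in
  distribution P X.

Lemma pushE A : push A = P (f @^-1` A). Proof. by []. Qed.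

Lemma ge0_integral_push (F : T' -> \bar R) :
  measurable_fun setT F -> (forall x, 0 <= F x)%E ->
  (\int[push]_x F x = \int[P]_x F (f x))%E.
Proof. by move=> mF F0; rewrite ge0_integral_distribution. Qed.

End push.

Section eq_prob_integral.
Context d (T : measurableType d) (R : realType) (P Q : probability T R).

Lemma eq_probability_integral (F : T -> \bar R) :
  (forall A, measurable A -> P A = Q A) ->
  (\int[P]_x F x = \int[Q]_x F x)%E.
Proof. by move=> PQ; apply: eq_measure_integral => A mA _; exact: PQ. Qed.

End eq_prob_integral.

(** * Rotation invariance of the plane Gaussian measure *)

Section gauss1.
Variable R : realType.
Local Notation leb := (@lebesgue_measure R).

Definition gauss_sd : R := Num.sqrt 2^-1.

Definition gauss1 : probability (measurableTypeR R) R := normal_prob 0 gauss_sd.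

Lemma gauss_sd_neq0 : gauss_sd != 0.
Proof. by rewrite gt_eqF// sqrtr_gt0 invr_gt0. Qed.

Definition gauss_pdf (x : R) : R := normal_pdf 0 gauss_sd x.

Lemma gauss_pdfE x : gauss_pdf x = normal_peak gauss_sd * expR (- x ^+ 2).
Proof.
rewrite /gauss_pdf normal_pdfE ?gauss_sd_neq0// /normal_fun subr0.
by rewrite sqr_sqrtr ?invr_ge0// -mulr_natr mulVf// divr1.
Qed.

Lemma gauss_pdf_ge0 x : 0 <= gauss_pdf x.
Proof. exact: normal_pdf_ge0. Qed.

Lemma measurable_gauss_pdf : measurable_fun setT gauss_pdf.
Proof. exact: measurable_normal_pdf. Qed.

(** The change of measure brings in the Radon-Nikodym derivative, which agrees almost everywhere
    with [gauss_pdf] because both have the same integral over every measurable set. *)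
Lemma integral_gauss1 (f : R -> \bar R) :
  measurable_fun setT f -> (forall x, 0 <= f x)%E ->
  (\int[gauss1]_x f x = \int[leb]_x (f x * (gauss_pdf x)%:E))%E.
Proof.
move=> mf f0.
have dom : gauss1 `<< leb by exact: normal_prob_dominates.
rewrite -(@Radon_Nikodym_SigmaFinite.change_of_variables _ _ _ gauss1 leb)//.
have mpdf : measurable_fun [set: R] (fun x => (gauss_pdf x)%:E).
  by apply/measurable_EFinP; exact: measurable_gauss_pdf.
apply: ge0_ae_eq_integral => //.
- by apply: emeasurable_funM => //; apply: measurable_int; exact: Radon_Nikodym_SigmaFinite.f_integrable.
- exact: emeasurable_funM.
- by move=> x _; rewrite mule_ge0// Radon_Nikodym_SigmaFinite.f_ge0.
- by move=> x _; rewrite mule_ge0// lee_fin gauss_pdf_ge0.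
- apply: ae_eqe_mul2l.
  apply: integral_ae_eq => //.
  + exact: Radon_Nikodym_SigmaFinite.f_integrable.
  + move=> E _ mE; rewrite -Radon_Nikodym_SigmaFinite.f_integral//.
Qed.

Lemma lebesgue_measureD (t : R) (A : set R) : measurable A ->
  pushforward leb ((fun x => x + t) : _ -> measurableTypeR R) A = leb A.
Proof.
move=> mA; apply/esym/lebesgue_measure_unique => //=.
  exact: measurable_funD.
move=> mt _ [[a b] _ <-].
rewrite /pushforward (_ : _ @^-1` _ = `]a - t, b - t]%classic).
  rewrite !lebesgue_measure_itv/= !lte_fin ltrD2r.
  by case: ifP => // _; rewrite -!EFinB; congr EFin; ring.
by apply/seteqP; split => x /=; rewrite !in_itv/= ltrBlDr lerBrDr.
Qed.

Lemma ge0_integral_shift (t : R) (f : R -> \bar R) :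
  measurable_fun [set: R] f -> (forall r, 0 <= f r)%E ->
  (\int[leb]_x f ((x : R) + t)%R = \int[leb]_x f x)%E.
Proof.
move=> mf f0.
transitivity (\int[pushforward leb ((fun x => x + t)%R : _ -> measurableTypeR R)]_x f x)%E.
  by rewrite ge0_integral_pushforward//=; exact: measurable_funD.
apply: eq_measure_integral => //=.
  exact: measurable_funD.
by move=> mt A mA _; exact: lebesgue_measureD.
Qed.

Lemma ge0_integral_opp (f : R -> \bar R) :
  measurable_fun [set: R] f -> (forall r, 0 <= f r)%E ->
  (\int[leb]_x f (- (x : R))%R = \int[leb]_x f x)%E.
Proof.
move=> mf f0.
transitivity (\int[pushforward leb (-%R : _ -> measurableTypeR R)]_x f x)%E.
  by rewrite ge0_integral_pushforward//=.
by apply: eq_measure_integral => //= A mA _; exact: lebesgue_measureN.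
Qed.

Section plane.
Local Open Scope ereal_scope.

Definition plane_int (H : R * R -> \bar R) := \int[leb]_x \int[leb]_y H (x, y).

Lemma plane_int_swap H : measurable_fun setT H -> (forall z, 0 <= H z) ->
  plane_int H = \int[leb]_y \int[leb]_x H (x, y).
Proof.
move=> mH H0.
exact: (@fubini_tonelli _ _ _ _ R leb leb H mH H0).
Qed.

Lemma measurable_linear2 (a b c d : R) :
  measurable_fun setT (fun z : R * R => (a * z.1 + b * z.2, c * z.1 + d * z.2)%R).
Proof.
by apply: measurable_fun_pair => /=; apply: measurable_funD; apply: measurable_funM => //;
  exact: measurable_cst.
Qed.

Lemma plane_int_shearr (t : R) H : measurable_fun setT H -> (forall z, 0 <= H z) ->
  plane_int (fun z => H (z.1, t * z.1 + z.2)%R) = plane_int H.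
Proof.
move=> mH H0; apply: eq_integral => x _.
rewrite -[RHS](@ge0_integral_shift (t * (x : R)))//.
  by apply: eq_integral => y _ /=; rewrite addrC.
exact: measurableT_comp.
Qed.

Lemma plane_int_shearl (t : R) H : measurable_fun setT H -> (forall z, 0 <= H z) ->
  plane_int (fun z => H (z.1 + t * z.2, z.2)%R) = plane_int H.
Proof.
move=> mH H0.
have mS : measurable_fun setT (fun z : R * R => H (z.1 + t * z.2, z.2)%R).
  apply: measurableT_comp => //.
  have := measurable_linear2 1 t 0 1; congr measurable_fun.
  by apply/funext => z /=; rewrite !mul1r mul0r add0r.
apply: (etrans (plane_int_swap mS (fun z => H0 _))).
apply: (etrans _ (esym (plane_int_swap mH H0))).
apply: eq_integral => y _.
rewrite -[RHS](@ge0_integral_shift (t * (y : R)))//.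
exact: measurableT_comp.
Qed.

(* A rotation with nonzero sine is a product of three shears. *)
Lemma plane_int_rot (c s : R) H : (c ^+ 2 + s ^+ 2 = 1)%R ->
  measurable_fun setT H -> (forall z, 0 <= H z) ->
  plane_int (fun z => H (c * z.1 - s * z.2, s * z.1 + c * z.2)%R) = plane_int H.
Proof.
move=> cs mH H0.
(* With zero sine the rotation is the identity or the point reflection; the latter is handled one
   coordinate at a time. *)
have [s0|s0] := eqVneq s 0%R.
  have /eqP : (c ^+ 2 = 1)%R by rewrite -cs s0 expr0n addr0.
  rewrite sqrf_eq1 => /orP[|] /eqP->.
    by congr plane_int; apply/funext => -[x y] /=; rewrite s0 !mul1r !mul0r subr0 add0r.
  transitivity (plane_int (fun z => H (- z.1, - z.2)%R)).
    congr plane_int; apply/funext => -[x y] /=; congr (H (_, _)); rewrite s0; ring.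
  rewrite /plane_int /=.
  transitivity (\int[leb]_x \int[leb]_y H ((- (x : R))%R, y)).
    apply: eq_integral => x _; rewrite -[RHS]ge0_integral_opp//.
    by apply: measurableT_comp => //; exact: measurable_fun_pair.
  rewrite (@ge0_integral_opp (fun x : R => \int[leb]_y H (x, y)))//.
    exact: (@measurable_fun_fubini_tonelli_F _ _ _ _ R leb H mH H0).
  by move=> x; apply: integral_ge0.
(* For an angle x with cosine [c] and sine [s] this is -tan(x/2): the rotation is the shear by [t],
   then by [s], then by [t] again. *)
pose t := ((c - 1) / s)%R.
pose H1 (z : R * R) := H (z.1 + t * z.2, z.2)%R.
pose H2 (z : R * R) := H1 (z.1, s * z.1 + z.2)%R.
have mH1 : measurable_fun setT H1.
  apply: measurableT_comp => //.
  have := measurable_linear2 1 t 0 1; congr measurable_fun.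
  by apply/funext => z /=; rewrite !mul1r mul0r add0r.
have mH2 : measurable_fun setT H2.
  apply: measurableT_comp => //.
  have := measurable_linear2 1 0 s 1; congr measurable_fun.
  by apply/funext => z /=; rewrite !mul1r mul0r addr0.
apply: (etrans _ (plane_int_shearl t mH H0)).
apply: (etrans _ (plane_int_shearr s mH1 (fun z => H0 _))).
apply: (etrans _ (plane_int_shearl t mH2 (fun z => H0 _))).
congr plane_int; apply/funext => -[x y]; rewrite /H2 /H1 /=; congr (H (_, _)).
    have -> : (s * (x + t * y) + y = s * x + c * y)%R.
      by rewrite /t; field.
    have -> : (c * x = x + t * s * x)%R by rewrite /t; field.
    have -> : (s * y = - (t + t * c) * y)%R.
      have -> : (t + t * c = (c ^+ 2 - 1) / s)%R by rewrite /t; field.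
      have -> : (c ^+ 2 = 1 - s ^+ 2)%R by rewrite -cs addrK.
      by field.
    by ring.
by rewrite /t; field.
Qed.

End plane.

(** The variance 1/2 makes the density of a pair a function of [x ^+ 2 + y ^+ 2], so the rotation
    only has to preserve Lebesgue measure on the plane. *)
Lemma gauss1_rot (c s : R) (H : R * R -> \bar R) : c ^+ 2 + s ^+ 2 = 1 ->
  measurable_fun setT H -> (forall z, 0 <= H z)%E ->
  (\int[gauss1]_x \int[gauss1]_y H (c * (x : R) - s * (y : R), s * (x : R) + c * (y : R))%R =
   \int[gauss1]_x \int[gauss1]_y H (x, y))%E.
Proof.
move=> cs mH H0.
have dens (K : R * R -> \bar R) : measurable_fun setT K -> (forall z, 0 <= K z)%E ->
  (\int[gauss1]_x \int[gauss1]_y K (x, y) =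
   plane_int (fun z => K z * (gauss_pdf z.1 * gauss_pdf z.2)%:E))%E.
  move=> mK K0; rewrite integral_gauss1; last 2 first.
  - exact: (@measurable_fun_fubini_tonelli_F _ _ _ _ R gauss1 K mK K0).
  - by move=> x; apply: integral_ge0.
  apply: eq_integral => x _.
  have mKx : measurable_fun setT (fun y => K (x, y)) by exact: measurableT_comp.
  rewrite integral_gauss1// -ge0_integralZr//=.
  - by apply: eq_integral => y _; rewrite -muleA -EFinM [in RHS]mulrC.
  - apply: emeasurable_funM => //; apply/measurable_EFinP; exact: measurable_gauss_pdf.
  - by move=> y _; rewrite mule_ge0// lee_fin gauss_pdf_ge0.
  - by rewrite lee_fin gauss_pdf_ge0.
have mlin : measurable_fun setT (fun z : R * R => (c * z.1 - s * z.2, s * z.1 + c * z.2)%R).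
  have := measurable_linear2 c (- s) s c; congr measurable_fun.
  by apply/funext => z /=; rewrite mulNr.
have mpdf2 : measurable_fun setT (fun z : R * R => (gauss_pdf z.1 * gauss_pdf z.2)%:E).
  apply/measurable_EFinP; apply: measurable_funM;
  by apply: measurableT_comp => //; exact: measurable_gauss_pdf.
have mHl : measurable_fun setT (fun z : R * R => H (c * z.1 - s * z.2, s * z.1 + c * z.2)%R).
  exact: measurableT_comp.
pose K z := (H z * (gauss_pdf z.1 * gauss_pdf z.2)%:E)%E.
have mK : measurable_fun setT K by exact: emeasurable_funM.
have K0 z : (0 <= K z)%E by rewrite mule_ge0// lee_fin mulr_ge0// gauss_pdf_ge0.
apply: (etrans (dens _ mHl (fun z => H0 _))).
apply: (etrans _ (esym (dens H mH H0))).
apply: (etrans _ (plane_int_rot cs mK K0)).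
rewrite /K; congr plane_int; apply/funext => -[x y] /=; congr (_ * _%:E)%E.
  have pdf2 (u v : R) : gauss_pdf u * gauss_pdf v =
      normal_peak gauss_sd ^+ 2 * expR (- (u ^+ 2 + v ^+ 2)).
    by rewrite !gauss_pdfE opprD expRD; ring.
  rewrite !pdf2; congr (_ * expR (- _)).
  by rewrite -[LHS]mul1r -cs; ring.
Qed.

End gauss1.

(** * Real Gaussian vectors and orthogonal invariance *)

Section real_gauss.
Variable R : realType.

Definition vcons n (p : R * 'cV[R]_n) : 'cV[R]_n.+1 :=
  col_mx (p.1%:M : 'M[R]_1) p.2 : 'cV[R]_(1 + n).

Lemma vcons0 n (p : R * 'cV[R]_n) : vcons p ord0 0 = p.1.
Proof.
transitivity ((col_mx (p.1%:M : 'M[R]_1) p.2) (lshift n (ord0 : 'I_1)) 0).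
  by congr (vcons p _ 0); exact/val_inj.
by rewrite col_mxEu mxE eqxx mulr1n.
Qed.

Lemma vconsS n (p : R * 'cV[R]_n) i : vcons p (lift ord0 i) 0 = p.2 i 0.
Proof.
transitivity ((col_mx (p.1%:M : 'M[R]_1) p.2) (rshift 1 i) 0).
  by congr (vcons p _ 0); exact/val_inj.
by rewrite col_mxEd.
Qed.

Lemma vcons_eta n (v : 'cV[R]_(1 + n)) : v = vcons (v 0 0, dsubmx v).
Proof.
apply/matrixP => i j; rewrite (ord1 j).
have [i' ->|->] := unliftP ord0 i; last by rewrite vcons0.
rewrite vconsS /= mxE.
by congr (v _ _); exact/val_inj.
Qed.

Lemma mx_id_on n (A : 'M[R]_n) : (forall v : 'cV_n, A *m v = v) -> A = 1%:M.
Proof.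
move=> h; apply/matrixP => i j.
have := congr1 (fun M : 'cV_n => M i 0) (h (delta_mx j 0)).
by rewrite -colE !mxE andbT.
Qed.

Lemma measurable_vcons n : measurable_fun setT (@vcons n).
Proof.
apply/measurable_matrixP => i j; rewrite (ord1 j).
have [i' ->|->] := unliftP ord0 i.
  rewrite (_ : (fun t => _) = (fun p : R * 'cV[R]_n => p.2 i' 0)).
    exact: (measurableT_comp (measurable_entry i' 0) measurable_snd).
  by apply/funext => p; rewrite vconsS.
rewrite (_ : (fun t => _) = fst); first exact: measurable_fst.
by apply/funext => p; rewrite vcons0.
Qed.

(** Independent coordinates obtained by iterated binary products: integrals then peel off one
    coordinate at a time, in step with the block matrices. *)
Fixpoint rgauss n : probability 'cV[R]_n R :=
  match n return probability 'cV[R]_n R with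
  | 0 => dirac (0 : 'cV[R]_0)
  | m.+1 => push (gauss1 R \x rgauss m)%E (@measurable_vcons m)
  end.

Lemma integral_rgaussS n (F : 'cV[R]_n.+1 -> \bar R) :
  measurable_fun setT F -> (forall x, 0 <= F x)%E ->
  (\int[rgauss n.+1]_v F v =
   \int[gauss1 R]_x \int[rgauss n]_v F (vcons (x, v)))%E.
Proof.
move=> mF F0; rewrite ge0_integral_push//.
apply: (@fubini_tonelli1 _ _ _ _ R (gauss1 R) (rgauss n) (fun p => F (vcons p)) _ _) => //.
exact: measurableT_comp mF (@measurable_vcons n).
Qed.

Lemma rgauss_box n (A : 'I_n -> set R) : (forall i, measurable (A i)) ->
  rgauss n [set v | forall i, A i (v i 0)] = (\prod_i gauss1 R (A i))%E.
Proof.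
elim: n A => [|n IH] A mA.
  rewrite big_ord0 /= diracE mem_set//.
  by case.
rewrite big_ord_recl.
pose S := [set v : 'cV[R]_n | forall i, A (lift ord0 i) (v i 0)].
have mtl : measurable S.
  rewrite (_ : S = \bigcap_(i in [set: 'I_n]) ((fun v : 'cV[R]_n => v i 0) @^-1` A (lift ord0 i))).
    apply: fin_bigcap_measurable => // i _.
    rewrite -[X in measurable X]setTI.
    exact: (measurable_entry i 0).
  by apply/seteqP; split => v /= h i //=; exact: h.
transitivity ((gauss1 R \x rgauss n)%E (A ord0 `*` S)); last first.
  by rewrite -IH// (product_measure1E (gauss1 R) (rgauss n))//; exact: mA.
transitivity ((gauss1 R \x rgauss n)%E
  (@vcons n @^-1` [set v | forall i, A i (v i 0)])); first by [].
congr (product_measure1 _ _ _).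
apply/seteqP; split => -[x v] /=.
  by move=> h; split => [|i]; [have := h ord0; rewrite vcons0|have := h (lift ord0 i); rewrite vconsS].
case=> /= hx hv i; have [i' ->|->] := unliftP ord0 i; first by rewrite vconsS.
by rewrite vcons0.
Qed.

Definition rinv n (O : 'M[R]_n) : Prop := forall F : 'cV[R]_n -> \bar R,
  measurable_fun setT F -> (forall x, 0 <= F x)%E ->
  (\int[rgauss n]_v F (O *m v)%R = \int[rgauss n]_v F v)%E.

Lemma measurable_rmul m n (O : 'M[R]_(m, n)) :
  measurable_fun setT (fun v : 'cV[R]_n => O *m v).
Proof.
apply/measurable_matrixP => i j.
rewrite (_ : (fun t => _) = (fun t : 'cV[R]_n => \sum_k O i k * t k j)).
  apply: measurable_real_sum => k; apply: measurable_funM; first exact: measurable_cst.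
  exact: measurable_entry.
by apply/funext => v; rewrite mxE.
Qed.

Lemma rinvM n (A B : 'M[R]_n) : rinv A -> rinv B -> rinv (A *m B).
Proof.
move=> hA hB F mF F0.
under eq_integral do rewrite -mulmxA.
rewrite (hB (fun v => F (A *m v)))//; first exact: hA.
exact: measurableT_comp mF (measurable_rmul A).
Qed.

Lemma block_vcons n (O : 'M[R]_n) x v :
  block_mx (1%:M : 'M[R]_1) 0 0 O *m vcons (x, v) = vcons (x, O *m v).
Proof.
apply: etrans (mul_block_col _ _ _ _ _ _) _.
by rewrite !mul0mx mul1mx add0r addr0.
Qed.

Lemma rinv_block n (O : 'M[R]_n) : rinv O ->
  rinv (block_mx (1%:M : 'M[R]_1) 0 0 O : 'M[R]_(1 + n)).
Proof.
move=> hO F mF F0.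
apply: etrans (integral_rgaussS (measurableT_comp mF (measurable_rmul _)) (fun x => F0 _)) _.
rewrite [RHS](integral_rgaussS mF F0).
apply: eq_integral => x _.
apply: etrans (hO (fun v => F (vcons (x, v))) _ _) => //.
  by apply: eq_integral => v _; congr F; exact: block_vcons.
apply: measurableT_comp mF _; apply: measurableT_comp (@measurable_vcons n) _.
exact: measurable_fun_pair.
Qed.

Definition rot_mx n (c s : R) : 'M[R]_(1 + (1 + n)) :=
  block_mx (c%:M : 'M[R]_1) (row_mx ((- s)%:M : 'M[R]_1) 0)
    (col_mx (s%:M : 'M[R]_1) 0) (block_mx (c%:M : 'M[R]_1) 0 0 1%:M).

Lemma rot_mx_vcons n c s x y (w : 'cV[R]_n) :
  rot_mx n c s *m vcons (x, vcons (y, w)) =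
  vcons (c * x - s * y, vcons (s * x + c * y, w)).
Proof.
apply: etrans (mul_block_col _ _ _ _ _ _) _.
apply: etrans (congr2 (@col_mx _ _ _ _) (congr2 +%R (erefl _) (mul_row_col _ _ _ _))
  (congr2 +%R (mul_col_mx _ _ _) (mul_block_col _ _ _ _ _ _))) _.
rewrite /= !mul0mx !addr0 add0r mul1mx !mul_scalar_mx !scale_scalar_mx.
rewrite add_col_mx add0r -!raddfD/= mulNr.
by [].
Qed.

Lemma rinv_rot n c s : c ^+ 2 + s ^+ 2 = 1 -> rinv (rot_mx n c s).
Proof.
move=> cs F mF F0.
have mF1 : measurable_fun setT (fun v => F (rot_mx n c s *m v)).
  exact: measurableT_comp mF (measurable_rmul _).
have mvv : measurable_fun setT (fun p : (R * R) * 'cV[R]_n => vcons (p.1.1, vcons (p.1.2, p.2))).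
  apply: measurableT_comp (@measurable_vcons _) _; apply: measurable_fun_pair.
    exact: measurableT_comp.
  apply: measurableT_comp (@measurable_vcons _) _; apply: measurable_fun_pair => //.
  exact: measurableT_comp.
pose H (z : R * R) := (\int[rgauss n]_w F (vcons (z.1, vcons (z.2, w))))%E.
have mH : measurable_fun setT H.
  apply: (@measurable_fun_fubini_tonelli_F _ _ _ _ R (rgauss n)
    (fun p : (R * R) * 'cV[R]_n => F (vcons (p.1.1, vcons (p.1.2, p.2)))))%E => //.
  exact: measurableT_comp mF mvv.
have H0 z : (0 <= H z)%E by apply: integral_ge0.
have stepF (G : 'cV[R]_(n.+2) -> \bar R) : measurable_fun setT G -> (forall x, 0 <= G x)%E ->
   (\int[rgauss n.+2]_v G v = \int[gauss1 R]_x \int[gauss1 R]_y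
     \int[rgauss n]_w G (vcons (x, vcons (y, w))))%E.
  move=> mG G0; rewrite integral_rgaussS//; apply: eq_integral => x _.
  rewrite integral_rgaussS//.
  apply: measurableT_comp mG _; apply: measurableT_comp (@measurable_vcons n.+1) _.
  exact: measurable_fun_pair.
apply: (etrans (stepF _ mF1 (fun x => F0 _))).
apply: (etrans _ (esym (stepF _ mF F0))).
apply: (etrans _ (gauss1_rot cs mH H0)).
apply: eq_integral => x _; apply: eq_integral => y _; rewrite /H /=.
by apply: eq_integral => w _; rewrite rot_mx_vcons.
Qed.

Definition orthmx n (O : 'M[R]_n) := O^T *m O = 1%:M.

Lemma orthmxT n (O : 'M[R]_n) : orthmx O -> O *m O^T = 1%:M.
Proof. by move=> /mulmx1C. Qed.

Lemma orthmxM n (A B : 'M[R]_n) : orthmx A -> orthmx B -> orthmx (A *m B).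
Proof.
move=> hA hB; rewrite /orthmx trmx_mul mulmxA -(mulmxA B^T) hA mulmx1.
exact: hB.
Qed.

Lemma orthmx_tr n (A : 'M[R]_n) : orthmx A -> orthmx A^T.
Proof. by move=> h; rewrite /orthmx trmxK; exact: orthmxT. Qed.

Lemma orthmx_block n (O : 'M[R]_n) : orthmx O ->
  orthmx (block_mx (1%:M : 'M[R]_1) 0 0 O : 'M[R]_(1 + n)).
Proof.
move=> h; rewrite /orthmx tr_block_mx mulmx_block !trmx0 trmx1 !mul0mx !mulmx0.
by rewrite mul1mx !addr0 add0r h -scalar_mx_block.
Qed.

Lemma sqnorm_ge0 n (u : 'cV[R]_n) : 0 <= (u^T *m u) 0 0.
Proof. by rewrite mxE sumr_ge0// => i _; rewrite mxE -expr2 sqr_ge0. Qed.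

Lemma sqnorm_eq0 n (u : 'cV[R]_n) : (u^T *m u) 0 0 = 0 -> u = 0.
Proof.
rewrite mxE => /eqP; rewrite psumr_eq0; last by move=> i _; rewrite mxE -expr2 sqr_ge0.
move=> /allP h; apply/matrixP => i j; rewrite (ord1 j) !mxE; apply/eqP.
by have := h i (mem_index_enum _); rewrite mxE -expr2 sqrf_eq0.
Qed.

(* Reflection exchanging [w] and the vector [|w| e_0]. *)
Lemma householder n (w : 'cV[R]_(1 + n)) : exists2 O : 'M[R]_(1 + n), orthmx O &
  O *m w = Num.sqrt ((w^T *m w) 0 0) *: delta_mx 0 0.
Proof.
set l := Num.sqrt _; pose e : 'cV[R]_(1 + n) := delta_mx 0 0.
have l2 : l ^+ 2 = (w^T *m w) 0 0 by rewrite sqr_sqrtr// sqnorm_ge0.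
(* The reflection is along [w - l *: e], which must be nonzero. *)
have [->|wne] := eqVneq w (l *: e).
  exists 1%:M; first by rewrite /orthmx trmx1 mul1mx.
  by rewrite mul1mx.
pose u := w - l *: e.
have uT : u^T = w^T - l *: e^T by rewrite /u linearB/= linearZ.
pose q := (u^T *m u) 0 0.
have q0 : q != 0.
  by apply/eqP => /sqnorm_eq0 /eqP; rewrite subr_eq0; exact/negP.
have uu : u^T *m u = q%:M by rewrite [LHS]mx11_scalar.
have ee : e^T *m e = 1%:M.
  by apply/matrixP => i j; rewrite !ord1 trmx_delta mul_delta_mx !mxE !eqxx.
have we : w^T *m e = (w 0 0)%:M.
  rewrite [LHS]mx11_scalar; congr (_%:M); rewrite mxE (bigD1 0)//= big1 => [|i i0].
    by rewrite !mxE !eqxx mulr1 addr0.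
  by rewrite !mxE (negbTE i0) mulr0.
have ew : e^T *m w = (w 0 0)%:M.
  by rewrite -[LHS]trmxK trmx_mul trmxK we tr_scalar_mx.
have ww : w^T *m w = (l ^+ 2)%:M by rewrite [LHS]mx11_scalar l2.
have qE : q = 2 * (l ^+ 2 - l * w 0 0).
  have : u^T *m u = (2 * (l ^+ 2 - l * w 0 0))%:M.
    rewrite uT /u mulmxBl !mulmxBr -!scalemxAr -!scalemxAl ww we ew ee.
    rewrite !scale_scalar_mx -!raddfB/=; congr (_%:M); ring.
  by rewrite /q => ->; rewrite mxE eqxx mulr1n.
have uw : u^T *m w = (l ^+ 2 - l * w 0 0)%:M.
  rewrite uT mulmxBl -!scalemxAl ww ew.
  by rewrite !scale_scalar_mx -!raddfB/=.
pose O := 1%:M - (2 / q) *: (u *m u^T).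
have OT : O^T = O.
  by rewrite /O linearB/= trmx1 linearZ/= trmx_mul trmxK.
exists O.
  pose S := u *m u^T.
  have SS : S *m S = q *: S.
    by rewrite /S mulmxA -(mulmxA u) uu mul_mx_scalar scalemxAl.
  rewrite /orthmx OT /O -/S mulmxBl mul1mx mulmxBr mulmx1 -scalemxAl -scalemxAr.
  rewrite SS !scalerA (_ : 2 / q * (2 / q) * q = 2 / q + 2 / q); last by field.
  by rewrite scalerDl opprB addrK subrK.
rewrite /O mulmxBl mul1mx -scalemxAl -mulmxA uw mul_mx_scalar scalerA.
(* By [qE] the coefficient of [u] is 1, which leaves [w - u], the vector [l *: e]. *)
rewrite (_ : 2 / q * _ = 1) ?scale1r; last first.
  by move: q0; rewrite qE => q0; field; move: q0; apply: contra => /eqP; nra.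
by rewrite /u opprB addrC subrK.
Qed.

(** The transpose is the inverse, so it fixes the first basis vector as well; hence both the first
    column and the first row are trivial. *)
Lemma orthmx_fix_e0 n (M : 'M[R]_(1 + n)) : orthmx M ->
  M *m delta_mx 0 0 = delta_mx 0 0 :> 'cV_(1 + n) ->
  exists2 O, orthmx O & M = block_mx 1%:M 0 0 O.
Proof.
move=> hM Me.
have Mt : M^T *m delta_mx 0 0 = delta_mx 0 0 :> 'cV_(1 + n).
  by rewrite -{1}Me mulmxA hM mul1mx.
have col0 (A : 'M[R]_(1 + n)) i : A *m delta_mx 0 0 = delta_mx 0 0 :> 'cV_(1 + n) ->
   A i 0 = (i == 0)%:R.
  move=> /matrixP /(_ i 0); rewrite !mxE eqxx andbT => <-.
  rewrite (bigD1 0)//= big1 => [|k k0]; first by rewrite !mxE !eqxx mulr1 addr0.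
  by rewrite !mxE (negbTE k0) mulr0.
have ME : M = block_mx 1%:M 0 0 (drsubmx M).
  rewrite -[LHS]submxK; congr block_mx.
  - apply/matrixP => i j; rewrite !ord1 !mxE lshift0 col0//.
  - apply/matrixP => i j; rewrite !ord1 !mxE lshift0.
    by have := col0 _ (rshift 1 j) Mt; rewrite mxE => ->.
  - apply/matrixP => i j; rewrite !ord1 !mxE lshift0 col0//.
exists (drsubmx M) => //.
move: hM; rewrite /orthmx {1 2}ME tr_block_mx mulmx_block !trmx0 trmx1 !mul0mx !mulmx0.
rewrite mul1mx !addr0 (scalar_mx_block 1 n) => /eq_block_mx[_ _ _ <-].
exact/esym/add0r.
Qed.

Lemma orthmx_rot n c s : c ^+ 2 + s ^+ 2 = 1 -> orthmx (rot_mx n c s).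
Proof.
move=> cs; rewrite /orthmx.
have -> : (rot_mx n c s)^T = rot_mx n c (- s).
  by rewrite /rot_mx tr_block_mx tr_row_mx tr_col_mx tr_block_mx !tr_scalar_mx !trmx0 opprK.
apply: mx_id_on => v; rewrite -mulmxA.
rewrite (vcons_eta v) (vcons_eta (dsubmx (v : 'cV_(1 + (1 + n))))) !rot_mx_vcons.
congr (vcons (_, vcons (_, _))).
  by rewrite -[RHS]mul1r -cs; ring.
by rewrite -[RHS]mul1r -cs; ring.
Qed.

(* Two Householder reflections reduce an orthogonal matrix to a rotation of the
   first two coordinates, whence orthogonal invariance by induction. *)
Lemma orthmx_decomp n (O : 'M[R]_(1 + (1 + n))) : orthmx O ->
  exists Q1 Q2 c s, [/\ orthmx Q1, orthmx Q2, c ^+ 2 + s ^+ 2 = 1 &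
   O = block_mx (1%:M : 'M[R]_1) 0 0 Q1 *m rot_mx n c s *m block_mx (1%:M : 'M[R]_1) 0 0 Q2].
Proof.
move=> hO; pose o := O *m delta_mx 0 0 : 'cV_(1 + (1 + n)).
have oo : o^T *m o = 1%:M.
  rewrite /o trmx_mul mulmxA -(mulmxA _ O^T) hO mulmx1 trmx_delta mul_delta_mx.
  by apply/matrixP => i j; rewrite !ord1 !mxE.
pose c := o 0 0; pose w : 'cV_(1 + n) := dsubmx o.
have oE : o = col_mx c%:M w.
  rewrite -[LHS]vsubmxK; congr col_mx.
  apply/matrixP => i j; rewrite !ord1 [LHS]mxE [RHS]mxE eqxx mulr1n lshift0.
  by [].
have [Q1 hQ1 Q1w] := householder w.
pose s := Num.sqrt ((w^T *m w) 0 0).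
have cs : c ^+ 2 + s ^+ 2 = 1.
  rewrite sqr_sqrtr ?sqnorm_ge0//.
  move: oo; rewrite oE tr_col_mx mul_row_col tr_scalar_mx mul_scalar_mx scale_scalar_mx.
  move=> /matrixP/(_ 0 0); rewrite [in X in X -> _]mxE.
  rewrite [in X in X + _]mxE [in X in _ = X -> _]mxE !eqxx !mulr1n => <-.
  by rewrite expr2.
pose B1 : 'M[R]_(1 + (1 + n)) := block_mx (1%:M : 'M[R]_1) 0 0 Q1.
have hB1 : orthmx B1 by exact: orthmx_block.
pose Rt := rot_mx n c s.
have hR : orthmx Rt by exact: orthmx_rot.
(* [B1] sends the first column of [O] to (c, s, 0, ..., 0), which [Rt^T] rotates back to the first
   basis vector; hence [M] fixes that vector. *)
pose M := Rt^T *m (B1 *m O).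
have hM : orthmx M by apply: orthmxM; [exact: orthmx_tr|exact: orthmxM].
have Me : M *m delta_mx 0 0 = delta_mx 0 0 :> 'cV_(1 + (1 + n)).
  rewrite /M -!mulmxA -/o.
  have -> : B1 *m o = Rt *m delta_mx 0 0.
    rewrite oE /B1 mul_block_col !mul0mx addr0 add0r mul1mx Q1w -/s.
    have -> : (delta_mx 0 0 : 'cV[R]_(1 + (1 + n))) = vcons (1, vcons (0, 0)).
      apply/matrixP => i j; rewrite (ord1 j).
      have [i' ->|->] := unliftP ord0 i; last by rewrite vcons0 !mxE !eqxx.
      rewrite vconsS /= mxE /=.
      have [i'' ->|->] := unliftP ord0 i'; last by rewrite vcons0.
      by rewrite vconsS mxE.
    rewrite rot_mx_vcons !mulr0 mulr1 subr0 mulr1 addr0 /vcons /=; congr col_mx.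
    apply/matrixP => i j; rewrite (ord1 j) mxE.
    have [i' ->|->] := unliftP ord0 i.
      rewrite (_ : lift ord0 i' = rshift 1 i'); last exact/val_inj.
      by rewrite col_mxEd !mxE mulr0.
    rewrite (_ : ord0 = lshift n (ord0 : 'I_1)); last exact/val_inj.
    by rewrite col_mxEu !mxE !eqxx mulr1 mulr1n.
  by rewrite mulmxA hR mul1mx.
have [Q2 hQ2 ME] := orthmx_fix_e0 hM Me.
exists Q1^T, Q2, c, s; split => //; first exact: orthmx_tr.
rewrite -ME /M -/Rt !mulmxA.
have -> : block_mx 1%:M 0 0 Q1^T = B1^T by rewrite /B1 tr_block_mx !trmx0 trmx1.
by rewrite -(mulmxA _ Rt) (orthmxT hR) mulmx1 hB1 mul1mx.
Qed.

Lemma rgauss_orth n (O : 'M[R]_n) : orthmx O -> rinv O.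
Proof.
elim: n O => [|n IH] O hO.
  by move=> F mF F0; apply: eq_integral => v _; congr F; apply/matrixP => -[].
case: n IH O hO => [_|n IH] O hO.
  move=> F mF F0.
  (* A 1 x 1 orthogonal matrix is a sign; it acts as a rotation of sine 0 once a dummy second
     Gaussian coordinate is added. *)
  have oo : O 0 0 ^+ 2 + 0 ^+ 2 = 1.
    move: hO => /matrixP /(_ 0 0); rewrite mxE big_ord1 !mxE -expr2 => ->.
    by rewrite expr0n addr0.
  pose H (z : R * R) := F (vcons (z.1, 0)).
  have mH : measurable_fun setT H.
    apply: measurableT_comp mF _; apply: measurableT_comp (@measurable_vcons 0) _.
    by apply: measurable_fun_pair => //; exact: measurable_fst.
  have red G : measurable_fun setT G -> (forall x, 0 <= G x)%E ->
     (\int[rgauss 1]_v G v = \int[gauss1 R]_x \int[gauss1 R]_y G (vcons (x, 0%R)))%E.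
    move=> mG G0; rewrite integral_rgaussS//; apply: eq_integral => x _.
    rewrite integral_cst//= probability_setT mule1.
    rewrite integral_dirac//= ?diracT ?mul1e//.
    apply: measurableT_comp mG _; apply: measurableT_comp (@measurable_vcons 0) _.
    exact: measurable_fun_pair.
  apply: (etrans (red _ (measurableT_comp mF (measurable_rmul O)) (fun x => F0 _))).
  apply: (etrans _ (esym (red _ mF F0))).
  apply: (etrans _ (gauss1_rot oo mH (fun z => F0 _))).
  apply: eq_integral => x _; apply: eq_integral => y _; rewrite /H /= mul0r subr0.
  congr F; apply/matrixP => i j; rewrite !ord1 mxE big_ord1.
  by rewrite !vcons0.
have [Q1 [Q2 [c [s [h1 h2 cs ->]]]]] := orthmx_decomp hO.
apply: rinvM; last exact/rinv_block/IH.
by apply: rinvM; [exact/rinv_block/IH|exact: rinv_rot].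
Qed.

End real_gauss.

(** * Complex Gaussian matrices and unitary invariance *)

Section complex_gauss.
Variable R : realType.
Local Notation C := R[i].

Definition cbox m n (A B : 'I_m -> 'I_n -> set R) : set 'M[C]_(m, n) :=
  [set X | forall i j, A i j (complex.Re (X i j)) /\ B i j (complex.Im (X i j))].

Lemma measurable_cbox1 (A B : set R) : measurable A -> measurable B ->
  measurable [set z : C | A (complex.Re z) /\ B (complex.Im z)].
Proof.
move=> mA mB; rewrite (_ : [set z | _] = (fun z : C => complex.Re z) @^-1` A `&`
  (fun z : C => complex.Im z) @^-1` B)//.
apply: measurableI; rewrite -[X in measurable X]setTI.
  by apply: (measurable_cRe (@measurable_id _ _ setT)).
by apply: (measurable_cIm (@measurable_id _ _ setT)).
Qed.

Lemma measurable_cbox m n (A B : 'I_m -> 'I_n -> set R) :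
  (forall i j, measurable (A i j)) -> (forall i j, measurable (B i j)) ->
  measurable (cbox A B).
Proof.
move=> mA mB.
rewrite (_ : cbox A B = \bigcap_(ij in [set: 'I_m * 'I_n])
   ((fun X : 'M[C]_(m, n) => X ij.1 ij.2) @^-1`
      [set z : C | A ij.1 ij.2 (complex.Re z) /\ B ij.1 ij.2 (complex.Im z)])).
  apply: fin_bigcap_measurable => // ij _.
  rewrite -[X in measurable X]setTI.
  apply: (measurable_entry ij.1 ij.2) => //.
  exact: measurable_cbox1.
apply/seteqP; split => X /=.
  by move=> h [i j] _; exact: h.
by move=> h i j; exact: (h (i, j) I).
Qed.

(** The i.i.d. law, prescribed on boxes in the real and imaginary parts only; [is_cgauss_unique]
    shows that this determines a probability, so laws are identified by computing on boxes. *)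
Definition is_cgauss m n (mu : set 'M[C]_(m, n) -> \bar R) := forall A B : 'I_m -> 'I_n -> set R,
  (forall i j, measurable (A i j)) -> (forall i j, measurable (B i j)) ->
  mu (cbox A B) = (\prod_j \prod_i (gauss1 R (A i j) * gauss1 R (B i j)))%E.

(** Boxes are stable under intersection and generate the matrix sigma-algebra. *)
Lemma is_cgauss_unique m n (mu nu : probability 'M[C]_(m, n) R) :
  is_cgauss mu -> is_cgauss nu -> forall E, measurable E -> mu E = nu E.
Proof.
move=> hmu hnu E mE.
pose G : set (set 'M[C]_(m, n)) := [set S | exists A B,
  [/\ forall i j, measurable (A i j), forall i j, measurable (B i j) & S = cbox A B]].
have mG S : G S -> measurable S.
  by move=> [A [B [mA mB ->]]]; exact: measurable_cbox.
apply: (@measure_unique _ R _ G (fun=> setT)) => //.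
- apply/seteqP; split; last first.
    by apply: smallest_sub => //; exact: sigma_algebra_measurable.
  apply: smallest_sub; first exact: smallest_sigma_algebra.
  move=> _ [[i j] _ /= [B mB <-]]; rewrite setTI.
  pose MG : measurableType _ := g_sigma_algebraType G.
  suff : measurable_fun [set: MG] (fun X : 'M[C]_(m, n) => X i j).
    by move=> /(_ measurableT _ mB); rewrite setTI.
  (* The box that constrains only the entry in row [i] and column [j]. *)
  pose at_ij (A : set R) (k : 'I_m) (l : 'I_n) := if (k == i) && (l == j) then A else setT.
  have mat A : measurable A -> forall k l, measurable (at_ij A k l).
    by move=> mA k l; rewrite /at_ij; case: ifP.
  apply/(@measurable_complexP _ MG) ; split => _ A mA; rewrite setTI; apply: sub_sigma_algebra.
    exists (at_ij A), (fun _ _ => setT); split=> //; first exact: mat.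
    apply/seteqP; split => X /=.
      by move=> h k l; split => //; rewrite /at_ij; case: ifPn => // /andP[/eqP-> /eqP->].
    by move=> /(_ i j)[]; rewrite /at_ij !eqxx.
  exists (fun _ _ => setT), (at_ij A); split=> //; first exact: mat.
  apply/seteqP; split => X /=.
    by move=> h k l; split => //; rewrite /at_ij; case: ifPn => // /andP[/eqP-> /eqP->].
  by move=> /(_ i j)[]; rewrite /at_ij !eqxx.
- move=> _ _ [A [B [mA mB ->]]] [A' [B' [mA' mB' ->]]].
  exists (fun i j => A i j `&` A' i j), (fun i j => B i j `&` B' i j); split.
  + by move=> i j; exact: measurableI.
  + by move=> i j; exact: measurableI.
  + apply/seteqP; split => X /=.
      by move=> [h h'] i j; have [? ?] := h i j; have [? ?] := h' i j.
    by move=> h; split => i j; have [[? ?] [? ?]] := h i j.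
- move=> k; exists (fun _ _ => setT), (fun _ _ => setT); split => //.
  by apply/seteqP; split => X.
- by apply/seteqP; split => // x _; exists 0%N.
- move=> _ [A [B [mA mB ->]]]; exact: (etrans (hmu _ _ mA mB) (esym (hnu _ _ mA mB))).
- move=> k; by rewrite (le_lt_trans (probability_le1 _ _))// ltry.
Qed.

Definition ccol n (v : 'cV[R]_(n + n)) : 'cV[C]_n :=
  \col_i (v (lshift n i) 0 +i* v (rshift n i) 0).

Lemma measurable_ccol n : measurable_fun setT (@ccol n).
Proof.
apply/measurable_matrixP => i j.
rewrite (_ : (fun t => _) = (fun v : 'cV[R]_(n + n) => v (lshift n i) 0 +i* v (rshift n i) 0)).
  by apply/measurable_complexP; split => /=; exact: measurable_entry.
by apply/funext => v; rewrite mxE.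
Qed.

Definition cgaussV n : probability 'cV[C]_n R := push (rgauss R (n + n)) (@measurable_ccol n).

Lemma cgaussV_is_cgauss n : @is_cgauss n 1 (cgaussV n).
Proof.
move=> A B mA mB.
pose AB (k : 'I_(n + n)) := match fintype.split k with inl i => A i 0 | inr i => B i 0 end.
have mAB k : measurable (AB k) by rewrite /AB; case: fintype.split.
transitivity (rgauss R (n + n) [set v : 'cV[R]_(n + n) | forall k, AB k (v k 0)]).
  rewrite /cgaussV pushE; congr (rgauss R _ _); apply/seteqP; split => v /=.
    move=> h k; rewrite /AB; case: split_ordP => i ->.
      by have [+ _] := h i 0; rewrite mxE.
    by have [_ +] := h i 0; rewrite mxE.
  move=> h i j; rewrite (ord1 j) mxE /=; split.
    by have := h (lshift n i); rewrite /AB; case: split_ordP => k /eqP; rewrite eq_shift // => /eqP->.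
  by have := h (rshift n i); rewrite /AB; case: split_ordP => k /eqP; rewrite eq_shift // => /eqP->.
rewrite rgauss_box// big_split_ord /= big_ord1 big_split /=; congr (_ * _)%E.
  apply: eq_bigr => i _; rewrite /AB; case: split_ordP => k /eqP; rewrite eq_shift // => /eqP->//.
apply: eq_bigr => i _; rewrite /AB; case: split_ordP => k /eqP; rewrite eq_shift // => /eqP->//.
Qed.

Lemma ge0_integral_cgaussV n (F : 'cV[C]_n -> \bar R) :
  measurable_fun setT F -> (forall x, 0 <= F x)%E ->
  (\int[cgaussV n]_v F v = \int[rgauss R (n + n)]_v F (ccol v))%E.
Proof. by move=> mF F0; exact: ge0_integral_push. Qed.

Definition mcons m n (p : 'cV[C]_m * 'M[C]_(m, n)) : 'M[C]_(m, n.+1) :=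
  row_mx p.1 p.2 : 'M[C]_(m, 1 + n).

Lemma mcons0 m n (p : 'cV[C]_m * 'M[C]_(m, n)) i : mcons p i ord0 = p.1 i 0.
Proof.
transitivity ((row_mx p.1 p.2) i (lshift n (ord0 : 'I_1))).
  by congr (mcons p _ _); exact/val_inj.
by rewrite row_mxEl.
Qed.

Lemma mconsS m n (p : 'cV[C]_m * 'M[C]_(m, n)) i j : mcons p i (lift ord0 j) = p.2 i j.
Proof.
transitivity ((row_mx p.1 p.2) i (rshift 1 j)).
  by congr (mcons p _ _); exact/val_inj.
by rewrite row_mxEr.
Qed.

Lemma measurable_mcons m n : measurable_fun setT (@mcons m n).
Proof.
apply/measurable_matrixP => i j.
have [j' ->|->] := unliftP ord0 j.
  rewrite (_ : (fun t => _) = (fun p : 'cV[C]_m * 'M[C]_(m, n) => p.2 i j')).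
    exact: (measurableT_comp (measurable_entry i j') measurable_snd).
  by apply/funext => p; rewrite mconsS.
rewrite (_ : (fun t => _) = (fun p : 'cV[C]_m * 'M[C]_(m, n) => p.1 i 0)).
  exact: (measurableT_comp (measurable_entry i 0) measurable_fst).
by apply/funext => p; rewrite mcons0.
Qed.

(** Built one column at a time, since the first column is singled out throughout. *)
Fixpoint cgauss m n : probability 'M[C]_(m, n) R :=
  match n return probability 'M[C]_(m, n) R with
  | 0 => dirac (0 : 'M[C]_(m, 0))
  | k.+1 => push (cgaussV m \x cgauss m k)%E (@measurable_mcons m k)
  end.

Lemma integral_cgaussS m n (F : 'M[C]_(m, n.+1) -> \bar R) :
  measurable_fun setT F -> (forall x, 0 <= F x)%E ->
  (\int[cgauss m n.+1]_X F X =
   \int[cgaussV m]_v \int[cgauss m n]_Y F (mcons (v, Y)))%E.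
Proof.
move=> mF F0; rewrite ge0_integral_push//.
apply: (@fubini_tonelli1 _ _ _ _ R (cgaussV m) (cgauss m n) (fun p => F (mcons p)) _ _) => //.
exact: measurableT_comp mF (@measurable_mcons m n).
Qed.

Lemma cgauss_is_cgauss m n : is_cgauss (cgauss m n).
Proof.
elim: n => [|n IH] A B mA mB.
  by rewrite big_ord0 /= diracE mem_set// => i [].
pose S0 : set 'cV[C]_m := @cbox m 1 (fun i _ => A i ord0) (fun i _ => B i ord0).
pose S1 : set 'M[C]_(m, n) := cbox (fun i j => A i (lift ord0 j)) (fun i j => B i (lift ord0 j)).
have mS0 : measurable S0 by apply: measurable_cbox.
have mS1 : measurable S1 by apply: measurable_cbox.
transitivity ((cgaussV m \x cgauss m n)%E (S0 `*` S1)).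
  transitivity ((cgaussV m \x cgauss m n)%E (@mcons m n @^-1` (cbox A B))); first by [].
  congr (product_measure1 _ _ _); apply/seteqP; split => -[v Y] /=.
    move=> h; split => i j /=.
      by have := h i ord0; rewrite mcons0 (ord1 j).
    by have := h i (lift ord0 j); rewrite mconsS.
  move=> [h0 h1] i j; have [j' ->|->] := unliftP ord0 j.
    by rewrite mconsS; exact: h1.
  by rewrite mcons0; exact: h0.
rewrite (product_measure1E (cgaussV m) (cgauss m n))//.
rewrite big_ord_recl; congr (_ * _)%E; last exact: IH.
by apply: (etrans (cgaussV_is_cgauss _ _)) => //; rewrite big_ord1.
Qed.

Lemma measurable_clmul p m n (U : 'M[C]_(p, m)) :
  measurable_fun setT (fun X : 'M[C]_(m, n) => U *m X).
Proof. by apply: measurable_mxM => //; exact: measurable_cst. Qed.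

Lemma measurable_crmul m n p (U : 'M[C]_(n, p)) :
  measurable_fun setT (fun X : 'M[C]_(m, n) => X *m U).
Proof. by apply: measurable_mxM => //; exact: measurable_cst. Qed.

Lemma measurable_trmx m n : measurable_fun setT (fun X : 'M[C]_(m, n) => X^T).
Proof.
apply/measurable_matrixP => i j.
rewrite (_ : (fun t => _) = (fun X : 'M[C]_(m, n) => X j i)).
  exact: measurable_entry.
by apply/funext => X; rewrite mxE.
Qed.

(** Transposition permutes i.i.d. entries, hence preserves the law; this turns right multiplication
    into left multiplication in [cgauss_runitary]. *)
Lemma integral_cgaussT m n (F : 'M[C]_(n, m) -> \bar R) :
  measurable_fun setT F -> (forall x, 0 <= F x)%E ->
  (\int[cgauss m n]_X F X^T = \int[cgauss n m]_X F X)%E.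
Proof.
move=> mF F0.
rewrite -(@ge0_integral_push _ _ _ _ _ (cgauss m n) _ (@measurable_trmx m n) F)//.
apply: eq_probability_integral; apply: is_cgauss_unique; last exact: cgauss_is_cgauss.
move=> A B mA mB; rewrite pushE exchange_big /=.
rewrite -(@cgauss_is_cgauss _ _ (fun i j => A j i) (fun i j => B j i))//.
congr (cgauss m n _); apply/seteqP; split => X /= h i j.
  by have := h j i; rewrite mxE.
by rewrite mxE; exact: h.
Qed.

Lemma unitarymx_tC n (U : 'M[C]_n) : U \is unitarymx -> (U^t* *m U = 1%:M)%sesqui.
Proof. by move=> /unitarymxP/mulmx1C. Qed.

Lemma sum_complex (I : Type) (s : seq I) (P : pred I) (f g : I -> R) :
  \sum_(i <- s | P i) (f i +i* g i) =
  (\sum_(i <- s | P i) f i) +i* (\sum_(i <- s | P i) g i).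
Proof. by apply/eqP; rewrite eq_complex /= !raddf_sum /= !eqxx. Qed.

(** Write U = A + iB. On the real and imaginary parts, stacked as a vector of length [n + n], U acts
    by the real matrix with block rows (A, -B) and (B, A), which is orthogonal because U is unitary;
    [rgauss_orth] applies. *)
Lemma cgaussV_unitary n (U : 'M[C]_n) (F : 'cV[C]_n -> \bar R) : U \is unitarymx ->
  measurable_fun setT F -> (forall x, 0 <= F x)%E ->
  (\int[cgaussV n]_v F (U *m v)%R = \int[cgaussV n]_v F v)%E.
Proof.
move=> hU mF F0.
have [A [B UE]] : exists A B : 'M[R]_n, forall i j, U i j = A i j +i* B i j.
  exists (map_mx (@complex.Re R) U), (map_mx (@complex.Im R) U) => i j.
  by rewrite !mxE; case: (U i j).
have entry (P Q : 'M[R]_n) k l : ((P^T) *m Q) k l = \sum_i P i k * Q i l.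
  by rewrite mxE; apply: eq_bigr => i _; rewrite mxE.
have UU k l : (\sum_i (A i k * A i l + B i k * B i l)) +i*
              (\sum_i (A i k * B i l - B i k * A i l)) = (k == l)%:R :> C.
  have /matrixP/(_ k l) := unitarymx_tC hU.
  rewrite [in X in X -> _]mxE [in X in _ = X -> _]mxE => <-.
  rewrite -sum_complex; apply: eq_bigr => i _.
  rewrite !mxE !UE; apply/eqP; rewrite eq_complex /=.
  by apply/andP; split; apply/eqP; ring.
have ReUU k l : \sum_i (A i k * A i l + B i k * B i l) = (k == l)%:R.
  by have /(congr1 (@complex.Re R)) /= := UU k l; case: (k == l).
have ImUU k l : \sum_i (A i k * B i l - B i k * A i l) = 0.
  by have /(congr1 (@complex.Im R)) /= := UU k l; case: (k == l).
pose O : 'M[R]_(n + n) := block_mx A (- B) B A.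
have hO : orthmx O.
  rewrite /orthmx /O tr_block_mx mulmx_block (scalar_mx_block n n); congr block_mx.
  - by apply/matrixP => k l; rewrite mxE !entry -big_split/= ReUU mxE.
  - apply/matrixP => k l; rewrite mxE [RHS]mxE !entry -big_split/=.
    apply: (etrans _ (etrans (congr1 -%R (ImUU k l)) (oppr0 _))).
    by rewrite -sumrN; apply: eq_bigr => i _; rewrite mxE; ring.
  - apply/matrixP => k l; rewrite mxE [RHS]mxE !entry -big_split/=.
    apply: (etrans _ (ImUU k l)).
    by apply: eq_bigr => i _; rewrite mxE; ring.
  - apply/matrixP => k l; rewrite mxE [RHS]mxE !entry -big_split/=.
    apply: (etrans _ (ReUU k l)).
    by apply: eq_bigr => i _; rewrite !mxE; ring.
have ccolO v : U *m ccol v = ccol (O *m v).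
  have e1 i : (O *m v) (lshift n i) 0 =
      \sum_k (A i k * v (lshift n k) 0 - B i k * v (rshift n k) 0).
    rewrite mxE big_split_ord /= -big_split /=; apply: eq_bigr => k _.
    by rewrite block_mxEul block_mxEur mxE mulNr.
  have e2 i : (O *m v) (rshift n i) 0 =
      \sum_k (B i k * v (lshift n k) 0 + A i k * v (rshift n k) 0).
    rewrite mxE big_split_ord /= -big_split /=; apply: eq_bigr => k _.
    by rewrite block_mxEdl block_mxEdr.
  apply/matrixP => i j; rewrite (ord1 j) [LHS]mxE [RHS]mxE e1 e2 -sum_complex.
  apply: eq_bigr => k _; rewrite mxE UE; apply/eqP; rewrite eq_complex /=.
  by apply/andP; split; apply/eqP; ring.
rewrite (ge0_integral_cgaussV mF F0).
apply: (etrans (ge0_integral_cgaussV (measurableT_comp mF (measurable_clmul U)) (fun x => F0 _))).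
apply: (etrans _ (rgauss_orth hO (measurableT_comp mF (@measurable_ccol n)) (fun x => F0 _))).
by apply: eq_integral => v _; congr F; rewrite /= ccolO.
Qed.

Lemma cgauss_lunitary m n (U : 'M[C]_m) (F : 'M[C]_(m, n) -> \bar R) : U \is unitarymx ->
  measurable_fun setT F -> (forall x, 0 <= F x)%E ->
  (\int[cgauss m n]_X F (U *m X)%R = \int[cgauss m n]_X F X)%E.
Proof.
move=> hU; elim: n F => [|n IH] F mF F0.
  by apply: eq_integral => v _; congr F; apply/matrixP => i [].
apply: (etrans (integral_cgaussS (measurableT_comp mF (measurable_clmul U)) (fun x => F0 _))).
apply: (etrans _ (esym (integral_cgaussS mF F0))).
pose G (v : 'cV[C]_m) := (\int[cgauss m n]_Y F (mcons (v, Y)))%E.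
have mFp : measurable_fun setT (fun p => F (@mcons m n p)).
  exact: measurableT_comp mF (@measurable_mcons m n).
have mG : measurable_fun setT G.
  exact: (@measurable_fun_fubini_tonelli_F _ _ _ _ R (cgauss m n) (fun p => F (mcons p)) mFp (fun p => F0 _)).
have G0 v : (0 <= G v)%E by apply: integral_ge0.
apply: (etrans _ (cgaussV_unitary hU mG G0)).
apply: eq_integral => v _; rewrite /G.
apply: (etrans _ (IH (fun Y => F (mcons (U *m v, Y))) _ _)) => //.
  apply: eq_integral => Y _; congr F.
  exact: (mul_mx_row U v Y).
apply: measurableT_comp mFp _.
exact: measurable_fun_pair.
Qed.

Lemma cgauss_runitary m n (U : 'M[C]_n) (F : 'M[C]_(m, n) -> \bar R) : U \is unitarymx ->
  measurable_fun setT F -> (forall x, 0 <= F x)%E ->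
  (\int[cgauss m n]_X F (X *m U)%R = \int[cgauss m n]_X F X)%E.
Proof.
move=> hU mF F0.
rewrite -(integral_cgaussT mF F0).
have mFT : measurable_fun setT (fun X => F X^T).
  exact: measurableT_comp mF (@measurable_trmx n m).
rewrite -(integral_cgaussT (measurableT_comp mF (measurable_crmul U)) (fun x => F0 _)).
have hUT : U^T \is unitarymx by rewrite trmx_unitary.
rewrite -(cgauss_lunitary hUT mFT)//.
by apply: eq_integral => X _; rewrite /= trmx_mul trmxK.
Qed.

End complex_gauss.

(** * Gaussian averages of exponentials of quadratic forms *)

Section exp_moments.
Variable R : realType.
Local Notation C := R[i].

Lemma integral_gauss1_exp (a : R) : 0 <= a ->
  (\int[gauss1 R]_x (expR (- (a * (x : R) ^+ 2)))%:E = ((Num.sqrt (1 + a))^-1)%:E)%E.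
Proof.
move=> a0.
have a1 : 0 < 1 + a by rewrite ltr_pwDl.
have mexp (b : R) : measurable_fun [set: R] (fun x : R => (expR (- (b * x ^+ 2)))%:E).
  apply/measurable_EFinP; apply: measurableT_comp => //.
  by apply: measurable_funN; apply: measurable_funM => //; exact: measurable_cst.
rewrite integral_gauss1//=.
(* Chosen so that 2 s^2 = 1/(1 + a): the integrand is then a multiple of the normal density of
   standard deviation [s]. *)
pose s := Num.sqrt (2^-1 / (1 + a)).
have s2 : s ^+ 2 *+ 2 = (1 + a)^-1.
  rewrite sqr_sqrtr ?divr_ge0 ?invr_ge0 ?(ltW a1)// -mulr_natr; field; lra.
have s0 : s != 0 by rewrite gt_eqF// sqrtr_gt0 divr_gt0 ?invr_gt0.
pose q := normal_peak (gauss_sd R) / normal_peak s.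
have pk : 0 < normal_peak s by rewrite normal_peak_gt0.
transitivity (\int[@lebesgue_measure R]_x (q%:E * (normal_pdf 0 s x)%:E))%E.
  apply: eq_integral => x _; rewrite -EFinM gauss_pdfE normal_pdfE// /normal_fun subr0 s2 invrK.
  rewrite -EFinM; congr EFin; rewrite mulrCA -expRD /q.
  rewrite !mulrA divfK ?gt_eqF//; congr (_ * expR _); ring.
rewrite ge0_integralZl//=.
- rewrite integral_normal_pdf mule1; congr EFin.
  have pkE (u : R) : normal_peak u = (Num.sqrt (u ^+ 2 *+ 2 * pi))^-1.
    by rewrite /normal_peak mulrnAl.
  have g2 : gauss_sd R ^+ 2 *+ 2 = 1.
    by rewrite sqr_sqrtr ?invr_ge0// -mulr_natr mulVf.
  rewrite /q !pkE invrK s2 g2 mul1r sqrtrM ?invr_ge0 ?(ltW a1)// sqrtrV ?(ltW a1)//.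
  by rewrite mulrCA mulVf ?mulr1// gt_eqF// sqrtr_gt0 pi_gt0.
- by apply/measurable_EFinP; exact: measurable_normal_pdf.
- by move=> x _; rewrite lee_fin normal_pdf_ge0.
- by rewrite lee_fin divr_ge0// normal_peak_ge0.
Qed.

Lemma measurable_rquad n (a : 'I_n -> R) :
  measurable_fun setT (fun v : 'cV[R]_n => expR (- \sum_k a k * v k 0 ^+ 2)).
Proof.
apply: measurableT_comp => //; apply: measurable_funN.
apply: measurable_real_sum => k; apply: measurable_funM; first exact: measurable_cst.
by apply: measurable_funX; exact: measurable_entry.
Qed.

Lemma integral_rgauss_exp n (a : 'I_n -> R) : (forall k, 0 <= a k) ->
  (\int[rgauss R n]_v (expR (- \sum_k a k * v k 0 ^+ 2))%:E =
   (\prod_k (Num.sqrt (1 + a k))^-1)%:E)%E.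
Proof.
elim: n a => [|n IH] a a0.
  rewrite big_ord0; under eq_integral do rewrite big_ord0 oppr0 expR0.
  by rewrite integral_cst//= probability_setT mule1.
apply: (etrans (integral_rgaussS _ _)).
- by apply/measurable_EFinP; exact: measurable_rquad.
- by move=> v; rewrite lee_fin expR_ge0.
rewrite big_ord_recl EFinM -integral_gauss1_exp// -IH// -ge0_integralZr//.
- apply: eq_integral => x _; rewrite -ge0_integralZl//.
  + apply: eq_integral => v _; rewrite big_ord_recl vcons0 opprD expRD EFinM.
    by congr (_ * (expR (- _))%:E)%E; apply: eq_bigr => k _; rewrite vconsS.
  + by apply/measurable_EFinP; exact: measurable_rquad.
- apply/measurable_EFinP; apply: measurableT_comp => //.
  by apply: measurable_funN; apply: measurable_funM => //; exact: measurable_cst.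
- by apply: integral_ge0 => v _; rewrite lee_fin expR_ge0.
Qed.

Definition nsq (z : C) : R := complex.Re z ^+ 2 + complex.Im z ^+ 2.

Lemma nsq_ge0 z : 0 <= nsq z.
Proof. by rewrite addr_ge0// sqr_ge0. Qed.

Lemma nsqE (z : C) : (z^*)%C * z = (nsq z)%:C.
Proof.
case: z => x y; apply/eqP; rewrite eq_complex /nsq /=.
by apply/andP; split; apply/eqP; ring.
Qed.

Lemma measurable_nsq d (T : measurableType d) (f : T -> C) :
  measurable_fun setT f -> measurable_fun setT (fun t => nsq (f t)).
Proof.
move=> mf; apply: measurable_funD; apply: measurable_funX.
  exact: measurable_cRe.
exact: measurable_cIm.
Qed.

Lemma measurable_cquad n (a : 'I_n -> R) :
  measurable_fun setT (fun v : 'cV[C]_n => expR (- \sum_k a k * nsq (v k 0))).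
Proof.
apply: measurableT_comp => //; apply: measurable_funN.
apply: measurable_real_sum => k; apply: measurable_funM; first exact: measurable_cst.
by apply: measurable_nsq; exact: measurable_entry.
Qed.

(** Each complex coordinate consists of two real ones with the same weight, which squares the
    inverse square root of the real formula. *)
Lemma integral_cgaussV_exp n (a : 'I_n -> R) : (forall k, 0 <= a k) ->
  (\int[cgaussV R n]_v (expR (- \sum_k a k * nsq (v k 0)))%:E =
   (\prod_k (1 + a k)^-1)%:E)%E.
Proof.
move=> a0; apply: (etrans (ge0_integral_cgaussV _ _)).
- by apply/measurable_EFinP; exact: measurable_cquad.
- by move=> v; rewrite lee_fin expR_ge0.
pose b (k : 'I_(n + n)) := match fintype.split k with inl i => a i | inr i => a i end.
have bl i : b (lshift n i) = a i.
  by rewrite /b; case: split_ordP => k /eqP; rewrite eq_shift // => /eqP->.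
have br i : b (rshift n i) = a i.
  by rewrite /b; case: split_ordP => k /eqP; rewrite eq_shift // => /eqP->.
transitivity (\int[rgauss R (n + n)]_v (expR (- \sum_k b k * v k 0 ^+ 2))%:E)%E.
  apply: eq_integral => v _; congr (expR (- _))%:E.
  rewrite big_split_ord /= -big_split /=; apply: eq_bigr => k _.
  by rewrite mxE /nsq /= bl br mulrDr.
rewrite integral_rgauss_exp; last by move=> k; rewrite /b; case: fintype.split.
rewrite big_split_ord /= -big_split /=; congr EFin; apply: eq_bigr => k _.
by rewrite bl br -invfM -expr2 sqr_sqrtr// addr_ge0.
Qed.

(** Minus the derivative of [integral_cgaussV_exp] with respect to [a l]. The difference quotients
    [g m] increase to the integrand, so monotone convergence replaces differentiation under the
    integral. *)
Lemma integral_cgaussV_nsq_exp n (a : 'I_n -> R) (l : 'I_n) : (forall k, 0 <= a k) ->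
  (\int[cgaussV R n]_v (nsq (v l 0) * expR (- \sum_k a k * nsq (v k 0)))%:E =
   ((1 + a l)^-1 * \prod_k (1 + a k)^-1)%:E)%E.
Proof.
move=> a0.
(* Halving the step makes the monotonicity of [g] elementary: with y the exponential for the smaller
   step, it reads 1 - y^2 <= 2 (1 - y). *)
pose e (m : nat) : R := 2^-1 ^+ m.
have e0 m : 0 < e m by rewrite exprn_gt0// invr_gt0.
pose r (v : 'cV[C]_n) := nsq (v l 0).
pose S (v : 'cV[C]_n) := \sum_k a k * nsq (v k 0).
pose g m v := (expR (- S v) - expR (- (S v + e m * r v))) / e m.
have r0 v : 0 <= r v by exact: nsq_ge0.
pose ae m k := a k + (if k == l then e m else 0).
have ae0 m k : 0 <= ae m k by rewrite /ae addr_ge0//; case: ifP => // _; exact/ltW.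
have Se m v : S v + e m * r v = \sum_k ae m k * nsq (v k 0).
  rewrite /S (bigD1 l)//= [in RHS](bigD1 l)//= /ae eqxx mulrDl addrAC.
  congr (_ + _); apply: eq_bigr => k kl; by rewrite (negbTE kl) addr0.
have mr : measurable_fun setT r by apply: measurable_nsq; exact: measurable_entry.
have mS : measurable_fun setT (fun v => expR (- S v)) by exact: measurable_cquad.
have mSe m : measurable_fun setT (fun v => expR (- (S v + e m * r v))).
  under eq_fun do rewrite Se; exact: measurable_cquad.
have mg m : measurable_fun setT (fun v => (g m v)%:E).
  apply/measurable_EFinP; apply: measurable_funM; last exact: measurable_cst.
  exact: measurable_funB.
have g0 m v : 0 <= g m v.
  rewrite divr_ge0 ?(ltW (e0 m))// subr_ge0 ler_expR lerN2 lerDl mulr_ge0// ltW//.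
have gE m v : g m v = expR (- S v) * ((1 - expR (- (e m * r v))) / e m).
  by rewrite /g opprD expRD mulrA mulrBr mulr1.
have gnd v : {homo (g ^~ v) : m p / (m <= p)%N >-> m <= p}.
  apply/nondecreasing_seqP => m; rewrite !gE ler_wpM2l ?expR_ge0//.
  have -> : e m = e m.+1 * 2 by rewrite /e exprSr -mulrA mulVf// mulr1.
  set y := expR (- (e m.+1 * r v)).
  have -> : expR (- (e m.+1 * 2 * r v)) = y * y.
    by rewrite -expRD; congr expR; ring.
  have y1 : y <= 1 by rewrite -expR0 ler_expR oppr_le0 mulr_ge0// ltW.
  rewrite invfM mulrA mulrAC ler_wpM2r ?invr_ge0 ?(ltW (e0 _))// ler_pdivrMr//.
  nra.
have gcvg v : g m v @[m --> \oo] --> r v * expR (- S v).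
  under eq_fun do rewrite gE.
  rewrite mulrC; apply: cvgM; first exact: cvg_cst.
  apply: (squeeze_cvgr (f := fun m => r v * expR (- (e m * r v))) (h := fun=> r v)).
  - near=> m; apply/andP; split.
      rewrite ler_pdivlMr//.
      have := expR_ge1Dx (e m * r v); set y := e m * r v => hy.
      have Y0 := expR_gt0 y.
      rewrite expRN -subr_ge0 (_ : _ - _ = (expR y - 1 - y) / expR y); last first.
        by rewrite /y; field; rewrite gt_eqF.
      by rewrite divr_ge0 ?(ltW Y0)//; lra.
    rewrite ler_pdivrMr//.
    have := expR_ge1Dx (- (e m * r v)); lra.
  - rewrite -[X in _ --> X]mulr1; apply: cvgM; first exact: cvg_cst.
    rewrite -expR0; apply: continuous_cvg; first exact: continuous_expR.
    rewrite -oppr0 -(mul0r (r v)); apply: cvgN; apply: cvgM; last exact: cvg_cst.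
    by apply: cvg_expr; rewrite ger0_norm ?invr_ge0// invf_lt1// ltr1n.
  - exact: cvg_cst.
pose p := \prod_k (1 + a k)^-1.
have p1 k : 1 + a k != 0 by rewrite gt_eqF// ltr_pwDl.
have intg m : (\int[cgaussV R n]_v (g m v)%:E = (p / (1 + a l + e m))%:E)%E.
  have h1 : (\int[cgaussV R n]_v (expR (- S v) / e m)%:E = (p / e m)%:E)%E.
    under eq_integral do rewrite EFinM.
    rewrite ge0_integralZr//=.
    - by rewrite integral_cgaussV_exp.
    - exact/measurable_EFinP.
    - by rewrite lee_fin invr_ge0 ltW.
  have h2 : (\int[cgaussV R n]_v (expR (- (S v + e m * r v)) / e m)%:E =
      (p * (1 + a l) / (1 + a l + e m) / e m)%:E)%E.
    under eq_integral do rewrite EFinM Se.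
    rewrite ge0_integralZr//=.
    - rewrite integral_cgaussV_exp// -EFinM; congr (_ * _)%:E.
      rewrite /p (bigD1 l)//= [in RHS](bigD1 l)//= /ae eqxx.
      rewrite (eq_bigr (fun k => (1 + a k)^-1)); last first.
        by move=> k kl; rewrite (negbTE kl) addr0.
      have := p1 l; have : 1 + a l + e m != 0.
        by rewrite gt_eqF// ltr_pwDr// addr_ge0.
      by move=> u1 u2; rewrite addrA; field; rewrite ?u1 ?u2.
    - by apply/measurable_EFinP; exact: measurable_cquad.
    - by rewrite lee_fin invr_ge0 ltW.
  (* Two nonnegative integrals are added and the finite one is cancelled afterwards, so no integral
     of a difference has to be split. *)
  have h3 : (\int[cgaussV R n]_v (g m v)%:E +
     \int[cgaussV R n]_v (expR (- (S v + e m * r v)) / e m)%:E = (p / e m)%:E)%E.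
    rewrite -ge0_integralD//.
    - by rewrite -h1; apply: eq_integral => v _; rewrite -EFinD /g mulrBl subrK.
    - by move=> v _; rewrite lee_fin g0.
    - by move=> v _; rewrite lee_fin divr_ge0// ?expR_ge0// ltW.
    - apply/measurable_EFinP; apply: measurable_funM => //; exact: measurable_cst.
  rewrite h2 in h3.
  have -> : (p / (1 + a l + e m) = p / e m - p * (1 + a l) / (1 + a l + e m) / e m)%R.
    have u1 : 1 + a l + e m != 0 by rewrite gt_eqF// ltr_pwDr// addr_ge0.
    by have u2 := lt0r_neq0 (e0 m); field; rewrite ?u1 ?u2.
  by rewrite EFinB -h3 addeK//.
have lim1 : (\int[cgaussV R n]_v (g m v)%:E)%E @[m --> \oo] -->
   (\int[cgaussV R n]_v (r v * expR (- S v))%:E)%E.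
  rewrite (eq_integral (fun v => limn (fun m => (g m v)%:E))); last first.
    by move=> v _; apply/esym/cvg_lim => //; apply: cvg_EFin; [near=> m|exact: gcvg].
  apply: cvg_monotone_convergence => //.
  - by move=> m v _; rewrite lee_fin.
  - by move=> v _ m m' mm'; rewrite lee_fin; exact: gnd.
have lim2 : ((p / (1 + a l + e m))%:E : \bar R) @[m --> \oo] --> (p / (1 + a l))%:E.
  apply: cvg_EFin; first by near=> m.
  apply: cvgM; first exact: cvg_cst.
  apply: cvgV => //.
  rewrite -[X in _ --> X]addr0; apply: cvgD; first exact: cvg_cst.
  by apply: cvg_expr; rewrite ger0_norm ?invr_ge0// invf_lt1// ltr1n.
move: lim1; rewrite (eq_cvg _ _ intg) => lim1.
have := cvg_unique _ lim1 lim2; rewrite /r /S => -> //.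
by rewrite mulrC.
Unshelve. all: by end_near. Qed.

End exp_moments.

(** * Gram matrices and elementary symmetric polynomials *)


Section gram.
Local Open Scope sesquilinear_scope.
Variable R : realType.
Local Notation C := R[i].

Lemma adjM m n p (A : 'M[C]_(m, n)) (B : 'M[C]_(n, p)) :
  (A *m B)^t* = B^t* *m A^t*.
Proof. by rewrite trmx_mul map_mxM. Qed.

Lemma adjD m n (A B : 'M[C]_(m, n)) : (A + B)^t* = A^t* + B^t*.
Proof. by rewrite linearD map_mxD. Qed.

Lemma adjB m n (A B : 'M[C]_(m, n)) : (A - B)^t* = A^t* - B^t*.
Proof. by rewrite linearB map_mxB. Qed.

Lemma adj1 n : (1%:M : 'M[C]_n)^t* = 1%:M.
Proof. by rewrite trmx1 map_mx1. Qed.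

Lemma conj_real (x : R) : Num.conj (x%:C) = x%:C.
Proof. by apply/eqP; rewrite eq_complex /= oppr0 !eqxx. Qed.

Lemma nsq_conj (z : C) : Num.conj z * z = (nsq z)%:C.
Proof. exact: nsqE. Qed.

Lemma adj_real_scale m n (c : R) (A : 'M[C]_(m, n)) : (c%:C *: A)^t* = c%:C *: A^t*.
Proof. by apply/matrixP => i j; rewrite !mxE rmorphM /= conj_real. Qed.

Lemma Dmx_entry n (w : 'I_n -> R) i j : Dmx w i j = (w i *+ (i == j))%:C.
Proof. by rewrite !mxE; case: eqP => // ->. Qed.

Lemma adj_Dmx n (w : 'I_n -> R) : (Dmx w)^t* = Dmx w.
Proof.
apply/matrixP => i j; rewrite mxE mxE !Dmx_entry eq_sym.
by case: eqP => [->|_]; rewrite conj_real.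
Qed.

Lemma Dmx_mul n (w x : 'I_n -> R) : Dmx w *m Dmx x = Dmx (fun i => w i * x i).
Proof.
rewrite /Dmx mulmx_diag; congr diag_mx; apply/matrixP => i j.
by rewrite !mxE rmorphM.
Qed.

Lemma Dmx_lmul m n (w : 'I_n -> R) (A : 'M[C]_(n, m)) i j :
  (Dmx w *m A) i j = (w i)%:C * A i j.
Proof. by rewrite /Dmx mul_diag_mx !mxE. Qed.

Lemma det_Dmx n (w : 'I_n -> R) : \det (Dmx w) = (\prod_i w i)%:C.
Proof.
rewrite /Dmx det_diag rmorph_prod.
by apply: eq_bigr => i _; rewrite mxE.
Qed.

Lemma Dmx1D n (w : 'I_n -> R) (t : R) :
  1%:M + t%:C *: Dmx w = Dmx (fun i => 1 + t * w i).
Proof.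
apply/matrixP => i j; rewrite mxE [X in _ + X]mxE mxE !Dmx_entry.
by case: eqP => _; rewrite ?mulr1n ?mulr0n ?mulr0 ?addr0// rmorphD rmorphM.
Qed.

Lemma gram_herm m n (B : 'M[C]_(m, n)) : (B^t* *m B)^t* = B^t* *m B.
Proof. by rewrite adjM trmxCK. Qed.

Lemma gram_diag m n (B : 'M[C]_(m, n)) i :
  (B^t* *m B) i i = (\sum_k nsq (B k i))%:C.
Proof.
rewrite mxE rmorph_sum; apply: eq_bigr => k _.
by rewrite !mxE; exact: nsq_conj.
Qed.

(** The Gram matrix is normal, hence unitarily diagonalizable; its eigenvalues are the squared
    column norms of [B *m P^t*], hence real and nonnegative. *)
Lemma gram_spectral m n (B : 'M[C]_(m, n)) : exists (U : 'M[C]_n) (w : 'I_n -> R),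
  [/\ U \is unitarymx, forall i, 0 <= w i & B^t* *m B = U^t* *m Dmx w *m U].
Proof.
set A := B^t* *m B.
have An : A \is normalmx by apply/normalmxP; rewrite /A gram_herm.
have /orthomx_spectralP AE := An.
set P := spectralmx A in AE; set sp := spectral_diag A in AE.
have hP : P \is unitarymx by exact: spectral_unitarymx.
rewrite invmx_unitary// in AE.
have PAP : (B *m P^t*)^t* *m (B *m P^t*) = diag_mx sp.
  rewrite adjM trmxCK mulmxA -(mulmxA P) -/A AE !mulmxA.
  by rewrite (unitarymxP hP) mul1mx mulmxtVK.
exists P, (fun i => \sum_k nsq ((B *m P^t*) k i)); split => //.
  by move=> i; rewrite sumr_ge0// => k _; exact: nsq_ge0.
suff -> : Dmx (fun i => \sum_k nsq ((B *m P^t*) k i)) = diag_mx sp by [].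
apply/matrixP => i j; rewrite Dmx_entry mxE; case: eqP => [->|_]; rewrite ?mulr0n// !mulr1n.
by rewrite -gram_diag PAP mxE eqxx mulr1n.
Qed.

Lemma det_unitary_conj n (U A : 'M[C]_n) : U \is unitarymx ->
  \det (U^t* *m A *m U) = \det A.
Proof.
move=> hU; rewrite !det_mulmx mulrAC -det_mulmx unitarymx_tC// det1 mul1r//.
Qed.

Lemma gram_det m n (B : 'M[C]_(m, n)) :
  exists2 r : R, 0 <= r & \det (B^t* *m B) = r%:C.
Proof.
have [U [w [hU w0 ->]]] := gram_spectral B.
exists (\prod_i w i); first by rewrite prodr_ge0.
by rewrite det_unitary_conj// det_Dmx.
Qed.

Lemma wgram_gram m n (w : 'I_n -> R) (Y : 'M[C]_(n, m)) : (forall i, 0 <= w i) ->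
  Y^t* *m Dmx w *m Y = (Dmx (fun i => Num.sqrt (w i)) *m Y)^t* *m (Dmx (fun i => Num.sqrt (w i)) *m Y).
Proof.
move=> w0; rewrite adjM adj_Dmx [RHS]mulmxA -[X in _ = X *m _]mulmxA Dmx_mul.
have -> : (fun i => Num.sqrt (w i) * Num.sqrt (w i)) = w.
  by apply/funext => i; rewrite -expr2 sqr_sqrtr.
by [].
Qed.

(* The coefficients of [epoly a] are the elementary symmetric functions of [a],
   those of [epoly' a i] the ones with [a i] left out. *)
Definition epoly n (a : 'I_n -> R) : {poly R} := \prod_i (1 + a i *: 'X).
Definition epoly' n (a : 'I_n -> R) i : {poly R} := \prod_(j | j != i) (1 + a j *: 'X).

Lemma epolyD1 n (a : 'I_n -> R) i : epoly a = (1 + a i *: 'X) * epoly' a i.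
Proof. by rewrite /epoly (bigD1 i). Qed.

Lemma deriv_prod (I : finType) (P : pred I) (f : I -> {poly R}) :
  (\prod_(i | P i) f i)^`() = \sum_(i | P i) (f i)^`() * \prod_(j | P j && (j != i)) f j.
Proof.
have gen (s : seq I) : uniq s ->
  (\prod_(i <- s | P i) f i)^`() = \sum_(i <- s | P i) (f i)^`() * \prod_(j <- s | P j && (j != i)) f j.
  elim: s => [|x s IH]; first by rewrite !big_nil derivC.
  move=> /= /andP[xs us]; rewrite !big_cons; case: ifP => Px; last first.
    rewrite IH//; apply: eq_bigr => i _; congr (_ * _).
    by rewrite [RHS]big_cons Px.
  rewrite derivM IH// eqxx /=; congr (_ * _ + _).
    rewrite big_seq_cond [RHS]big_seq_cond; apply: eq_bigl => j.
    by case: eqP => [->|_]; rewrite ?(negbTE xs)// andbT.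
  rewrite mulr_sumr big_seq_cond [RHS]big_seq_cond; apply: eq_bigr => i /andP[si Pi].
  rewrite [X in _ = _ * X]big_cons Px /=; case: eqP => [xi|_]; first by rewrite xi si in xs.
  by rewrite mulrCA.
by apply: gen; exact: index_enum_uniq.
Qed.

Lemma epoly_deriv n (a : 'I_n -> R) :
  (epoly a)^`() = \sum_i a i *: epoly' a i.
Proof.
rewrite /epoly deriv_prod; apply: eq_bigr => i _.
by rewrite derivD derivZ derivX derivC add0r -mul_polyC mulr1 mul_polyC.
Qed.

(** A monomial of degree [k + 1] arises once for each variable that it contains. *)
Lemma epoly_coef_rec n (a : 'I_n -> R) k :
  \sum_i a i * (epoly' a i)`_k = k.+1%:R * (epoly a)`_k.+1.
Proof.
have /(congr1 (fun p : {poly R} => p`_k)) := epoly_deriv a.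
rewrite coef_deriv coef_sum mulr_natl => ->.
by apply: eq_bigr => i _; rewrite coefZ.
Qed.

Lemma epoly_coef_step n (a : 'I_n -> R) i k :
  (epoly a)`_k.+1 = (epoly' a i)`_k.+1 + a i * (epoly' a i)`_k.
Proof.
by rewrite (epolyD1 a i) mulrDl mul1r -scalerAl coefD coefZ coefXM.
Qed.

Lemma epoly_coef0 n (a : 'I_n -> R) : (epoly a)`_0 = 1.
Proof.
rewrite -horner_coef0 horner_prod big1// => i _.
by rewrite hornerD hornerZ hornerX hornerC mulr0 addr0.
Qed.

Lemma epoly'_coef0 n (a : 'I_n -> R) i : (epoly' a i)`_0 = 1.
Proof.
rewrite -horner_coef0 horner_prod big1// => j _.
by rewrite hornerD hornerZ hornerX hornerC mulr0 addr0.
Qed.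

Lemma epoly_coef_ge0 n (a : 'I_n -> R) (P : pred 'I_n) k : (forall i, 0 <= a i) ->
  0 <= (\prod_(i | P i) (1 + a i *: 'X))`_k.
Proof.
move=> a0; elim/big_rec : _ k => [|i p Pi IH] k.
  by rewrite coef1 ler0n.
rewrite mulrDl mul1r -scalerAl coefD coefZ coefXM.
by case: k => [|k] /=; rewrite ?mulr0 ?addr0// addr_ge0// mulr_ge0.
Qed.

Lemma horner_epoly n (a : 'I_n -> R) t : (epoly a).[t] = \prod_i (1 + t * a i).
Proof.
rewrite horner_prod; apply: eq_bigr => i _.
by rewrite hornerD hornerZ hornerX hornerC mulrC.
Qed.

Lemma poly_eq_ge0 (p q : {poly R}) : (forall t, 0 <= t -> p.[t] = q.[t]) -> p = q.
Proof.
move=> h; apply/eqP; rewrite -subr_eq0; apply/eqP.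
apply: (@roots_geq_poly_eq0 _ _ [seq k%:R | k <- iota 0 (size (p - q))]).
- apply/allP => _ /mapP[k _ ->]; rewrite rootE hornerD hornerN h ?subrr//.
- by rewrite map_inj_uniq ?iota_uniq// => i j /eqP; rewrite eqr_nat => /eqP.
- by rewrite size_map size_iota.
Qed.

(** Two triangular factorizations of the block matrix [M] compute its determinant in both ways
    (Sylvester's identity). *)
Lemma det_rank1 n (x : 'cV[C]_n) (y : 'rV[C]_n) :
  \det (1%:M - x *m y) = 1 - (y *m x) 0 0.
Proof.
pose M : 'M[C]_(1 + n) := block_mx 1%:M y x 1%:M.
have e1 : M = block_mx 1%:M 0 x 1%:M *m block_mx 1%:M y 0 (1%:M - x *m y).
  rewrite mulmx_block !(mul1mx, mulmx1, mul0mx, mulmx0) !addr0.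
  by congr block_mx; rewrite addrC subrK.
have e2 : M = block_mx (1%:M - y *m x) y 0 1%:M *m block_mx 1%:M 0 x 1%:M.
  rewrite mulmx_block !(mul1mx, mulmx1, mul0mx, mulmx0) !add0r.
  by rewrite subrK.
have d1 : \det M = \det (1%:M - x *m y).
  by rewrite e1 det_mulmx det_lblock det_ublock !det1 !mul1r.
have d2 : \det M = \det (1%:M - y *m x).
  by rewrite e2 det_mulmx det_lblock det_ublock !det1 !mulr1.
by rewrite -d1 d2 det_mx11 [LHS]mxE [X in X + _]mxE [X in _ + X]mxE eqxx.
Qed.

Lemma quad_form n (a : 'I_n -> R) (v : 'cV[C]_n) :
  (v^t* *m Dmx a *m v) 0 0 = (\sum_k a k * nsq (v k 0))%:C.
Proof.
rewrite -mulmxA mxE rmorph_sum; apply: eq_bigr => k _.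
by rewrite Dmx_lmul !mxE mulrCA nsq_conj rmorphM.
Qed.

(** The algebra behind Q^* A Q = A - c S with Q = 1 - c Y and Q^* = 1 - c X. In [schur_spectral], Q
    is the projection that kills [v]. *)
Lemma compress n (c q : C) (A X Y S : 'M[C]_n) : c * q = 1 ->
  A *m Y = S -> S *m Y = q *: S -> X *m A = S ->
  (1%:M - c *: X) *m A *m (1%:M - c *: Y) = A - c *: S.
Proof.
move=> cq AY SY XA; rewrite mulmxBl mul1mx -scalemxAl XA mulmxBr mulmx1 -scalemxAr.
by rewrite mulmxBl AY -scalemxAl SY scalerA cq scale1r subrr scaler0 subr0.
Qed.

(* The left-hand side is the Schur complement of the direction [v]. *)
Lemma schur_spectral n (a : 'I_n -> R) (v : 'cV[C]_n) :
  (forall i, 0 <= a i) -> 0 < \sum_k a k * nsq (v k 0) ->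
  exists (U : 'M[C]_n) (w : 'I_n -> R),
  [/\ U \is unitarymx, forall i, 0 <= w i,
     Dmx a - ((\sum_k a k * nsq (v k 0))^-1)%:C *: (Dmx a *m v *m v^t* *m Dmx a)
       = U^t* *m Dmx w *m U &
     (\sum_k a k * nsq (v k 0)) *: epoly w = \sum_k (a k * nsq (v k 0)) *: epoly' a k].
Proof.
move=> a0; set q := \sum_k _ => q0.
(* [Q] kills [v] and is a projection, orthogonal for the form [Dmx a]. The Schur complement equals
   [Q^t* *m Dmx a *m Q], a weighted Gram matrix, so its spectrum is nonnegative. *)
pose Q : 'M[C]_n := 1%:M - (q^-1)%:C *: (v *m v^t* *m Dmx a).
have qv : v^t* *m Dmx a *m v = (q%:C)%:M by rewrite [LHS]mx11_scalar quad_form.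
set M := _ - _ *: _.
have MQ : M = Q^t* *m Dmx a *m Q.
  have QT : Q^t* = 1%:M - (q^-1)%:C *: (Dmx a *m v *m v^t*).
    by rewrite /Q adjB adj1 adj_real_scale !adjM trmxCK adj_Dmx mulmxA.
  pose S := Dmx a *m v *m v^t* *m Dmx a.
  have DS : Dmx a *m (v *m v^t* *m Dmx a) = S by rewrite /S !mulmxA.
  have SS : S *m (v *m v^t* *m Dmx a) = q%:C *: S.
    have SE : S = Dmx a *m v *m (v^t* *m Dmx a) by rewrite mulmxA.
    rewrite -(mulmxA v) SE [LHS]mulmxA -(mulmxA (Dmx a *m v) _ v) qv.
    by rewrite mul_mx_scalar -scalemxAl.
  rewrite QT /Q; apply/esym/(compress _ DS SS); last by [].
  by rewrite -(rmorphM (real_complex R)) mulVf ?gt_eqF.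
have [U [w [hU w0 MU]]] : exists (U : 'M[C]_n) (w : 'I_n -> R),
  [/\ U \is unitarymx, forall i, 0 <= w i & M = U^t* *m Dmx w *m U].
  by rewrite MQ wgram_gram//; exact: gram_spectral.
exists U, w; split => //.
(* It suffices to compare values at t >= 0, where 1 + t a_k is invertible. Up to the factor [q],
   both sides are det(1 + t M), computed once from the eigenvalues [w] and once as a rank-one
   perturbation of 1 + t D. *)
apply: poly_eq_ge0 => t t0; rewrite hornerZ horner_epoly.
have ta0 k : 1 + t * a k != 0 by rewrite gt_eqF// ltr_pwDl// mulr_ge0.
pose E := Dmx (fun k => (1 + t * a k)^-1).
have detM : (\prod_i (1 + t * w i))%:C = \det (1%:M + t%:C *: M).
  rewrite -det_Dmx -Dmx1D -(det_unitary_conj _ hU) MU; congr (\det _).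
  rewrite mulmxDr mulmxDl mulmx1 (unitarymx_tC hU); congr (_ + _).
  by rewrite -scalemxAr -scalemxAl.
have fact : 1%:M + t%:C *: M = Dmx (fun k => 1 + t * a k) *m
   (1%:M - ((t / q)%:C *: (E *m Dmx a *m v)) *m (v^t* *m Dmx a)).
  rewrite mulmxBr mulmx1 -Dmx1D /M scalerBr addrA; congr (_ - _).
  rewrite -scalemxAl -scalemxAr scalerA -rmorphM; congr (_ *: _).
  rewrite Dmx1D /E !mulmxA Dmx_mul.
  rewrite (_ : (fun i => _) = fun=> 1); last by apply/funext => i; rewrite divff.
  have -> : Dmx (fun=> 1) = 1%:M :> 'M[C]_n.
    by apply/matrixP => i j; rewrite Dmx_entry mxE; case: eqP.
  by rewrite mul1mx.
have quad : ((v^t* *m Dmx a) *m ((t / q)%:C *: (E *m Dmx a *m v))) 0 0 =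
   (t / q * \sum_k a k ^+ 2 / (1 + t * a k) * nsq (v k 0))%:C.
  rewrite -scalemxAr mxE [RHS]rmorphM; congr (_ * _).
  apply: (etrans _ (quad_form (fun k => a k ^+ 2 / (1 + t * a k)) v)).
  have -> : Dmx (fun k => a k ^+ 2 / (1 + t * a k)) = Dmx a *m (E *m Dmx a).
    by rewrite /E !Dmx_mul; congr Dmx; apply/funext => k; field.
  by rewrite !mulmxA.
move: detM; rewrite fact det_mulmx det_Dmx det_rank1 quad.
rewrite -[1 in X in _ * X](rmorph1 (real_complex R)) -rmorphB -rmorphM => /(congr1 (@complex.Re R)) /= ->.
rewrite mulrCA mulrBr mulr1 mulrA mulrCA mulfV ?gt_eqF// mulr1.
(* [q] is the sum of the a_k |v_k|^2, so the rank-one determinant is the weighted average of 1 - t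
   a_k / (1 + t a_k) = 1 / (1 + t a_k), and each term cancels one factor of the product. *)
rewrite horner_sum /q mulr_sumr -sumrB mulr_sumr; apply: eq_bigr => k _.
rewrite hornerZ horner_prod (bigD1 k)//=.
rewrite [in RHS](eq_bigr (fun j => 1 + t * a j)); last first.
  by move=> j _; rewrite hornerD hornerZ hornerX hornerC mulrC.
by have := ta0 k; move=> h; field.
Qed.

End gram.

(** * Determinants of Gaussian Gram matrices *)


Section det_moment.
Local Open Scope sesquilinear_scope.
Variable R : realType.
Local Notation C := R[i].

(** Taking the real part loses nothing for nonnegative weights, by [gdetE]. *)
Definition gdet n m (w : 'I_n -> R) (Y : 'M[C]_(n, m)) : R :=
  complex.Re (\det (Y^t* *m Dmx w *m Y)).

Lemma gdetE n m (w : 'I_n -> R) (Y : 'M[C]_(n, m)) : (forall i, 0 <= w i) ->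
  \det (Y^t* *m Dmx w *m Y) = (gdet w Y)%:C.
Proof.
move=> w0; rewrite /gdet wgram_gram//.
by have [r r0 ->] := gram_det (Dmx (fun i => Num.sqrt (w i)) *m Y).
Qed.

Lemma gdet_ge0 n m (w : 'I_n -> R) (Y : 'M[C]_(n, m)) : (forall i, 0 <= w i) ->
  0 <= gdet w Y.
Proof.
move=> w0; rewrite /gdet wgram_gram//.
by have [r r0 ->] := gram_det (Dmx (fun i => Num.sqrt (w i)) *m Y).
Qed.

Lemma measurable_gdet n m (w : 'I_n -> R) :
  measurable_fun setT (fun Y : 'M[C]_(n, m) => gdet w Y).
Proof.
apply: measurable_cRe; apply: measurable_det; apply: measurable_mxM => //.
by apply: measurable_mxM; [exact: measurable_mxtC|exact: measurable_cst].
Qed.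

Lemma gdet_runitary n m (w : 'I_n -> R) (Y : 'M[C]_(n, m)) (U : 'M[C]_m) :
  U \is unitarymx -> gdet w (Y *m U) = gdet w Y.
Proof.
move=> hU; rewrite /gdet.
have -> : (Y *m U)^t* *m Dmx w *m (Y *m U) = U^t* *m (Y^t* *m Dmx w *m Y) *m U.
  by rewrite adjM !mulmxA.
by rewrite det_unitary_conj.
Qed.

Lemma det_schur m (q : C) (b : 'rV[C]_m) (c : 'cV[C]_m) (Z : 'M[C]_m) : q != 0 ->
  \det (block_mx q%:M b c Z) = q * \det (Z - q^-1 *: (c *m b)).
Proof.
move=> q0.
have -> : block_mx q%:M b c Z =
   block_mx 1%:M 0 (q^-1 *: c) 1%:M *m block_mx q%:M b 0 (Z - q^-1 *: (c *m b)).
  rewrite mulmx_block !(mul1mx, mulmx1, mul0mx, mulmx0) !addr0.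
  rewrite mul_mx_scalar scalerA mulfV// scale1r; congr block_mx.
  by rewrite -scalemxAl addrCA subrr addr0.
by rewrite det_mulmx det_lblock det_ublock !det1 !mul1r det_scalar1.
Qed.

Definition qform n (w : 'I_n -> R) (v : 'cV[C]_n) : R := \sum_k w k * nsq (v k 0).

Lemma qform_ge0 n (w : 'I_n -> R) v : (forall i, 0 <= w i) -> 0 <= qform w v.
Proof. by move=> w0; rewrite sumr_ge0// => k _; rewrite mulr_ge0// nsq_ge0. Qed.

Lemma measurable_qform n (w : 'I_n -> R) : measurable_fun setT (qform w).
Proof.
apply: measurable_real_sum => k; apply: measurable_funM; first exact: measurable_cst.
by apply: measurable_nsq; exact: measurable_entry.
Qed.

Lemma gram_mcons n m (w : 'I_n -> R) (v : 'cV[C]_n) (Y : 'M[C]_(n, m)) :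
  (mcons (v, Y))^t* *m Dmx w *m mcons (v, Y) =
  block_mx (((qform w v)%:C)%:M : 'M[C]_1) (v^t* *m Dmx w *m Y)
    (Y^t* *m Dmx w *m v) (Y^t* *m Dmx w *m Y) :> 'M[C]_(1 + m).
Proof.
have -> : ((qform w v)%:C)%:M = v^t* *m Dmx w *m v by rewrite [RHS]mx11_scalar quad_form.
have -> : (mcons (v, Y))^t* = col_mx (v^t*) (Y^t*).
  exact: (etrans (congr1 (fun M => M ^ Num.conj) (tr_row_mx v Y)) (map_col_mx _ _ _)).
have -> : col_mx (v^t*) (Y^t*) *m Dmx w = col_mx (v^t* *m Dmx w) (Y^t* *m Dmx w).
  exact: mul_col_mx.
exact: mul_col_row.
Qed.

Lemma det_gram_mcons n m (w : 'I_n -> R) (v : 'cV[C]_n) (Y : 'M[C]_(n, m)) :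
  \det ((mcons (v, Y))^t* *m Dmx w *m mcons (v, Y)) =
  \det (block_mx (((qform w v)%:C)%:M : 'M[C]_1) (v^t* *m Dmx w *m Y)
    (Y^t* *m Dmx w *m v) (Y^t* *m Dmx w *m Y)).
Proof. exact: (congr1 (@determinant _ (1 + m)) (gram_mcons w v Y)). Qed.

Lemma gdet_mcons0 n m (w : 'I_n -> R) (v : 'cV[C]_n) (Y : 'M[C]_(n, m)) :
  (forall i, 0 <= w i) -> qform w v = 0 -> gdet w (mcons (v, Y)) = 0.
Proof.
move=> w0 q0.
have Dv : Dmx w *m v = 0.
  apply/matrixP => i j; rewrite (ord1 j) Dmx_lmul mxE.
  have /eqP := q0; rewrite psumr_eq0; last by move=> k _; rewrite mulr_ge0// nsq_ge0.
  move=> /allP/(_ i (mem_index_enum _)) /=.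
  rewrite mulf_eq0 => /orP[/eqP->|]; first by rewrite mul0r.
  rewrite /nsq paddr_eq0 ?sqr_ge0// !sqrf_eq0 => /andP[/eqP re /eqP im].
  by case: (v i 0) re im => x y /= -> ->; rewrite mulr0.
have vD : v^t* *m Dmx w = 0.
  by rewrite -[v^t* *m Dmx w]trmxCK adjM trmxCK adj_Dmx Dv trmx0 map_mx0.
rewrite /gdet det_gram_mcons.
by rewrite vD q0 -(mulmxA (Y^t*)) Dv mul0mx mulmx0 det_ublock det_scalar1 mul0r.
Qed.

(** [det_schur] splits off [qform w v]; what remains is the determinant of [Y] weighted by the Schur
    complement, which [U] diagonalizes. *)
Lemma gdet_mcons n m (w : 'I_n -> R) (v : 'cV[C]_n) (Y : 'M[C]_(n, m))
    (U : 'M[C]_n) (u : 'I_n -> R) : 0 < qform w v ->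
  Dmx w - ((qform w v)^-1)%:C *: (Dmx w *m v *m v^t* *m Dmx w) = U^t* *m Dmx u *m U ->
  gdet w (mcons (v, Y)) = qform w v * gdet u (U *m Y).
Proof.
move=> q0 MU; rewrite /gdet.
have q1 : (qform w v)%:C != 0 :> C.
  by rewrite eq_complex /= negb_and gt_eqF.
rewrite det_gram_mcons det_schur//.
have -> : Y^t* *m Dmx w *m Y - ((qform w v)%:C)^-1 *: (Y^t* *m Dmx w *m v *m (v^t* *m Dmx w *m Y)) =
   (U *m Y)^t* *m Dmx u *m (U *m Y).
  rewrite adjM !mulmxA -(mulmxA (Y^t*) (U^t*)) -(mulmxA (Y^t*) _ U) -MU.
  rewrite mulmxBr mulmxBl; congr (_ - _).
  rewrite -scalemxAr -scalemxAl -fmorphV /=; congr (_ *: _).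
  by rewrite !mulmxA.
by case: (\det _) => x y /=; rewrite mul0r subr0.
Qed.

(** Named so that [det_moment_cond] can take the induction hypothesis as a premise. *)
Definition det_moment_stmt n m := forall w : 'I_n -> R, (forall i, 0 <= w i) ->
  (\int[cgauss R n m]_Y (gdet w Y)%:E = (m`!%:R * (epoly w)`_m)%:E)%E.

(** After [gdet_mcons], left unitary invariance removes [U], the hypothesis gives the symmetric
    function of the new weights [u], and [schur_spectral] expresses its product with [qform w v] in
    the original weights. If [qform w v] is 0, both sides vanish. *)
Lemma det_moment_cond n m (w : 'I_n -> R) (v : 'cV[C]_n) : det_moment_stmt n m ->
  (forall i, 0 <= w i) ->
  (\int[cgauss R n m]_Y (gdet w (mcons (v, Y)))%:E =
   (m`!%:R * \sum_k (w k * nsq (v k 0)) * (epoly' w k)`_m)%:E)%E.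
Proof.
move=> IH w0.
have := qform_ge0 v w0; rewrite le_eqVlt => /orP[/eqP/esym q0|q0].
  under eq_integral do rewrite gdet_mcons0//.
  rewrite integral0 big1 ?mulr0// => k _.
  have /eqP := q0; rewrite psumr_eq0; last by move=> i _; rewrite mulr_ge0// nsq_ge0.
  by move=> /allP/(_ k (mem_index_enum _)) /= /eqP ->; rewrite mul0r.
have [U [u [hU u0 MU pU]]] := schur_spectral w0 q0.
under eq_integral do rewrite (gdet_mcons _ q0 MU) EFinM.
have mg : measurable_fun setT (fun Y : 'M[C]_(n, m) => (gdet u Y)%:E).
  by apply/measurable_EFinP; exact: measurable_gdet.
rewrite ge0_integralZl//=.
- rewrite (cgauss_lunitary hU mg); last by move=> Y; rewrite lee_fin gdet_ge0.
  rewrite IH// -EFinM; congr EFin; rewrite mulrCA; congr (_ * _).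
  have /(congr1 (fun p : {poly R} => p`_m)) := pU.
  by rewrite coefZ coef_sum => ->; apply: eq_bigr => k _; rewrite coefZ.
- exact: measurableT_comp mg (measurable_clmul U).
- by move=> Y _; rewrite lee_fin gdet_ge0.
- by rewrite lee_fin ltW.
Qed.

Lemma integral_nsq n (k : 'I_n) : (\int[cgaussV R n]_v (nsq (v k 0))%:E = 1)%E.
Proof.
have := @integral_cgaussV_nsq_exp R n (fun=> 0) k (fun=> lexx 0).
rewrite addr0 invr1 mul1r big1 => [<-|i _]; last by [].
apply: eq_integral => v _; rewrite big1 ?oppr0 ?expR0 ?mulr1// => i _.
by rewrite mul0r.
Qed.

Lemma ge0_integral_wsum n (c : 'I_n -> R) (F : 'I_n -> 'cV[C]_n -> R) :
  (forall k, 0 <= c k) -> (forall k v, 0 <= F k v) ->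
  (forall k, measurable_fun setT (F k)) ->
  (\int[cgaussV R n]_v (\sum_k c k * F k v)%:E =
   \sum_k (c k)%:E * \int[cgaussV R n]_v (F k v)%:E)%E.
Proof.
move=> c0 F0 mF.
under eq_integral do rewrite -sumEFin.
rewrite ge0_integral_sum//.
- apply: eq_bigr => k _.
  under eq_integral do rewrite EFinM.
  rewrite ge0_integralZl//=.
  + by apply/measurable_EFinP.
  + by move=> v _; rewrite lee_fin F0.
  + by rewrite lee_fin.
- move=> k; apply/measurable_EFinP; apply: measurable_funM => //; exact: measurable_cst.
- by move=> k v _; rewrite lee_fin mulr_ge0.
Qed.

Lemma det_moment n m : det_moment_stmt n m.
Proof.
elim: m => [|m IH] w w0.
  rewrite epoly_coef0 mulr1.
  under eq_integral do rewrite /gdet det_mx00.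
  by rewrite integral_cst//= probability_setT mule1.
apply: (etrans (integral_cgaussS _ _)).
- by apply/measurable_EFinP; exact: measurable_gdet.
- by move=> Y; rewrite lee_fin gdet_ge0.
under eq_integral do rewrite det_moment_cond//.
have e0 k : 0 <= (epoly' w k)`_m by exact: epoly_coef_ge0.
transitivity (\int[cgaussV R n]_v (\sum_k (m`!%:R * w k * (epoly' w k)`_m) * nsq (v k 0))%:E)%E.
  apply: eq_integral => v _; congr EFin; rewrite mulr_sumr; apply: eq_bigr => k _; ring.
rewrite ge0_integral_wsum//.
- under eq_bigr do rewrite integral_nsq mule1.
  rewrite sumEFin; congr EFin; under eq_bigr do rewrite -mulrA.
  by rewrite -mulr_sumr epoly_coef_rec factS natrM mulrA [in RHS](mulrC _ m`!%:R).
- by move=> k; rewrite !mulr_ge0.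
- by move=> k v; exact: nsq_ge0.
- by move=> k; apply: measurable_nsq; exact: measurable_entry.
Qed.

(** * Reduction of a ratio of determinants to a single Gaussian column *)

Definition sdet n m (d : 'I_n -> R) (s : R) (X : 'M[C]_(n, m)) : R :=
  complex.Re (\det (s%:C%:M + X^t* *m Dmx d *m X)).

Lemma sdet_spectral n m (d : 'I_n -> R) (X : 'M[C]_(n, m)) : (forall i, 0 <= d i) ->
  exists (U : 'M[C]_m) (w : 'I_m -> R), [/\ U \is unitarymx, forall i, 0 <= w i,
   X^t* *m Dmx d *m X = U^t* *m Dmx w *m U &
   forall s, \det (s%:C%:M + X^t* *m Dmx d *m X) = (\prod_i (s + w i))%:C].
Proof.
move=> d0; rewrite wgram_gram//.
have [U [w [hU w0 E]]] := gram_spectral (Dmx (fun i => Num.sqrt (d i)) *m X).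
exists U, w; split => // s; rewrite E -det_Dmx -(det_unitary_conj _ hU); congr (\det _).
have -> : Dmx (fun i => s + w i) = s%:C%:M + Dmx w.
  apply/matrixP => i j; rewrite Dmx_entry [RHS]mxE Dmx_entry [X in _ = X + _]mxE.
  by case: eqP => _; rewrite ?mulr1n ?mulr0n ?addr0// rmorphD.
rewrite mulmxDr mulmxDl mul_mx_scalar -scalemxAl (unitarymx_tC hU).
by rewrite scalemx1.
Qed.

Lemma sdet_gt0 n m (d : 'I_n -> R) s (X : 'M[C]_(n, m)) : (forall i, 0 <= d i) ->
  0 < s -> 0 < sdet d s X.
Proof.
move=> d0 s0; rewrite /sdet; have [U [w [_ w0 _ ->]]] := sdet_spectral X d0.
by rewrite /= prodr_gt0// => i _; rewrite ltr_pwDl.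
Qed.

Lemma measurable_sdet n m (d : 'I_n -> R) s :
  measurable_fun setT (fun X : 'M[C]_(n, m) => sdet d s X).
Proof.
apply: measurable_cRe; apply: measurable_det; apply: measurable_mxD.
  exact: measurable_cst.
apply: measurable_mxM => //.
by apply: measurable_mxM; [exact: measurable_mxtC|exact: measurable_cst].
Qed.

Lemma qform_mul n m (d : 'I_n -> R) (X : 'M[C]_(n, m)) (U : 'M[C]_m) (w : 'I_m -> R) z :
  X^t* *m Dmx d *m X = U^t* *m Dmx w *m U ->
  qform d (X *m z) = qform w (U *m z).
Proof.
move=> E; suff : (qform d (X *m z))%:C = (qform w (U *m z))%:C :> C by case.
rewrite -!quad_form.
have -> : (X *m z)^t* *m Dmx d *m (X *m z) = z^t* *m (X^t* *m Dmx d *m X) *m z.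
  by rewrite adjM !mulmxA.
by rewrite E adjM !mulmxA.
Qed.

(** In an eigenbasis of X^* D X this is [integral_cgaussV_exp]: each factor 1/(1 + w_k/s), with one
    power of 1/s, becomes 1/(s + w_k). The matrix X now enters only through the vector X z. *)
Lemma sdet_inv n m (d : 'I_n -> R) s (X : 'M[C]_(n, m)) : (forall i, 0 <= d i) ->
  0 < s ->
  ((sdet d s X)^-1%:E =
   (s ^- m)%:E * \int[cgaussV R m]_z (expR (- (s^-1 * qform d (X *m z)))) %:E)%E.
Proof.
move=> d0 s0; rewrite /sdet; have [U [w [hU w0 E ->]]] := sdet_spectral X d0.
transitivity ((s ^- m)%:E * \int[cgaussV R m]_z
   (expR (- \sum_k (s^-1 * w k) * nsq (z k 0)))%:E)%E; last first.
  congr (_ * _)%E.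
  rewrite -(cgaussV_unitary hU); first last.
  - by move=> z; rewrite lee_fin expR_ge0.
  - by apply/measurable_EFinP; exact: measurable_cquad.
  apply: eq_integral => z _; congr (expR (- _))%:E.
  by rewrite (qform_mul _ E) /qform mulr_sumr; apply: eq_bigr => k _; rewrite mulrA.
rewrite integral_cgaussV_exp; last by move=> k; rewrite mulr_ge0// invr_ge0 ltW.
rewrite -EFinM /=; congr EFin.
rewrite -prodfV -exprVn -[in s^-1 ^+ m](card_ord m) -prodr_const -big_split /=.
apply: eq_bigr => k _; rewrite -invfM; congr (_^-1).
by rewrite mulrDr mulr1 mulrA mulfV ?gt_eqF// mul1r.
Qed.

Lemma unitary_first_col m (z : 'cV[C]_m.+1) : exists (V : 'M[C]_m.+1) (c : C),
  [/\ V \is unitarymx, z = V *m (c *: delta_mx 0 0) & nsq c = \sum_k nsq (z k 0)].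
Proof.
(* All rows are equal to z^*, so the first Gram-Schmidt row spans it up to a scalar, and z = 0 is no
   special case. *)
pose A : 'M[C]_m.+1 := \matrix_(i, j) (z^t* 0 j).
pose U := schmidt A.
have hU : U \is unitarymx by rewrite schmidt_unitarymx.
have := row_schmidt_sub A 0.
rewrite (big_pred1 0); last by move=> k; rewrite leqn0.
rewrite genmxE => /sub_rVP[a].
have -> : row 0 A = z^t* by apply/rowP => j; rewrite !mxE.
rewrite rowE => zE.
pose V := U^t*.
have hV : V \is unitarymx by rewrite trmxC_unitary.
have zV : z = V *m (a^* *: delta_mx 0 0).
  rewrite -[z]trmxCK zE -scalemxAr /V.
  apply/matrixP => i j; rewrite (ord1 j) mxE mxE mxE rmorphM /=.
  rewrite [RHS]mxE; congr (_ * _).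
  rewrite -rowE -colE !mxE //.
exists V, (a^*); split => //.
have : (z^t* *m z) 0 0 = (nsq a^*)%:C.
  rewrite zV adjM -!mulmxA (mulmxA (V^t*)) (unitarymx_tC hV) mul1mx.
  rewrite mxE (bigD1 0)//= big1 => [|k k0].
    by rewrite !mxE eqxx mulr1 addr0; exact: nsq_conj.
  by rewrite !mxE (negbTE k0) !mulr0.
rewrite mxE => h.
have : (nsq a^*)%:C = (\sum_k nsq (z k 0))%:C :> C.
  rewrite -h rmorph_sum; apply: eq_bigr => k _; rewrite !mxE; exact: nsq_conj.
by case.
Qed.

Lemma qform_scale n (d : 'I_n -> R) c (v : 'cV[C]_n) :
  qform d (c *: v) = nsq c * qform d v.
Proof.
rewrite /qform mulr_sumr; apply: eq_bigr => k _; rewrite mxE /nsq.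
case: c (v k 0) => a b [x y] /=; ring.
Qed.

(* Averaging over the unitary invariance replaces [det (s + W)] by the power of
   a single diagonal entry. *)
Lemma gdet_over_sdet n m (a d : 'I_n -> R) s :
  (forall i, 0 <= a i) -> (forall i, 0 <= d i) -> 0 < s ->
  (\int[cgauss R n m.+1]_X (gdet a X / sdet d s X)%:E =
   \int[cgauss R n m.+1]_X (gdet a X / (s + qform d (col 0 X)) ^+ m.+1)%:E)%E.
Proof.
move=> a0 d0 s0; set L := m.+1.
have si0 : 0 <= s^-1 by rewrite invr_ge0 ltW.
pose E (X : 'M[C]_(n, L)) (z : 'cV[C]_L) := expR (- (s^-1 * qform d (X *m z))).
pose E0 (X : 'M[C]_(n, L)) (z : 'cV[C]_L) :=
  expR (- \sum_k (s^-1 * qform d (col 0 X)) * nsq (z k 0)).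
have mg (X : 'M[C]_(n, L)) : measurable_fun setT (fun X : 'M[C]_(n, L) => gdet a X) by exact: measurable_gdet.
have mEE : measurable_fun setT (fun p : 'cV[C]_L * 'M[C]_(n, L) => (gdet a p.2 * E p.2 p.1)%:E).
  apply/measurable_EFinP; apply: measurable_funM.
    exact: measurableT_comp (measurable_gdet a) measurable_snd.
  apply: measurableT_comp => //; apply: measurable_funN; apply: measurable_funM.
    exact: measurable_cst.
  apply: measurableT_comp (measurable_qform d) _.
  exact: measurable_mxM measurable_snd measurable_fst.
have mEE0 : measurable_fun setT (fun p : 'cV[C]_L * 'M[C]_(n, L) => (gdet a p.2 * E0 p.2 p.1)%:E).
  apply/measurable_EFinP; apply: measurable_funM.
    exact: measurableT_comp (measurable_gdet a) measurable_snd.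
  apply: measurableT_comp => //; apply: measurable_funN.
  apply: measurable_real_sum => k; apply: measurable_funM.
    apply: measurable_funM; first exact: measurable_cst.
    apply: measurableT_comp (measurable_qform d) _.
    rewrite (_ : (fun t => _) = (fun p : 'cV[C]_L * 'M[C]_(n, L) => p.2 *m delta_mx 0 0)).
      by apply: measurable_mxM; [exact: measurable_snd|exact: measurable_cst].
    by apply/funext => p; rewrite colE.
  apply: measurable_nsq; exact: measurableT_comp (measurable_entry k 0) measurable_fst.
have nn p : (0 <= (gdet a p.2 * E p.2 p.1)%:E)%E.
  by rewrite lee_fin mulr_ge0 ?gdet_ge0 ?expR_ge0.
have nn0 p : (0 <= (gdet a p.2 * E0 p.2 p.1)%:E)%E.
  by rewrite lee_fin mulr_ge0 ?gdet_ge0 ?expR_ge0.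
(* For fixed [z], replacing X by X V^* turns X z into the first column times a scalar of squared
   modulus |z|^2, and leaves [gdet] unchanged. *)
have rot z : (\int[cgauss R n L]_X (gdet a X * E X z)%:E =
              \int[cgauss R n L]_X (gdet a X * E0 X z)%:E)%E.
  have [V [c [hV zV cz]]] := unitary_first_col z.
  have hVt : V^t* \is unitarymx by rewrite trmxC_unitary.
  rewrite -(cgauss_runitary hVt); first last.
  - by move=> X; exact: (nn (z, X)).
  - exact: (measurableT_comp mEE (measurable_fun_pair (measurable_cst z) (@measurable_id _ _ setT))).
  apply: eq_integral => X _; rewrite gdet_runitary//; congr (_ * expR (- _))%:E.
  have -> : X *m V^t* *m z = c *: col 0 X.
    by rewrite {1}zV -mulmxA (mulmxA (V^t*)) (unitarymx_tC hV) mul1mx -scalemxAr -colE.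
  by rewrite qform_scale cz -[RHS]mulr_sumr; ring.
transitivity ((s ^- L)%:E * \int[cgauss R n L]_X \int[cgaussV R L]_z (gdet a X * E X z)%:E)%E.
  rewrite -ge0_integralZl//.
  - apply: eq_integral => X _; rewrite EFinM sdet_inv// muleCA; congr (_ * _)%E.
    rewrite -ge0_integralZl//.
    + apply/measurable_EFinP; apply: measurableT_comp => //; apply: measurable_funN.
      apply: measurable_funM; first exact: measurable_cst.
      exact: measurableT_comp (measurable_qform d) (measurable_clmul X).
    + by rewrite lee_fin gdet_ge0.
  - exact: (@measurable_fun_fubini_tonelli_G _ _ _ _ R (cgaussV R L) _ mEE nn).
  - by move=> X _; apply: integral_ge0 => z _; exact: (nn (z, X)).
  - by rewrite lee_fin invr_ge0 exprn_ge0// ltW.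
have -> : (\int[cgauss R n L]_X \int[cgaussV R L]_z (gdet a X * E X z)%:E =
  \int[cgauss R n L]_X \int[cgaussV R L]_z (gdet a X * E0 X z)%:E)%E.
  rewrite -(@fubini_tonelli _ _ _ _ R (cgaussV R L) (cgauss R n L) _ mEE nn).
  rewrite -(@fubini_tonelli _ _ _ _ R (cgaussV R L) (cgauss R n L) _ mEE0 nn0).
  by apply: eq_integral => z _; exact: rot.
rewrite -ge0_integralZl//.
- apply: eq_integral => X _.
  under eq_integral do rewrite EFinM.
  have q0 : 0 <= qform d (col 0 X) by exact: qform_ge0.
  rewrite ge0_integralZl//.
  + rewrite integral_cgaussV_exp; last by move=> k; rewrite mulr_ge0.
    rewrite prodr_const card_ord -!EFinM; congr EFin.
    rewrite mulrCA; congr (_ * _); rewrite exprVn -invfM; congr (_^-1).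
    rewrite -exprMn; congr (_ ^+ _).
    by rewrite mulrDr mulr1 mulrA mulfV ?gt_eqF// mul1r.
  + by apply/measurable_EFinP; exact: measurable_cquad.
  + by move=> *; rewrite lee_fin ?expR_ge0 ?gdet_ge0.
  + by rewrite lee_fin gdet_ge0.
- exact: (@measurable_fun_fubini_tonelli_G _ _ _ _ R (cgaussV R L) _ mEE0 nn0).
- by move=> X _; apply: integral_ge0 => z _; exact: (nn0 (z, X)).
- by rewrite lee_fin invr_ge0 exprn_ge0// ltW.
Qed.

Lemma measurable_col0 n m :
  measurable_fun setT (fun X : 'M[C]_(n, m.+1) => col 0 X).
Proof.
apply/measurable_matrixP => i j.
rewrite (_ : (fun t => _) = (fun X : 'M[C]_(n, m.+1) => X i 0)).
  exact: measurable_entry.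
by apply/funext => X; rewrite mxE.
Qed.

Lemma gdet_over_sdet_col n m (a d : 'I_n -> R) s :
  (forall i, 0 <= a i) -> (forall i, 0 <= d i) -> 0 < s ->
  (\int[cgauss R n m.+1]_X (gdet a X / sdet d s X)%:E =
   \int[cgaussV R n]_v (m`!%:R / (s + qform d v) ^+ m.+1 *
      \sum_k (a k * nsq (v k 0)) * (epoly' a k)`_m)%:E)%E.
Proof.
move=> a0 d0 s0; rewrite gdet_over_sdet//.
have c0 v : 0 <= (s + qform d v)^-1 by rewrite invr_ge0 addr_ge0 ?qform_ge0// ltW.
apply: (etrans (integral_cgaussS _ _)).
- apply/measurable_EFinP; apply: measurable_funM; first exact: measurable_gdet.
  apply: measurable_invr; apply: measurable_funX; apply: measurable_funD.
    exact: measurable_cst.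
  exact: measurableT_comp (measurable_qform d) (@measurable_col0 n m).
- by move=> X; rewrite lee_fin -exprVn mulr_ge0 ?gdet_ge0// exprn_ge0.
apply: eq_integral => v _.
have colv (Y : 'M[C]_(n, m)) : col 0 (mcons (v, Y)) = v.
  by apply/matrixP => i j; rewrite (ord1 j) mxE mcons0.
transitivity (((s + qform d v) ^- m.+1)%:E * \int[cgauss R n m]_Y (gdet a (mcons (v, Y)))%:E)%E.
  rewrite -ge0_integralZl//.
  - by apply: eq_integral => Y _; rewrite -EFinM colv mulrC.
  - apply/measurable_EFinP; apply: measurableT_comp (measurable_gdet a) _.
    apply: measurableT_comp (@measurable_mcons R n m) _; exact: measurable_fun_pair.
  - by move=> Y _; rewrite lee_fin gdet_ge0.
  - by rewrite lee_fin -exprVn exprn_ge0.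
rewrite det_moment_cond//; last exact: det_moment.
by rewrite -EFinM; congr EFin; rewrite mulrA [in RHS](mulrC m`!%:R).
Qed.

End det_moment.

(** * Expectation of a ratio of determinants *)

Section derivation_rules.
Variable R : realType.
Implicit Types (f g : R -> R) (x a b : R).

Lemma derive_cstR (c x : R) : is_derive x 1 (fun=> c) 0.
Proof. exact: is_derive_cst. Qed.

Lemma derive_idR (x : R) : is_derive x 1 (fun y => y) 1.
Proof. exact: is_derive_id. Qed.

Lemma derive_addR f g x a b : is_derive x 1 f a -> is_derive x 1 g b ->
  is_derive x 1 (fun y => f y + g y) (a + b).
Proof. exact: is_deriveD. Qed.

Lemma derive_oppR f x a : is_derive x 1 f a -> is_derive x 1 (fun y => - f y) (- a).
Proof. exact: is_deriveN. Qed.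

Lemma derive_mulR f g x a b : is_derive x 1 f a -> is_derive x 1 g b ->
  is_derive x 1 (fun y => f y * g y) (a * g x + f x * b).
Proof.
move=> df dg; apply: (is_derive_eq (is_deriveM df dg)).
by rewrite /GRing.scale /= addrC [g x * a]mulrC.
Qed.

Lemma derive_mulcR (c : R) f x a : is_derive x 1 f a ->
  is_derive x 1 (fun y => c * f y) (c * a).
Proof.
move=> df; apply: (is_derive_eq (derive_mulR (derive_cstR c x) df)).
by rewrite mul0r add0r.
Qed.

Lemma derive_compR f g x a b : is_derive (g x) 1 f a -> is_derive x 1 g b ->
  is_derive x 1 (fun y => f (g y)) (a * b).
Proof. by move=> df dg; apply: (is_derive_eq (is_derive1_comp df dg)). Qed.

Lemma derive_expR_comp f x a : is_derive x 1 f a ->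
  is_derive x 1 (fun y => expR (f y)) (expR (f x) * a).
Proof. by move=> df; apply: derive_compR. Qed.

Lemma derive_ln_comp f x a : 0 < f x -> is_derive x 1 f a ->
  is_derive x 1 (fun y => ln (f y)) ((f x)^-1 * a).
Proof. by move=> fx df; apply: derive_compR; exact: is_derive1_ln. Qed.

Lemma derive_exprR n x : is_derive x 1 (fun y : R => y ^+ n) (n%:R * x ^+ n.-1).
Proof.
elim: n => [|n IH].
  by rewrite mul0r; exact: derive_cstR.
rewrite (_ : (fun y => _) = fun y => y * y ^+ n); last by apply/funext => y; rewrite exprS.
apply: (is_derive_eq (derive_mulR (derive_idR x) IH)).
case: n {IH} => [|n] /=; first by rewrite mul0r mulr0 addr0.
by rewrite exprS -[n.+2%:R]natr1; ring.
Qed.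

Lemma derive_invR f x a : f x != 0 -> is_derive x 1 f a ->
  is_derive x 1 (fun y => (f y)^-1) (- (a / f x ^+ 2)).
Proof.
move=> fx df; have fd : derivable f x 1 by exact: ex_derive.
apply: DeriveDef; first exact: derivableV.
by rewrite deriveV// derive_val [LHS]mulNr mulrC.
Qed.

Lemma derive_sumR (I : Type) (s : seq I) (f : I -> R -> R) (a : I -> R) x :
  (forall i, is_derive x 1 (f i) (a i)) ->
  is_derive x 1 (fun y => \sum_(i <- s) f i y) (\sum_(i <- s) a i).
Proof.
move=> df; elim: s => [|i s IH].
  rewrite big_nil (_ : (fun y => _) = fun=> 0); last by apply/funext => y; rewrite big_nil.
  exact: derive_cstR.
rewrite big_cons (_ : (fun y => _) = fun y => f i y + \sum_(j <- s) f j y).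
  exact: derive_addR.
by apply/funext => y; rewrite big_cons.
Qed.

End derivation_rules.

Section main_formula.
Variable R : realType.
Local Notation C := R[i].
Local Notation leb := (@lebesgue_measure R).

(** Primitive of [x ^+ n * expR (- (b * x))], from repeated integration by parts. *)
Fixpoint gamma_prim (b : R) n (x : R) : R :=
  match n with
  | 0 => - (b^-1 * expR (- (b * x)))
  | k.+1 => - (b^-1 * (x ^+ k.+1 * expR (- (b * x)))) + k.+1%:R / b * gamma_prim b k x
  end.

Lemma is_derive_gamma_prim (b : R) n (x : R) : b != 0 ->
  is_derive x 1 (gamma_prim b n) (x ^+ n * expR (- (b * x))).
Proof.
move=> b0.
have de : is_derive x 1 (fun y => expR (- (b * y))) (expR (- (b * x)) * - (b * 1)).
  by apply: derive_expR_comp; apply: derive_oppR; apply: derive_mulcR; exact: derive_idR.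
elim: n => [|n IH] /=.
  apply: (is_derive_eq (derive_oppR (derive_mulcR b^-1 de))).
  by rewrite expr0; field.
apply: (is_derive_eq (derive_addR
  (derive_oppR (derive_mulcR b^-1 (derive_mulR (derive_exprR n.+1 x) de)))
  (derive_mulcR (n.+1%:R / b) IH))).
by rewrite /= exprS; field.
Qed.

Lemma cvg_exprn_expR (b : R) n : 0 < b ->
  (x ^+ n * expR (- (b * x))) @[x --> +oo] --> (0 : R).
Proof.
move=> b0.
(* From e^(b x) >= (b x)^(n+1) / (n+1)!, the function is at most [c / x]. *)
pose c := n.+1`!%:R / b ^+ n.+1.
apply: (squeeze_cvgr (f := fun=> 0) (h := fun x => c * x^-1)).
- near=> x.
  have x0 : 0 < x by [].
  rewrite mulr_ge0 ?expR_ge0 ?exprn_ge0 ?(ltW x0)//=.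
  have bx : 0 <= b * x by rewrite mulr_ge0// ltW.
  have := expR_ge1Dxn n bx; set E := expR _ => hE.
  have E0 : 0 < E by exact: expR_gt0.
  rewrite expRN -/E ler_pdivrMr// /c.
  have f0 : 0 < (n.+1)`!%:R :> R by rewrite ltr0n fact_gt0.
  apply: (@le_trans _ _ ((n.+1)`!%:R / b ^+ n.+1 / x * ((b * x) ^+ n.+1 / (n.+1)`!%:R))).
    rewrite exprMn (_ : _ * _ = x ^+ n)// [x ^+ n.+1]exprSr; field.
    by rewrite !gt_eqF// exprn_gt0.
  rewrite ler_wpM2l//; last by lra.
  by rewrite !divr_ge0// ?exprn_ge0// ltW.
- exact: cvg_cst.
- rewrite -[X in _ --> X](mulr0 c); apply: cvgM; first exact: cvg_cst.
  by apply/gtr0_cvgV0; [near=> x|exact: cvg_id].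
Unshelve. all: by end_near. Qed.

Lemma gamma_integral (b : R) n : 0 < b ->
  (\int[leb]_(x in `[0%R, +oo[) ((x : R) ^+ n * expR (- (b * x)))%:E =
   (n`!%:R / b ^+ n.+1)%:E)%E.
Proof.
move=> b0; have b1 : b != 0 by rewrite gt_eqF.
have prim0 : gamma_prim b n 0 = - (n`!%:R / b ^+ n.+1).
  elim: n => [|n IH] /=; first by rewrite mulr0 oppr0 expR0 fact0 expr1 mul1r mulr1.
  rewrite IH expr0n /= mul0r mulr0 oppr0 add0r factS natrM !exprS; field.
  by rewrite b1 expf_neq0.
have primy : gamma_prim b n x @[x --> +oo] --> (0 : R).
  elim: n {prim0} => [|n IH] /=.
    rewrite -[X in _ --> X]oppr0 -[X in - X](mulr0 b^-1).
    apply: cvgN; apply: cvgM; first exact: cvg_cst.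
    by have := cvg_exprn_expR 0 b0; under eq_fun do rewrite expr0 mul1r.
  rewrite -[X in _ --> X]addr0 -[X in X + _]oppr0 -[X in - X + _](mulr0 b^-1) -[X in _ + X](mulr0 (n.+1%:R / b)).
  apply: cvgD; last by apply: cvgM => //; exact: cvg_cst.
  by apply: cvgN; apply: cvgM; [exact: cvg_cst|exact: cvg_exprn_expR].
have dprim (x : R) : is_derive x 1 (gamma_prim b n) (x ^+ n * expR (- (b * x))).
  exact: is_derive_gamma_prim.
rewrite (@ge0_continuous_FTC2y _ _ (gamma_prim b n) 0 0)//.
- by rewrite prim0 sub0e -EFinN opprK.
- by move=> x x0; rewrite mulr_ge0 ?expR_ge0// exprn_ge0.
- apply: continuous_subspaceT => x; apply: cvgM; first exact: exprn_continuous.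
  apply: continuous_comp; last exact: continuous_expR.
  by apply: cvgN; apply: cvgM; [exact: cvg_cst|exact: cvg_id].
- apply: cvg_at_right_filter; apply: differentiable_continuous.
  exact/derivable1_diffP.
- by move=> x _; rewrite derive1E; exact: derive_val.
Qed.

(** [gamma_integral] writes m!/(s + q)^(m+1) as the integral of r^m e^(-(s + q) r). After Tonelli,
    the average over the column at fixed r is [integral_cgaussV_nsq_exp] with weights [r * d k]. *)
Lemma det_ratio n m (a d : 'I_n -> R) s :
  (forall i, 0 <= a i) -> (forall i, 0 <= d i) -> 0 < s ->
  (\int[cgauss R n m.+1]_X (gdet a X / sdet d s X)%:E =
   \int[leb]_(r in `[0%R, +oo[) ((r : R) ^+ m * expR (- (s * r)) *
     ((\sum_k a k * (epoly' a k)`_m / (1 + r * d k)) * \prod_k (1 + r * d k)^-1))%:E)%E.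
Proof.
move=> a0 d0 s0; rewrite gdet_over_sdet_col//.
have e0 k : 0 <= (epoly' a k)`_m by exact: epoly_coef_ge0.
pose S (v : 'cV[C]_n) : R := \sum_k (a k * nsq (v k 0)) * (epoly' a k)`_m.
have S0 v : 0 <= S v by apply: sumr_ge0 => k _; rewrite !mulr_ge0// nsq_ge0.
have mS : measurable_fun setT S.
  apply: measurable_real_sum => k; apply: measurable_funM; last exact: measurable_cst.
  apply: measurable_funM; first exact: measurable_cst.
  by apply: measurable_nsq; exact: measurable_entry.
(* The half-line is encoded by a cut-off, so that Tonelli applies on the whole product space. *)
pose K (p : 'cV[C]_n * R) : R :=
  if 0 <= p.2 then S p.1 * (p.2 ^+ m * expR (- ((s + qform d p.1) * p.2))) else 0.
have K0 p : (0 <= (K p)%:E)%E.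
  rewrite lee_fin /K; case: ifP => // p0.
  by rewrite !mulr_ge0// ?exprn_ge0// expR_ge0.
have mK : measurable_fun setT (fun p => (K p)%:E).
  apply/measurable_EFinP; apply: measurable_fun_ifT => //.
  - by apply: measurable_fun_ler.
  - apply: measurable_funM; first exact: measurableT_comp mS measurable_fst.
    apply: measurable_funM; first by apply: measurable_funX; exact: measurable_snd.
    apply: measurableT_comp => //; apply: measurable_funN; apply: measurable_funM; last exact: measurable_snd.
    apply: measurable_funD; first exact: measurable_cst.
    exact: measurableT_comp (measurable_qform d) measurable_fst.
have sq v : 0 < s + qform d v by rewrite ltr_pwDl// qform_ge0.
transitivity (\int[cgaussV R n]_v \int[leb]_r (K (v, r))%:E)%E.
  apply: eq_integral => v _.
  rewrite -/(S v) mulrC EFinM -gamma_integral// integral_mkcond.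
  rewrite -ge0_integralZl//.
  - apply: eq_integral => r _; rewrite patchE /K /= mem_setE in_itv /= andbT.
    by case: ifP => _; rewrite ?mule0.
  - apply/(measurable_restrictT _ _).1 => //; apply/measurable_EFinP.
    apply: measurable_funTS; apply: measurable_funM; first exact: measurable_funX.
    apply: measurableT_comp => //; apply: measurable_funN.
    exact: mulrl_measurable.
  - move=> r _; rewrite patchE mem_setE in_itv /= andbT; case: ifP => // r0.
    by rewrite lee_fin mulr_ge0 ?expR_ge0// exprn_ge0.
  - by rewrite lee_fin.
rewrite (@fubini_tonelli _ _ _ _ R (cgaussV R n) [the {sigma_finite_measure set _ -> \bar _} of leb] _ mK K0).
rewrite [RHS]integral_mkcond; apply: eq_integral => r _.
rewrite patchE mem_setE in_itv /= andbT /K /=; case: ifP => r0; last by rewrite integral0.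
have rd0 k : 0 <= r * d k by rewrite mulr_ge0.
pose N (v : 'cV[C]_n) := expR (- \sum_k (r * d k) * nsq (v k 0)).
transitivity (\int[cgaussV R n]_v (\sum_k ((r ^+ m * expR (- (s * r))) * (a k * (epoly' a k)`_m)) *
   (nsq (v k 0) * N v))%:E)%E.
  apply: eq_integral => v _; congr EFin.
  have -> : expR (- ((s + qform d v) * r)) = expR (- (s * r)) * N v.
    rewrite -expRD /N; congr expR; rewrite mulrDl opprD; congr (_ - _).
    by rewrite /qform mulr_suml; apply: eq_bigr => k _; ring.
  rewrite /S mulr_suml; apply: eq_bigr => k _; ring.
have intN k : (\int[cgaussV R n]_v (nsq (v k 0) * N v)%:E =
    ((1 + r * d k)^-1 * \prod_k (1 + r * d k)^-1)%:E)%E.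
  exact: integral_cgaussV_nsq_exp.
rewrite ge0_integral_wsum.
- rewrite (eq_bigr (fun k => (((r ^+ m * expR (- (s * r))) * (a k * (epoly' a k)`_m)) *
      ((1 + r * d k)^-1 * \prod_k (1 + r * d k)^-1))%:E)%R); last first.
    by move=> k _; rewrite [RHS]EFinM -(intN k).
  rewrite sumEFin; congr EFin; rewrite mulr_suml mulr_sumr; apply: eq_bigr => k _; ring.
- by move=> k; rewrite !mulr_ge0// ?expR_ge0// exprn_ge0.
- by move=> k v; rewrite mulr_ge0 ?nsq_ge0 ?expR_ge0.
- move=> k; apply: measurable_funM; last exact: measurable_cquad.
  by apply: measurable_nsq; exact: measurable_entry.
Qed.

End main_formula.

(** * Partial fractions and the Vandermonde determinant *)

Section partial_fractions.
Variables (R : realType) (n m : nat) (d : 'I_n -> R).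
Hypotheses (mn : (m.+1 < n)%N) (d_gt0 : forall i, 0 < d i) (d_inj : injective d).

Let mn' : (m < n)%N. Proof. exact: ltn_trans mn. Qed.
(** Rows are numbered from 0: this is the row replaced in [Gmx m.+1 d]. *)
Let l : 'I_n := Ordinal mn'.

(** Reversing the rows gives the usual Vandermonde matrix with increasing powers. *)
Lemma det_vandermonde_neq0 : \det (vandermonde d) != 0.
Proof.
pose s := perm (@rev_ord_inj n).
have VE : Vandermonde n (\row_i d i) = row_perm s (vandermonde d).
  apply/matrixP => j i; rewrite !mxE permE /=; congr (_ ^+ _).
  by have := ltn_ord j; lia.
have : \det (Vandermonde n (\row_i d i)) != 0.
  rewrite det_Vandermonde; apply/prodf_neq0 => i _; apply/prodf_neq0 => j ij.
  rewrite !mxE subr_eq0; apply/eqP => /d_inj ji; by rewrite ji ltnn in ij.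
by rewrite VE row_permE det_mulmx mulf_eq0 negb_or => /andP[].
Qed.

(** The entries of column [l] of the inverse Vandermonde matrix. *)
Definition pf_beta (i : 'I_n) : R := cofactor (vandermonde d) l i / \det (vandermonde d).

Lemma pf_betaP p : (p < n)%N ->
  \sum_i d i ^+ p * pf_beta i = (p == n - m.+1)%N%:R.
Proof.
move=> pn; have jP : (n - p.+1 < n)%N by lia.
pose j := Ordinal jP.
have /matrixP/(_ j l) := mul_mx_adj (vandermonde d).
rewrite [in X in X -> _]mxE [in X in _ = X -> _]mxE => h.
have -> : (p == n - m.+1)%N = (j == l).
  by rewrite -val_eqE /=; apply/eqP/eqP; lia.
apply: (mulfI det_vandermonde_neq0); rewrite mulr_sumr mulr_natr -h.
apply: eq_bigr => i _.
rewrite [adjugate _ _ _]mxE [vandermonde _ _ _]mxE /=.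
have -> : (n - (n - p.+1).+1 = p)%N by lia.
by rewrite /pf_beta mulrCA [X in _ * X]mulrC divfK ?det_vandermonde_neq0.
Qed.

(** The partial fraction coefficients of [psum d m.+1], by [psum_pf]. *)
Definition pf_alpha i := d i ^+ (n - m.+1) * pf_beta i.

Lemma size_epoly' i : (size (epoly' d i) <= n)%N.
Proof.
apply: leq_trans (size_prod_leq _ _) _ => //=.
rewrite (@leq_trans ((\sum_(j | j != i) 2).+1 - #|[pred j | j != i]|))//.
  rewrite leq_sub2r// ltnS; apply: leq_sum => j _.
  apply: leq_trans (size_polyD _ _) _; rewrite size_poly1 geq_max /=.
  by apply: leq_trans (size_scale_leq _ _) _; rewrite size_polyX.
rewrite sum_nat_const; have := cardC1 i; rewrite card_ord.
rewrite (_ : #|predC1 i| = #|[pred j | j != i]|)//; last first.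
lia.
Qed.

(** [epoly_coef_step] trades a step down in the coefficient index for one more power of d_i; at
    index 0 only [pf_betaP] remains. *)
Lemma pf_low k q : (k + q < m.+1)%N ->
  \sum_i d i ^+ (n - m.+1 + q) * pf_beta i * (epoly' d i)`_k =
  (q == 0)%:R * (epoly d)`_k.
Proof.
elim: k q => [|k IH] q kq.
  under eq_bigr do rewrite epoly'_coef0 mulr1.
  rewrite pf_betaP; last by lia.
  by rewrite epoly_coef0 mulr1; congr (_%:R); lia.
have -> : \sum_i d i ^+ (n - m.+1 + q) * pf_beta i * (epoly' d i)`_k.+1 =
   (\sum_i d i ^+ (n - m.+1 + q) * pf_beta i) * (epoly d)`_k.+1 -
   \sum_i d i ^+ (n - m.+1 + q.+1) * pf_beta i * (epoly' d i)`_k.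
  rewrite mulr_suml -sumrB; apply: eq_bigr => i _.
  by rewrite (epoly_coef_step d i k) addnS exprS; ring.
rewrite IH; last by lia.
rewrite mul0r subr0 pf_betaP; last by lia.
by congr (_%:R * _); lia.
Qed.

(** The same relation read backwards lowers the power of d_i and raises the index; once the power is
    0, the index exceeds the degree of [epoly' d i]. *)
Lemma pf_high k p : (p <= n - m.+1)%N -> (n <= k + p)%N ->
  \sum_i d i ^+ p * pf_beta i * (epoly' d i)`_k = 0.
Proof.
elim: p k => [|p IH] k pm kp.
  rewrite big1// => i _; rewrite [X in _ * X]nth_default ?mulr0//.
  by apply: leq_trans (size_epoly' i) _; lia.
have -> : \sum_i d i ^+ p.+1 * pf_beta i * (epoly' d i)`_k =
   (\sum_i d i ^+ p * pf_beta i) * (epoly d)`_k.+1 -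
   \sum_i d i ^+ p * pf_beta i * (epoly' d i)`_k.+1.
  rewrite mulr_suml -sumrB; apply: eq_bigr => i _.
  by rewrite (epoly_coef_step d i k) exprS; ring.
rewrite IH; [|lia|lia]; rewrite pf_betaP; last by lia.
by rewrite (_ : (p == _) = false) ?mul0r ?subr0//; apply/eqP; lia.
Qed.

Lemma pf_alpha_poly : \sum_i pf_alpha i *: epoly' d i = \poly_(k < m.+1) (epoly d)`_k.
Proof.
apply/polyP => k; rewrite coef_sum coef_poly.
under eq_bigr do rewrite coefZ.
case: ifP => km.
  by have := @pf_low k 0; rewrite !addn0 mul1r; apply.
by apply: pf_high => //; lia.
Qed.

(** The exponent [n - m.+2], meaningful since [m.+1 < n], selects another row in [pf_betaP]. This
    cancellation removes the ln r term at infinity in [cvg_Lam]. *)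
Lemma pf_alpha_sum : \sum_i pf_alpha i / d i = 0.
Proof.
have h : \sum_i d i ^+ (n - m.+2) * pf_beta i = 0.
  rewrite pf_betaP; last by lia.
  by rewrite (_ : (_ == _) = false)//; apply/eqP; lia.
rewrite -[RHS]h; apply: eq_bigr => i _; rewrite /pf_alpha (_ : (n - m.+1 = (n - m.+2).+1)%N); last by lia.
by rewrite exprSr mulrAC mulfK// gt_eqF.
Qed.

Definition pf_value : R := \sum_i pf_alpha i / d i * ln (d i).

(** Expansion along the replaced row, whose cofactors are those of the Vandermonde matrix. *)
Lemma pf_valueE : pf_value = \det (Gmx m.+1 d) / \det (vandermonde d).
Proof.
rewrite (expand_det_row _ l) mulr_suml; apply: eq_bigr => i _.
rewrite [Gmx _ _ _ _]mxE eqxx /pf_alpha.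
have -> : cofactor (Gmx m.+1 d) l i = cofactor (vandermonde d) l i.
  rewrite /cofactor; congr (_ * \det _); apply/matrixP => a b; rewrite !mxE.
  rewrite eqSS ifF//; apply/negbTE; have := neq_lift l a.
  by rewrite eq_sym -val_eqE.
rewrite /pf_beta (_ : (n - m.+1 = (n - m.+2).+1)%N); last by lia.
by rewrite exprSr; field; rewrite det_vandermonde_neq0 gt_eqF.
Qed.

End partial_fractions.

(** * One-dimensional integrals *)

Section calculus.
Variables (R : realType) (n : nat) (d : 'I_n -> R).
Local Notation leb := (@lebesgue_measure R).
Hypothesis d_gt0 : forall i, 0 < d i.

Definition cprod (r : R) : R := \prod_k (1 + r * d k)^-1.
Definition pterm k (r : R) : R := r ^+ k * (epoly d)`_k * cprod r.
(** The rational function Q of the overview is [psum L]: the first L terms of [epoly d] at r,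
    divided by its full value. *)
Definition psum p (r : R) : R := \sum_(k < p) pterm k r.
(** The integrand of [det_ratio] for a = d without the factor e^(-sr); [derive_psum] recognizes it
    as minus the derivative of a partial sum. *)
Definition pflux k (r : R) : R :=
  r ^+ k * ((\sum_j d j * (epoly' d j)`_k / (1 + r * d j)) * cprod r).

Lemma den_gt0 (r : R) k : 0 <= r -> 0 < 1 + r * d k.
Proof. by move=> r0; rewrite ltr_pwDl// mulr_ge0// ltW. Qed.

Lemma cprod_gt0 r : 0 <= r -> 0 < cprod r.
Proof. by move=> r0; apply: prodr_gt0 => k _; rewrite invr_gt0 den_gt0. Qed.

Let d_ge0 i : 0 <= d i. Proof. exact: ltW. Qed.

Lemma pterm_ge0 k r : 0 <= r -> 0 <= pterm k r.
Proof.
move=> r0; rewrite !mulr_ge0 ?exprn_ge0 ?(ltW (cprod_gt0 _))//.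
exact: epoly_coef_ge0.
Qed.

Lemma psum_ge0 p r : 0 <= r -> 0 <= psum p r.
Proof. by move=> r0; apply: sumr_ge0 => k _; exact: pterm_ge0. Qed.

Lemma pflux_ge0 k r : 0 <= r -> 0 <= pflux k r.
Proof.
move=> r0; rewrite !mulr_ge0 ?exprn_ge0 ?(ltW (cprod_gt0 _))//.
apply: sumr_ge0 => j _; rewrite divr_ge0 ?(ltW (den_gt0 _ _))// mulr_ge0//.
exact: epoly_coef_ge0.
Qed.

Lemma derive_den (r : R) k : is_derive r 1 (fun x => 1 + x * d k) (d k).
Proof.
apply: (is_derive_eq (derive_addR (derive_cstR 1 r)
  (derive_mulR (derive_idR r) (derive_cstR (d k) r)))).
by rewrite mulr0 addr0 mul1r add0r.
Qed.

Lemma derive_den_inv (r : R) k : 0 <= r ->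
  is_derive r 1 (fun x => (1 + x * d k)^-1) (- (d k / (1 + r * d k) ^+ 2)).
Proof. by move=> r0; apply: derive_invR; [rewrite gt_eqF// den_gt0|exact: derive_den]. Qed.

Lemma derive_cprod (r : R) : 0 <= r ->
  is_derive r 1 cprod (- (cprod r * \sum_j d j / (1 + r * d j))).
Proof.
move=> r0; rewrite /cprod.
have gen (s : seq 'I_n) : is_derive r 1 (fun x => \prod_(k <- s) (1 + x * d k)^-1)
   (- ((\prod_(k <- s) (1 + r * d k)^-1) * \sum_(j <- s) d j / (1 + r * d j))).
  elim: s => [|i s IH].
    rewrite !big_nil mulr0 oppr0 (_ : (fun x => _) = fun=> 1).
      exact: derive_cstR.
    by apply/funext => x; rewrite big_nil.
  rewrite (_ : (fun x => _) = fun x => (1 + x * d i)^-1 * \prod_(k <- s) (1 + x * d k)^-1).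
    apply: (is_derive_eq (derive_mulR (derive_den_inv i r0) IH)).
    rewrite !big_cons; have := den_gt0 i r0; move=> h; field.
    by rewrite gt_eqF.
  by apply/funext => x; rewrite big_cons.
exact: gen.
Qed.

Lemma derive_pterm k (r : R) : 0 <= r ->
  is_derive r 1 (pterm k) ((epoly d)`_k * cprod r *
     (k%:R * r ^+ k.-1 - r ^+ k * \sum_j d j / (1 + r * d j))).
Proof.
move=> r0.
apply: (is_derive_eq (derive_mulR (derive_mulR (derive_exprR k r) (derive_cstR _ r)) (derive_cprod r0))).
by rewrite mulr0 addr0; ring.
Qed.

Lemma derive_pterm0 (r : R) : 0 <= r -> is_derive r 1 (pterm 0) (- pflux 0 r).
Proof.
move=> r0; apply: (is_derive_eq (derive_pterm 0 r0)).
rewrite /pflux epoly_coef0 !expr0 mul0r add0r !mul1r mulrN mulrC; congr (- (_ * _)).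
by apply: eq_bigr => j _; rewrite epoly'_coef0 mulr1.
Qed.

(** The difference form makes the derivative of [psum] telescope to one term. It comes from
    splitting, in each summand of the logarithmic derivative of [cprod], the coefficient of index k
    + 1 according to whether d_j occurs. *)
Lemma derive_ptermS k (r : R) : 0 <= r ->
  is_derive r 1 (pterm k.+1) (pflux k r - pflux k.+1 r).
Proof.
move=> r0; apply: (is_derive_eq (derive_pterm k.+1 r0)).
rewrite /pflux; pose c := cprod r; pose e := (epoly d)`_k.+1.
pose S0 := \sum_j d j / (1 + r * d j).
pose T0 := \sum_j d j * (epoly' d j)`_k / (1 + r * d j).
pose T1 := \sum_j d j * (epoly' d j)`_k.+1 / (1 + r * d j).
rewrite -/c -/e -/S0 -/T0 -/T1.
have E : e * S0 * r = r * T1 + (k.+1%:R * e - T0).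
  have := epoly_coef_rec d k; rewrite -/e => <-.
  rewrite /S0 /T0 /T1 [e * _]mulr_sumr [LHS]mulr_suml [r * _]mulr_sumr -sumrB -big_split /=.
  apply: eq_bigr => j _; rewrite /e (epoly_coef_step d j k).
  by have := den_gt0 j r0 => h; field; rewrite gt_eqF.
have -> : e * c * (k.+1%:R * r ^+ k.+1.-1 - r ^+ k.+1 * S0) =
    c * r ^+ k * (k.+1%:R * e - e * S0 * r) by rewrite /= exprS; ring.
by rewrite E exprS; ring.
Qed.

Lemma derive_psum p (r : R) : 0 <= r -> is_derive r 1 (psum p.+1) (- pflux p r).
Proof.
move=> r0; elim: p => [|p IH].
  rewrite (_ : psum 1 = pterm 0); first exact: derive_pterm0.
  by apply/funext => x; rewrite /psum big_ord1.
rewrite (_ : psum p.+2 = fun x => psum p.+1 x + pterm p.+1 x).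
  by apply: (is_derive_eq (derive_addR IH (derive_ptermS p r0))); ring.
by apply/funext => x; rewrite /psum big_ord_recr.
Qed.

Lemma derivable_pflux k (r : R) : 0 <= r -> derivable (pflux k) r 1.
Proof.
move=> r0.
have ds := @derive_sumR R _ (index_enum 'I_n) _ _ r
  (fun j => derive_mulcR (d j * (epoly' d j)`_k) (derive_den_inv j r0)).
have := derive_mulR (derive_exprR k r) (derive_mulR ds (derive_cprod r0)) => h.
exact: ex_derive.
Qed.

Lemma ray_integral (f F : R -> R) (y : R) :
  (forall x, 0 <= x -> 0 <= f x) -> (forall x, 0 <= x -> derivable f x 1) ->
  (forall x : R, 0 <= x -> is_derive x 1 F (f x)) -> F x @[x --> +oo] --> y ->
  (\int[leb]_(x in `[0%R, +oo[) (f x)%:E = (y - F 0)%:E)%E.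
Proof.
move=> f0 df dF Fy.
rewrite (@ge0_continuous_FTC2y _ f F 0 y)//.
- by apply: derivable_within_continuous => x; rewrite in_itv/= andbT; exact: df.
- by move=> x x0; have := dF x (ltW x0) => h; exact: ex_derive.
- apply: cvg_at_right_filter; apply: differentiable_continuous.
  by apply/derivable1_diffP; have := dF 0 (lexx _) => h; exact: ex_derive.
- move=> x; rewrite in_itv/= andbT => x0; rewrite derive1E.
  by have := dF x (ltW x0) => h; exact: derive_val.
Qed.

Lemma cprod_cvg p : (p < n)%N -> (r ^+ p * cprod r) @[r --> +oo] --> (0 : R).
Proof.
move=> pn; pose c := \prod_k (d k)^-1.
have c0 : 0 <= c by apply: prodr_ge0 => k _; rewrite invr_ge0.
apply: (squeeze_cvgr (f := fun=> 0) (h := fun x => c * x^-1)).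
- near=> r.
  have r1 : 1 <= r by [].
  have r0 : 0 < r by rewrite (lt_le_trans ltr01).
  rewrite mulr_ge0 ?exprn_ge0 ?(ltW (cprod_gt0 _)) ?(ltW r0)//=.
  apply: (@le_trans _ _ (r ^+ p * (r ^- n * c))).
    rewrite ler_wpM2l ?exprn_ge0 ?(ltW r0)//.
    rewrite /c -exprVn -[in X in _ ^+ X](card_ord n) -prodr_const -big_split /=.
    apply: ler_prod => k _; rewrite invr_ge0 (ltW (den_gt0 _ (ltW r0))) /=.
    by rewrite -invfM lef_pV2 ?posrE ?mulr_gt0 ?den_gt0 ?(ltW r0)// lerDr.
  rewrite mulrA [c * _]mulrC ler_wpM2r//.
  rewrite ler_pdivrMr ?exprn_gt0// mulrC ler_pdivlMr// -exprSr.
  exact: ler_weXn2l.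
- exact: cvg_cst.
- rewrite -[X in _ --> X](mulr0 c); apply: cvgM; first exact: cvg_cst.
  by apply/gtr0_cvgV0; [near=> x|exact: cvg_id].
Unshelve. all: by end_near. Qed.

Lemma pterm_cvg p k : (p + k < n)%N -> (r ^+ p * pterm k r) @[r --> +oo] --> (0 : R).
Proof.
move=> pk.
rewrite (_ : (fun r => _) = (fun r => (epoly d)`_k * (r ^+ (p + k) * cprod r))).
  rewrite -[X in _ --> X](mulr0 (epoly d)`_k); apply: cvgM; first exact: cvg_cst.
  exact: cprod_cvg.
by apply/funext => r; rewrite /pterm exprD; ring.
Qed.

Lemma psum_cvg p q : (p + q <= n)%N -> (r ^+ p * psum q r) @[r --> +oo] --> (0 : R).
Proof.
elim: q => [|q IH] pq.
  rewrite (_ : (fun r => _) = cst 0); first exact: cvg_cst.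
  by apply/funext => r; rewrite /psum big_ord0 mulr0.
rewrite (_ : (fun r => _) = fun r => r ^+ p * psum q r + r ^+ p * pterm q r).
  rewrite -[X in _ --> X]addr0; apply: cvgD; first by apply: IH; lia.
  by apply: pterm_cvg; lia.
by apply/funext => r; rewrite /psum big_ord_recr mulrDr.
Qed.

End calculus.

(** * Closed forms of the integrals over the half-line *)

Section closed_forms.
Variables (R : realType) (n m : nat) (d : 'I_n -> R).
Local Notation leb := (@lebesgue_measure R).
Hypotheses (mn : (m.+1 < n)%N) (d_gt0 : forall i, 0 < d i) (d_inj : injective d).

Let d_ge0 i : 0 <= d i. Proof. exact: ltW. Qed.
Let alpha := pf_alpha d mn.

Lemma psum_pf (r : R) : 0 <= r -> psum d m.+1 r = \sum_i alpha i / (1 + r * d i).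
Proof.
move=> r0.
have /(congr1 (horner^~ r)) := pf_alpha_poly mn d_inj.
rewrite horner_sum horner_poly => h.
have -> : psum d m.+1 r = (\sum_(k < m.+1) (epoly d)`_k * r ^+ k) * cprod d r.
  by rewrite mulr_suml; apply: eq_bigr => k _; rewrite /pterm [_ * r ^+ k]mulrC.
rewrite -h mulr_suml; apply: eq_bigr => i _; rewrite hornerZ -mulrA; congr (_ * _).
rewrite /epoly' horner_prod /cprod [X in _ * X](bigD1 i)//= mulrCA -big_split /= big1 ?mulr1// => j _.
by rewrite hornerD hornerZ hornerX hornerC [d j * r]mulrC mulfV// gt_eqF// den_gt0.
Qed.

(** The primitive of [psum d m.+1] that vanishes at 0, from its partial fractions. *)
Let Lam (r : R) := \sum_i alpha i / d i * ln (1 + r * d i).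

Lemma derive_Lam (r : R) : 0 <= r -> is_derive r 1 Lam (psum d m.+1 r).
Proof.
move=> r0; rewrite psum_pf//.
have h i : is_derive r 1 (fun x => alpha i / d i * ln (1 + x * d i)) (alpha i / (1 + r * d i)).
  have pos := den_gt0 d_gt0 i r0.
  have h1 := @derive_ln_comp R (fun x => 1 + x * d i) r _ pos (derive_den d r i).
  apply: (is_derive_eq (derive_mulcR (alpha i / d i) h1)).
  by field; rewrite !gt_eqF.
exact: (derive_sumR (index_enum 'I_n) h).
Qed.

Lemma Lam0 : Lam 0 = 0.
Proof. by rewrite /Lam big1// => i _; rewrite mul0r addr0 ln1 mulr0. Qed.

(** ln(1 + r d_i) = ln r + ln d_i + ln(1 + 1/(r d_i)): the ln r terms cancel by [pf_alpha_sum] and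
    the last ones tend to 0. *)
Lemma cvg_Lam : Lam r @[r --> +oo] --> pf_value d mn.
Proof.
have h : (\sum_i alpha i / d i * (ln (d i) + ln (1 + r^-1 * (d i)^-1))) @[r --> +oo] --> pf_value d mn.
  have -> : pf_value d mn = \sum_i alpha i / d i * (ln (d i) + 0).
    by apply: eq_bigr => i _; rewrite addr0.
  have gen (s : seq 'I_n) :
      (\sum_(i <- s) alpha i / d i * (ln (d i) + ln (1 + r^-1 * (d i)^-1))) @[r --> +oo] -->
      \sum_(i <- s) alpha i / d i * (ln (d i) + 0).
    elim: s => [|i s IH].
      rewrite big_nil (_ : (fun r => _) = cst 0); first exact: cvg_cst.
      by apply/funext => r; rewrite big_nil.
    rewrite big_cons (_ : (fun r => _) = fun r : R => alpha i / d i * (ln (d i) + ln (1 + r^-1 * (d i)^-1)) +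
       \sum_(i <- s) alpha i / d i * (ln (d i) + ln (1 + r^-1 * (d i)^-1))); last first.
      by apply/funext => r; rewrite big_cons.
    apply: cvgD => //; apply: cvgM; first exact: cvg_cst.
    apply: cvgD; first exact: cvg_cst.
    rewrite -(@ln1 R); apply: continuous_cvg; first exact: continuous_ln.
    rewrite -[X in _ --> X]addr0 -[X in _ + X](mul0r (d i)^-1).
    apply: cvgD; first exact: cvg_cst.
    apply: cvgM; last exact: cvg_cst.
    by apply/gtr0_cvgV0; [near=> x|exact: cvg_id].
  exact: gen.
apply: cvg_trans h; apply: near_eq_cvg; near=> r.
have r0 : 0 < r by [].
rewrite /Lam; apply/esym.
transitivity (\sum_i (alpha i / d i * (ln (d i) + ln (1 + r^-1 * (d i)^-1)) + alpha i / d i * ln r)).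
  apply: eq_bigr => i _; rewrite -mulrDr; congr (_ * _).
  have q0 : 0 < 1 + r^-1 * (d i)^-1 by rewrite ltr_pwDl// mulr_ge0// invr_ge0// ltW.
  rewrite -lnM ?posrE// -lnM ?posrE ?mulr_gt0//; congr ln.
  by field; rewrite !gt_eqF.
by rewrite big_split /= -mulr_suml pf_alpha_sum// mul0r addr0.
Unshelve. all: by end_near. Qed.

Lemma derivable_psum (r : R) : 0 <= r -> derivable (psum d m.+1) r 1.
Proof. by move=> r0; have := derive_psum d_gt0 m r0 => h; exact: ex_derive. Qed.

Lemma integral_psum :
  (\int[leb]_(r in `[0%R, +oo[) (psum d m.+1 r)%:E = (pf_value d mn)%:E)%E.
Proof.
have dL := derive_Lam; have cL := cvg_Lam; have dp := derivable_psum.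
apply: (etrans (ray_integral (psum_ge0 d_gt0 _) dp dL cL)).
by rewrite Lam0 subr0.
Qed.

Lemma derive_exp_decay (s r : R) : is_derive r 1 (fun x => expR (- (s * x))) (- (s * expR (- (s * r)))).
Proof.
apply: (is_derive_eq (derive_expR_comp (derive_oppR (derive_mulcR s (derive_idR r))))).
by ring.
Qed.

Lemma psum0 : psum d m.+1 0 = 1.
Proof.
rewrite /psum big_ord_recl big1 => [|k _]; last first.
  by rewrite /pterm /= expr0n mul0r mul0r.
rewrite /pterm expr0 epoly_coef0 /cprod big1 ?mulr1 ?addr0// => k _.
by rewrite mul0r addr0 invr1.
Qed.

Lemma psum_cvg0 : psum d m.+1 r @[r --> +oo] --> (0 : R).
Proof.
have := @psum_cvg R n d d_gt0 0 m.+1; under eq_fun do rewrite expr0 mul1r.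
by apply; exact: ltnW.
Qed.

(** Integration by parts with primitive -e^(-sr) Q and Q(0) = 1. Stated as a sum, it stays among
    nonnegative integrals. *)
Lemma integral_pflux_exp (s : R) : 0 < s ->
  (\int[leb]_(r in `[0%R, +oo[) (expR (- (s * r)) * pflux d m r)%:E +
   s%:E * \int[leb]_(r in `[0%R, +oo[) (expR (- (s * r)) * psum d m.+1 r)%:E = 1)%E.
Proof.
move=> s0.
have mexp (f : R -> R) : (forall x, 0 <= x -> derivable f x 1) ->
   measurable_fun (`[0%R, +oo[%classic : set R) (fun r => (expR (- (s * r)) * f r)%:E).
  move=> df; apply/measurable_EFinP; apply: subspace_continuous_measurable_fun => //.
  apply: derivable_within_continuous => x; rewrite in_itv/= andbT => x0.
  apply: derivableM; last exact: df.
  by have := derive_exp_decay s x => h; exact: ex_derive.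
have dpf x : 0 <= x -> derivable (pflux d m) x 1 by move=> x0; exact: derivable_pflux.
rewrite -ge0_integralZl//; last first.
- by rewrite lee_fin ltW.
- move=> x /=; rewrite in_itv/= andbT => x0; rewrite lee_fin mulr_ge0 ?expR_ge0//.
  exact: psum_ge0.
- exact: mexp derivable_psum.
rewrite -ge0_integralD//; last first.
- by apply: measurable_funeM; exact: mexp derivable_psum.
- move=> x /=; rewrite in_itv/= andbT => x0; rewrite -EFinM lee_fin !mulr_ge0 ?expR_ge0 ?(ltW s0)//.
  exact: psum_ge0.
- exact: mexp dpf.
- move=> x /=; rewrite in_itv/= andbT => x0; rewrite lee_fin mulr_ge0 ?expR_ge0//.
  exact: pflux_ge0.
transitivity (\int[leb]_(r in `[0%R, +oo[) (expR (- (s * r)) * (pflux d m r + s * psum d m.+1 r))%:E)%E.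
  by apply: eq_integral => r _; rewrite -EFinM -EFinD; congr EFin; ring.
apply: (etrans (@ray_integral R (fun r => expR (- (s * r)) * (pflux d m r + s * psum d m.+1 r))
  (fun r => - (expR (- (s * r)) * psum d m.+1 r)) 0 _ _ _ _)).
- move=> x x0; apply: mulr_ge0; first exact: expR_ge0.
  apply: addr_ge0; first exact: pflux_ge0.
  by apply: mulr_ge0; [exact: ltW|exact: psum_ge0].
- move=> x x0; apply: derivableM.
    by have := derive_exp_decay s x => h; exact: ex_derive.
  apply: derivableD; first exact: dpf.
  by have := derive_mulcR s (derive_psum d_gt0 m x0) => h; exact: ex_derive.
- move=> x x0.
  apply: (is_derive_eq (derive_oppR (derive_mulR (derive_exp_decay s x) (derive_psum d_gt0 m x0)))).
  by ring.
- rewrite -[X in _ --> X]oppr0 -[X in - X](mulr0 0); apply: cvgN; apply: cvgM; last exact: psum_cvg0.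
  have := cvg_exprn_expR 0 s0; by under eq_fun do rewrite expr0 mul1r.
- by rewrite mulr0 oppr0 expR0 psum0 mul1r sub0r opprK.
Qed.

(** The diagonal of D + e_i e_i^*. *)
Definition bump (i k : 'I_n) : R := d k + (k == i)%:R.

(** A monomial of degree [j] survives the deletion of exactly those variables that it does not
    contain. On generating polynomials this is the operator sending p to (number of variables) p - X
    p'. *)
Lemma prod_del_sum (P : pred 'I_n) j :
  \sum_(i | P i) (\prod_(k | P k && (k != i)) (1 + d k *: 'X))`_j =
  (#|[pred i | P i]|%:R - j%:R) * (\prod_(k | P k) (1 + d k *: 'X))`_j :> R.
Proof.
pose p : {poly R} := \prod_(k | P k) (1 + d k *: 'X).
pose q i : {poly R} := \prod_(k | P k && (k != i)) (1 + d k *: 'X).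
have pq i : P i -> p = q i + 'X * (d i *: q i).
  by move=> Pi; rewrite /p (bigD1 i)//= mulrDl mul1r -scalerAl -scalerAr.
have dp : p^`() = \sum_(i | P i) d i *: q i.
  rewrite /p deriv_prod; apply: eq_bigr => i _.
  by rewrite derivD derivZ derivX derivC add0r -mul_polyC mulr1 mul_polyC.
have : \sum_(i | P i) q i = p *+ #|[pred i | P i]| - 'X * p^`().
  rewrite dp mulr_sumr -sumr_const -sumrB /=; apply: eq_bigr => i Pi.
  by rewrite {1}(pq i Pi) addrK.
move=> /(congr1 (fun u : {poly R} => u`_j)); rewrite coef_sum => ->.
rewrite coefB coefMn coefXM coef_deriv.
case: j => [|j] /=; first by rewrite !subr0 mulr_natl.
by rewrite mulrBl !mulr_natl.
Qed.

Lemma epoly'_bump_ne (i k : 'I_n) : i != k ->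
  epoly' (bump i) k = epoly' d k + 'X * \prod_(j | (j != k) && (j != i)) (1 + d j *: 'X).
Proof.
move=> ik; rewrite /epoly' (bigD1 i)//= [in RHS](bigD1 i)//= /bump eqxx.
rewrite (eq_bigr (fun j => 1 + d j *: 'X)); last first.
  by move=> j /andP[_ ji]; rewrite (negbTE ji) addr0.
by rewrite scalerDl scale1r addrA mulrDl.
Qed.

Lemma epoly'_bump_eq (i : 'I_n) : epoly' (bump i) i = epoly' d i.
Proof.
by apply: eq_bigr => j ji; rewrite /bump (negbTE ji) addr0.
Qed.

(** The sum over i of the integrands of [det_ratio] for the weights [bump i], without the factor
    e^(-sr). *)
Definition flux_sum (r : R) : R := \sum_i (r ^+ m *
  ((\sum_k bump i k * (epoly' (bump i) k)`_m / (1 + r * d k)) * cprod d r)).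

Lemma bump_sum (r : R) : 0 <= r ->
  \sum_i \sum_k bump i k * (epoly' (bump i) k)`_m / (1 + r * d k) =
  n%:R * (\sum_k d k * (epoly' d k)`_m / (1 + r * d k)) +
  (epoly d)`_m * (\sum_k (1 + r * d k)^-1) +
  (n - m.+1)%:R * \sum_k d k * ('X * epoly' d k)`_m / (1 + r * d k).
Proof.
move=> r0; rewrite exchange_big /=.
have key k : \sum_i bump i k * (epoly' (bump i) k)`_m =
   n%:R * (d k * (epoly' d k)`_m) + (epoly d)`_m + (n - m.+1)%:R * (d k * ('X * epoly' d k)`_m).
  rewrite (bigD1 k)//= epoly'_bump_eq /bump eqxx.
  rewrite (eq_bigr (fun i => d k * (epoly' d k)`_m + d k *
      ('X * \prod_(j | (j != k) && (j != i)) (1 + d j *: 'X))`_m)); last first.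
    move=> i ik; rewrite epoly'_bump_ne// coefD eq_sym (negbTE ik) addr0; ring.
  rewrite big_split /= sumr_const -mulr_sumr.
  have cardk : #|[pred i | i != k]| = n.-1.
    by have := cardC1 k; rewrite card_ord.
  (* Each monomial of degree m - 1 in the n - 1 variables other than d_k survives (n - 1) - (m - 1)
     deletions; the factor ['X] makes the coefficient 0 when m = 0. One of these n - m copies is
     absorbed below into [(epoly d)_m], which leaves n - m - 1. *)
  have -> : \sum_(i | i != k) ('X * \prod_(j | (j != k) && (j != i)) (1 + d j *: 'X))`_m =
      (n - m)%:R * ('X * epoly' d k)`_m.
    under eq_bigr do rewrite coefXM.
    rewrite coefXM; case: m mn => [|m'] mn' /=; first by rewrite big1// mulr0.
    rewrite prod_del_sum cardk /epoly'; congr (_ * _).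
    by rewrite -natrB; [congr (_%:R); lia|lia].
  have -> : (epoly d)`_m = (epoly' d k)`_m + d k * ('X * epoly' d k)`_m.
    case: m => [|m']; first by rewrite epoly_coef0 epoly'_coef0 coefXM mulr0 addr0.
    by rewrite (epoly_coef_step d k) coefXM.
  rewrite cardk.
  have -> : (n - m)%:R = (n - m.+1)%:R + 1 :> R by rewrite natr1; congr (_%:R); lia.
  have -> : n%:R = n.-1%:R + 1 :> R by rewrite natr1; congr (_%:R); lia.
  by rewrite -mulr_natl; ring.
rewrite !mulr_sumr -!big_split /=; apply: eq_bigr => k _.
by rewrite -mulr_suml key; ring.
Qed.

Lemma integral_flux_sum :
  (\int[leb]_(r in `[0%R, +oo[) (flux_sum r)%:E =
   (n%:R + (n - m.+1)%:R * pf_value d mn)%:E)%E.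
Proof.
pose c : R := (n - m.+1)%:R.
(* A primitive of [flux_sum], matched to [bump_sum]: the first term yields the part with factor n,
   [r * psum d m] the last sum, and [r * pterm d m] the sum of the 1/(1 + r d_k). The leftover
   multiples of [psum d m] and [pterm d m] cancel against the derivative of [c * Lam r] because c =
   n - m - 1. Only the [Lam] term survives at infinity, only the first one at 0. *)
pose G (r : R) := - (n%:R * psum d m.+1 r) + (- (c * (r * psum d m r)) + r * pterm d m r + c * Lam r).
have G0 : G 0 = - n%:R.
  by rewrite /G psum0 Lam0 mulr1 !mul0r !mulr0 oppr0 !addr0.
apply: (etrans (@ray_integral R flux_sum G (c * pf_value d mn) _ _ _ _)).
- move=> r r0; apply: sumr_ge0 => i _; rewrite !mulr_ge0 ?exprn_ge0 ?(ltW (cprod_gt0 _ _))//.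
  apply: sumr_ge0 => k _; rewrite divr_ge0 ?(ltW (den_gt0 _ _ _))//.
  have b0 j : 0 <= bump i j by rewrite addr_ge0// ler0n.
  by rewrite mulr_ge0//; exact: epoly_coef_ge0.
- move=> r r0.
  have := @derive_sumR R _ (index_enum 'I_n) _ _ r (fun i =>
    derive_mulR (derive_exprR m r) (derive_mulR (@derive_sumR R _ (index_enum 'I_n) _ _ r
      (fun j => derive_mulcR (bump i j * (epoly' (bump i) j)`_m) (derive_den_inv d_gt0 j r0)))
      (derive_cprod d_gt0 r0))) => h.
  exact: ex_derive.
- move=> r r0.
  (* [derive_psum] covers positive lengths; for m = 0 the sum is empty, and ['X] makes the matching
     coefficient vanish too. *)
  have dpm : exists2 D, is_derive r 1 (psum d m) D &
      psum d m r + r * D = psum d m r -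
        r ^+ m * ((\sum_k d k * ('X * epoly' d k)`_m / (1 + r * d k)) * cprod d r).
    case: m => [|m'].
      exists 0.
        rewrite (_ : psum d 0 = fun=> 0); first exact: derive_cstR.
        by apply/funext => x; rewrite /psum big_ord0.
      by rewrite mulr0 big1 ?mul0r ?mulr0 ?oppr0// => k _; rewrite coefXM /= mulr0 mul0r.
    exists (- pflux d m' r); first exact: derive_psum.
    rewrite /pflux exprS mulrN !mulrA; congr (_ - _ * _ * _).
    by apply: eq_bigr => k _; rewrite coefXM.
  have [D dD DE] := dpm.
  apply: (is_derive_eq (derive_addR
    (derive_oppR (derive_mulcR n%:R (derive_psum d_gt0 m r0)))
    (derive_addR (derive_addR (derive_oppR (derive_mulcR c (derive_mulR (derive_idR r) dD)))
      (derive_mulR (derive_idR r) (derive_pterm d_gt0 m r0)))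
      (derive_mulcR c (derive_Lam r0))))).
  have -> : flux_sum r =
      r ^+ m * (\sum_i \sum_k bump i k * (epoly' (bump i) k)`_m / (1 + r * d k)) * cprod d r.
    by rewrite /flux_sum mulr_sumr mulr_suml; apply: eq_bigr => i _; rewrite mulrA.
  rewrite bump_sum// !mul1r.
  have -> : psum d m.+1 r = psum d m r + pterm d m r by rewrite /psum big_ord_recr.
  have ps : r * (m%:R * r ^+ m.-1) = m%:R * r ^+ m.
    by case: m => [|m'] /=; rewrite ?mul0r ?mulr0// mulrCA -exprS.
  have sc : r * (\sum_j d j / (1 + r * d j)) = n%:R - \sum_k (1 + r * d k)^-1.
    rewrite -[n in n%:R](card_ord n) -sumr_const -sumrB mulr_sumr; apply: eq_bigr => k _.
    by have := den_gt0 d_gt0 k r0 => h; field; rewrite gt_eqF.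
  rewrite -/c.
  have cE : c = n%:R - m%:R - 1.
    by rewrite /c -addn1 natrB ?addn1 1?ltnW// -natr1; ring.
  rewrite DE /pflux /pterm.
  set T := \sum_j d j / _ in sc *; set V := \sum_k _^-1 in sc *.
  set e := (epoly d)`_m; set p := cprod d r; set A := \sum_j d j * (epoly' d j)`_m / _.
  set B := \sum_k d k * ('X * _)`_m / _; set Q := psum d m r.
  have -> : r * (e * p * (m%:R * r ^+ m.-1 - r ^+ m * T)) =
     e * p * (r * (m%:R * r ^+ m.-1) - r ^+ m * (r * T)) by ring.
  by rewrite ps sc cE; ring.
- rewrite /G -[X in _ --> X]add0r; apply: cvgD.
    rewrite -[X in _ --> X]oppr0 -[X in - X](mulr0 n%:R); apply: cvgN; apply: cvgM; first exact: cvg_cst.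
    exact: psum_cvg0.
  rewrite -[X in _ --> X]add0r; apply: cvgD; last by apply: cvgM; [exact: cvg_cst|exact: cvg_Lam].
  rewrite -[X in _ --> X]addr0; apply: cvgD.
    rewrite -[X in _ --> X]oppr0 -[X in - X](mulr0 c); apply: cvgN; apply: cvgM; first exact: cvg_cst.
    have := @psum_cvg R n d d_gt0 1 m; under eq_fun do rewrite expr1.
    by apply; rewrite add1n ltnW.
  have := @pterm_cvg R n d d_gt0 1 m; under eq_fun do rewrite expr1.
  by apply; rewrite add1n.
- by rewrite G0 opprK addrC.
Qed.

End closed_forms.

(** * Inverse moments of Gaussian Gram matrices *)

Section monotone_limits.
Context d (T : measurableType d) (R : realType) (mu : {measure set T -> \bar R}).

Lemma cvg_monotone_integral (D : set T) (g : nat -> T -> \bar R) (f : T -> \bar R) :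
  measurable D -> (forall k, measurable_fun D (g k)) ->
  (forall k x, D x -> (0 <= g k x)%E) ->
  (forall x, D x -> {homo (g^~ x) : i j / (i <= j)%N >-> (i <= j)%E}) ->
  (forall x, D x -> g k x @[k --> \oo] --> f x) ->
  (\int[mu]_(x in D) g k x)%E @[k --> \oo] --> (\int[mu]_(x in D) f x)%E.
Proof.
move=> mD mg g0 ndg gf.
rewrite (eq_integral (fun x => limn (g^~ x))); last first.
  by move=> x /set_mem Dx; apply/esym/cvg_lim => //; exact: gf.
exact: cvg_monotone_convergence.
Qed.

Lemma harmonic_anti : {homo (@harmonic R) : i j / (i <= j)%N >-> j <= i}.
Proof. by move=> i j ij; rewrite /harmonic lef_pV2 ?posrE// ler_nat ltnS. Qed.

End monotone_limits.

Section ray_limits.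
Variable R : realType.
Local Notation leb := (@lebesgue_measure R).
Local Notation ray := (`[0%R, +oo[%classic : set R).

Lemma measurable_exp_decay (s : R) (f : R -> R) : measurable_fun ray f ->
  measurable_fun ray (fun r => (expR (- (s * r)) * f r)%:E).
Proof.
move=> mf; apply/measurable_EFinP; apply: measurable_funM => //.
apply: measurable_funTS; apply: measurableT_comp => //.
by apply: measurableT_comp => //; apply: measurable_funM.
Qed.

(** The factor e^(-r/(k+1)) increases to 1. *)
Lemma cvg_ray_exp (f : R -> R) : (forall r, 0 <= r -> 0 <= f r) -> measurable_fun ray f ->
  (\int[leb]_(r in ray) (expR (- (harmonic k * r)) * f r)%:E)%E @[k --> \oo] -->
  (\int[leb]_(r in ray) (f r)%:E)%E.
Proof.
move=> f0 mf; apply: cvg_monotone_integral => //.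
- by move=> k; exact: measurable_exp_decay.
- move=> k x /=; rewrite in_itv/= andbT => x0.
  by rewrite lee_fin mulr_ge0 ?expR_ge0// f0.
- move=> x /=; rewrite in_itv/= andbT => x0 i j ij.
  rewrite lee_fin ler_wpM2r ?f0// ler_expR lerN2 ler_wpM2r//.
  exact: harmonic_anti.
- move=> x _; apply: cvg_EFin; first by near=> k.
  rewrite /= (_ : _ \o _ = fun k => expR (- (harmonic k * x)) * f x); last by [].
  rewrite -[X in _ --> X]mul1r; apply: cvgM; last exact: cvg_cst.
  rewrite -(expR0 R); apply: continuous_cvg; first exact: continuous_expR.
  rewrite -[X in _ --> X]oppr0 -[X in - X](mul0r x); apply: cvgN.
  by apply: cvgM; [exact: cvg_harmonic|exact: cvg_cst].
Unshelve. all: by end_near. Qed.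

Lemma le_ray_exp (s : R) (f : R -> R) : 0 < s -> (forall r, 0 <= r -> 0 <= f r) ->
  measurable_fun ray f ->
  (\int[leb]_(r in ray) (expR (- (s * r)) * f r)%:E <= \int[leb]_(r in ray) (f r)%:E)%E.
Proof.
move=> s0 f0 mf; apply: ge0_le_integral => //.
- move=> x /=; rewrite in_itv/= andbT => x0.
  by rewrite lee_fin mulr_ge0 ?expR_ge0// f0.
- exact: measurable_exp_decay.
- exact/measurable_EFinP.
- move=> x /=; rewrite in_itv/= andbT => x0.
  by rewrite lee_fin ler_piMl ?f0// -expR0 ler_expR oppr_le0 mulr_ge0// ltW.
Qed.

Lemma measurable_ray (f : R -> R) : (forall r, 0 <= r -> derivable f r 1) ->
  measurable_fun ray f.
Proof.
move=> df; apply: subspace_continuous_measurable_fun => //.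
apply: (@derivable_within_continuous _ _ f `[0%R, +oo[%R) => x.
by rewrite in_itv/= andbT => /df.
Qed.

End ray_limits.

(** * Almost sure invertibility of the Gram matrix *)

Section almost_sure.
Variables (R : realType) (n m : nat) (d : 'I_n -> R).
Local Notation C := R[i].
Local Notation leb := (@lebesgue_measure R).
Local Notation ray := (`[0%R, +oo[%classic : set R).
Hypothesis d_gt0 : forall i, 0 < d i.

Let d_ge0 i : 0 <= d i. Proof. exact: ltW. Qed.

Lemma integral_pflux : (m < n)%N -> (\int[leb]_(r in ray) (pflux d m r)%:E = 1)%E.
Proof.
move=> mn.
apply: (etrans (@ray_integral R (pflux d m) (fun r => - psum d m.+1 r) 0 _ _ _ _)).
- exact: pflux_ge0.
- exact: derivable_pflux.
- move=> x x0; apply: (is_derive_eq (derive_oppR (derive_psum d_gt0 m x0))).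
  by rewrite opprK.
- rewrite -[X in _ --> X]oppr0; apply: cvgN.
  have := @psum_cvg R n d d_gt0 0 m.+1; under eq_fun do rewrite expr0 mul1r.
  by apply.
- by rewrite psum0 sub0r opprK.
Qed.

Definition gpos : set 'M[C]_(n, m.+1) := [set X | 0 < gdet d X].

Lemma measurable_gpos : measurable gpos.
Proof.
have -> : gpos = (fun X => gdet d X) @^-1` `]0%R, +oo[%classic.
  by apply/seteqP; split => X /=; rewrite in_itv/= andbT.
rewrite -[X in measurable X]setTI.
by apply: measurable_gdet => //.
Qed.

Lemma gdet_le_sdet s (X : 'M[C]_(n, m.+1)) : 0 <= s -> gdet d X <= sdet d s X.
Proof.
move=> s0; have [U [w [_ w0 _ dw]]] := sdet_spectral X d_ge0.
have z0 : (0 : R)%:C%:M = 0 :> 'M[C]_m.+1.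
  by apply/matrixP => i j; rewrite !mxE mul0rn.
have := dw 0; rewrite z0 add0r => dW.
rewrite /gdet dW /sdet dw /=.
by apply: ler_prod => i _; rewrite add0r w0 lerDr.
Qed.

Lemma pfluxE s r : (r ^+ m * expR (- (s * r)) *
     ((\sum_k d k * (epoly' d k)`_m / (1 + r * d k)) * \prod_k (1 + r * d k)^-1)) =
   expR (- (s * r)) * pflux d m r.
Proof. by rewrite /pflux /cprod; ring. Qed.

(** The ratio det W / det(s + W) is at most the indicator of [gpos], while its mean tends to the
    integral of [pflux], which is 1. Only [m < n] is assumed, so square matrices are included. *)
Lemma cgauss_gpos : (m < n)%N -> cgauss R n m.+1 gpos = 1%E.
Proof.
move=> mn; apply/eqP; rewrite eq_le probability_le1 /=; last exact: measurable_gpos.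
have mpf : measurable_fun ray (pflux d m).
  by apply: measurable_ray => r r0; exact: derivable_pflux.
have := cvg_ray_exp (@pflux_ge0 R n d d_gt0 m) mpf.
rewrite integral_pflux// => /cvge_to_le; apply; near=> k.
have s0 : 0 < harmonic k :> R by exact: harmonic_gt0.
have := det_ratio m d_ge0 d_ge0 s0.
under [X in _ = X -> _]eq_integral do rewrite pfluxE.
move=> <-.
suff h : (\int[cgauss R n m.+1]_X (gdet d X / sdet d (harmonic k) X)%:E <=
    \int[cgauss R n m.+1]_(x in gpos) cst 1 x)%E.
  by apply: (le_trans h); rewrite integral_cst ?mul1e//; exact: measurable_gpos.
rewrite [leRHS]integral_mkcond.
apply: ge0_le_integral => //.
- by move=> X _; rewrite lee_fin divr_ge0 ?gdet_ge0// ltW// sdet_gt0.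
- apply/measurable_EFinP; apply: measurable_funM; first exact: measurable_gdet.
  by apply: measurable_invr; exact: measurable_sdet.
- apply/(measurable_restrictT _ measurable_gpos); exact: measurable_cst.
- move=> X _; rewrite patchE; case: ifPn => [_|].
    by rewrite lee_fin ler_pdivrMr ?sdet_gt0// mul1r gdet_le_sdet// ltW.
  rewrite notin_setE /gpos/= => /negP; rewrite -leNgt => g0.
  by rewrite lee_fin ler_pdivrMr ?sdet_gt0// mul0r.
Unshelve. all: by end_near. Qed.

Lemma ge0_integral_gpos (F : 'M[C]_(n, m.+1) -> \bar R) : (m < n)%N ->
  measurable_fun setT F -> (forall X, 0 <= F X)%E ->
  (\int[cgauss R n m.+1]_X F X = \int[cgauss R n m.+1]_(X in gpos) F X)%E.
Proof.
move=> mn mF F0.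
rewrite (@ge0_negligible_integral _ _ _ _ setT (~` gpos))//.
- by rewrite setDE setCK setTI.
- by apply: measurableC; exact: measurable_gpos.
- apply: (etrans (probability_setC (cgauss R n m.+1) measurable_gpos)).
  by rewrite cgauss_gpos// subee.
Qed.

End almost_sure.

(** * Traces involving the inverse of a Gram matrix *)

Section inverse_trace.
Local Open Scope sesquilinear_scope.
Variable R : realType.
Local Notation C := R[i].

Lemma mulmx1_invmx n (A B : 'M[C]_n) : A *m B = 1%:M -> invmx A = B.
Proof.
move=> AB; have [uA _] := mulmx1_unit AB.
by rewrite -[LHS]mulmx1 -AB mulKmx.
Qed.

(* The second case is the junk value [invmx A = A] at a singular [A]. *)
Lemma invmx_spectral n (U : 'M[C]_n) (w : 'I_n -> R) : U \is unitarymx ->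
  (forall i, 0 <= w i) ->
  exists w', [/\ forall i, 0 <= w' i, invmx (U^t* *m Dmx w *m U) = U^t* *m Dmx w' *m U &
    (forall i, w i != 0) -> w' = fun i => (w i)^-1].
Proof.
move=> Uu w0; have UU := unitarymx_tC Uu; have /unitarymxP UU' := Uu.
have [nz|/forallPn[i /negPn/eqP wi0]] := boolP [forall i, w i != 0].
  exists (fun i => (w i)^-1); split => //; first by move=> i; rewrite invr_ge0.
  apply: mulmx1_invmx.
  rewrite -!mulmxA (mulmxA U) UU' mul1mx (mulmxA (Dmx w)) Dmx_mul.
  rewrite (_ : Dmx _ = 1%:M) ?mul1mx//.
  apply/matrixP => i j; rewrite Dmx_entry mulfV ?(forallP nz)// mxE.
  by case: eqP.
exists w; split => //; last by move=> /(_ i); rewrite wi0 eqxx.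
rewrite /invmx unitmxE det_unitary_conj// det_Dmx (bigD1 i)//= wi0 mul0r.
by rewrite unitr0.
Qed.

Variables (n m : nat) (d : 'I_n -> R).
Hypothesis d_ge0 : forall i, 0 <= d i.

(** One diagonalization serves the Gram matrix, its [invmx] and all shifts by [s]; [w'] is the
    inverse spectrum when [gdet d X] is positive and merely nonnegative otherwise. *)
Lemma gram_inv_spectral (X : 'M[C]_(n, m)) : exists (U : 'M[C]_m) (w w' : 'I_m -> R),
  [/\ U \is unitarymx, forall i, 0 <= w i, forall i, 0 <= w' i,
   invmx (X^t* *m Dmx d *m X) = U^t* *m Dmx w' *m U &
   [/\ forall s, sdet d s X = \prod_i (s + w i), gdet d X = \prod_i w i &
     0 < gdet d X -> (forall i, 0 < w i) /\ w' = fun i => (w i)^-1]].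
Proof.
have [U [w [Uu w0 WE dw]]] := sdet_spectral X d_ge0.
have [w' [w'0 iE w'E]] := invmx_spectral Uu w0.
have gE : gdet d X = \prod_i w i.
  by rewrite /gdet WE det_unitary_conj// det_Dmx.
exists U, w, w'; split; [exact: Uu|exact: w0|exact: w'0|by rewrite WE|].
split => [s||]; [by rewrite /sdet dw|by []|].
rewrite gE => /lt0r_neq0 /prodf_neq0 nz.
have wn i : w i != 0 by exact: nz.
by split=> [i|]; [rewrite lt0r wn w0|exact: w'E].
Qed.

Definition tinv (X : 'M[C]_(n, m)) : R := complex.Re (trace_inv d X).

Lemma trace_unitary_conj (A U : 'M[C]_m) : U \is unitarymx -> \tr (U^t* *m A *m U) = \tr A.
Proof. by move=> /unitarymxP UU; rewrite mxtrace_mulC mulmxA UU mul1mx. Qed.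

Lemma trace_Dmx (w : 'I_m -> R) : \tr (Dmx w) = (\sum_i w i)%:C.
Proof.
rewrite rmorph_sum /=; apply: eq_bigr => i _.
by rewrite Dmx_entry eqxx mulr1n.
Qed.

Lemma trace_inv_nonneg (X : 'M[C]_(n, m)) : exists2 t : R, 0 <= t & trace_inv d X = t%:C.
Proof.
have [U [w [w' [Uu _ w'0 iE _]]]] := gram_inv_spectral X.
exists (\sum_i w' i); first exact: sumr_ge0.
by rewrite /trace_inv iE trace_unitary_conj// trace_Dmx.
Qed.

Lemma trace_invE (X : 'M[C]_(n, m)) : trace_inv d X = (tinv X)%:C.
Proof. by rewrite /tinv; have [t _ ->] := trace_inv_nonneg X. Qed.

Lemma tinv_ge0 (X : 'M[C]_(n, m)) : 0 <= tinv X.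
Proof. by rewrite /tinv; have [t t0 ->] := trace_inv_nonneg X. Qed.

(** With T the sum of the x_i, it comes from prod (1 + s x_i) >= 1 + s T and prod (1 + s x_i)^-1 >=
    1 - s T. As s decreases to 0 the left bound increases to T, which is what monotone convergence
    needs in [integral_tinv]. *)
Lemma prod_inv_bounds (x : 'I_m -> R) (s : R) : 0 < s -> (forall i, 0 <= x i) ->
  (\sum_i x i) / (1 + s * \sum_i x i) <= (1 - \prod_i (1 + s * x i)^-1) / s <= \sum_i x i.
Proof.
move=> s0 x0.
have T0 : 0 <= \sum_i x i by exact: sumr_ge0.
have gen (r : seq 'I_m) :
    [/\ 1 + s * \sum_(i <- r) x i <= \prod_(i <- r) (1 + s * x i),
      \prod_(i <- r) (1 + s * x i)^-1 <= 1 &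
      1 - s * \sum_(i <- r) x i <= \prod_(i <- r) (1 + s * x i)^-1].
  elim: r => [|i r [h1 h2 h3]]; first by rewrite !big_nil; split; lra.
  rewrite !big_cons; have sx : 0 <= s * x i by rewrite mulr_ge0// ltW.
  have y0 : 0 < 1 + s * x i by rewrite ltr_pwDl.
  have S0 : 0 <= \sum_(j <- r) x j by exact: sumr_ge0.
  have p0 : 0 <= \prod_(j <- r) (1 + s * x j)^-1.
    by apply: prodr_ge0 => j _; rewrite invr_ge0 addr_ge0// mulr_ge0// ltW.
  have y1 : (1 + s * x i)^-1 <= 1 by rewrite invf_le1// lerDl.
  split.
  - have := ler_wpM2l (ltW y0) h1; apply: le_trans.
    have : 0 <= (s * x i) * (s * \sum_(j <- r) x j).
      by rewrite mulr_ge0// mulr_ge0// ltW.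
    by nra.
  - by rewrite mulr_ile1// invr_ge0 ltW.
  - have y2 : 1 - s * x i <= (1 + s * x i)^-1.
      by rewrite -[leRHS]mul1r ler_pdivlMr//; nra.
    have := ler_wpM2r p0 y2 => h4; apply: (le_trans _ h4).
    have : s * x i * \prod_(j <- r) (1 + s * x j)^-1 <= s * x i * 1 by rewrite ler_wpM2l.
    by nra.
have [h1 _ h3] := gen (index_enum _).
have sT0 : 0 < 1 + s * \sum_i x i by rewrite ltr_pwDl// mulr_ge0// ltW.
apply/andP; split.
  rewrite ler_pdivlMr// prodfV.
  have : (\prod_i (1 + s * x i))^-1 <= (1 + s * \sum_i x i)^-1.
    by rewrite lef_pV2 ?posrE//; exact: lt_le_trans h1.
  suff : (\sum_i x i) / (1 + s * \sum_i x i) * s = 1 - (1 + s * \sum_i x i)^-1.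
    by move=> ->; lra.
  by field; rewrite gt_eqF.
by rewrite ler_pdivrMr//; lra.
Qed.

Lemma tinv_bounds (X : 'M[C]_(n, m)) (s : R) : 0 < s -> 0 < gdet d X ->
  tinv X / (1 + s * tinv X) <= (1 - gdet d X / sdet d s X) / s <= tinv X.
Proof.
move=> s0 g0; have [U [w [w' [Uu w0 w'0 iE [sE gE]]]]] := gram_inv_spectral X.
move=> /(_ g0)[wp w'E].
have -> : tinv X = \sum_i w' i.
  by rewrite /tinv /trace_inv iE trace_unitary_conj// trace_Dmx.
have -> : gdet d X / sdet d s X = \prod_i (1 + s * w' i)^-1.
  rewrite gE sE -prodf_div; apply: eq_bigr => i _; rewrite w'E.
  have := wp i => wi; field.
  by rewrite !gt_eqF// ?addr_gt0.
exact: prod_inv_bounds.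
Qed.

Definition tgram (X : 'M[C]_(n, m)) : R :=
  complex.Re (\tr (X^t* *m X *m invmx (X^t* *m Dmx d *m X))).

Lemma tgram_nonneg (X : 'M[C]_(n, m)) : exists2 t : R, 0 <= t &
  \tr (X^t* *m X *m invmx (X^t* *m Dmx d *m X)) = t%:C.
Proof.
have [U [w [w' [Uu _ w'0 iE _]]]] := gram_inv_spectral X.
pose Y := X *m U^t*.
exists (\sum_i w' i * \sum_k nsq (Y k i)).
  by apply: sumr_ge0 => i _; rewrite mulr_ge0// sumr_ge0// => k _; exact: nsq_ge0.
have -> : \tr (X^t* *m X *m invmx (X^t* *m Dmx d *m X)) = \tr (Dmx w' *m (Y^t* *m Y)).
  rewrite iE; transitivity (\tr ((X^t* *m X *m (U^t*) *m Dmx w') *m U)).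
    by rewrite !mulmxA.
  rewrite mxtrace_mulC; transitivity (\tr ((U *m X^t* *m X *m (U^t*)) *m Dmx w')).
    by rewrite !mulmxA.
  by rewrite mxtrace_mulC /Y adjM trmxCK !mulmxA.
rewrite rmorph_sum; apply: eq_bigr => i _.
by rewrite Dmx_lmul gram_diag -rmorphM.
Qed.

Lemma tgramE (X : 'M[C]_(n, m)) :
  \tr (X^t* *m X *m invmx (X^t* *m Dmx d *m X)) = (tgram X)%:C.
Proof. by rewrite /tgram; have [t _ ->] := tgram_nonneg X. Qed.

Lemma tgram_ge0 (X : 'M[C]_(n, m)) : 0 <= tgram X.
Proof. by rewrite /tgram; have [t t0 ->] := tgram_nonneg X. Qed.

Lemma bump_ge0 i k : 0 <= bump d i k.
Proof. by rewrite addr_ge0// ler0n. Qed.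

(** Bumping the i-th weight adds x^* x to W, with x the i-th row of X, so by [det_rank1] each ratio
    is 1 + x W^-1 x^* as a scalar. Summing over i gives n plus a trace, which is rotated
    cyclically. *)
Lemma gdet_bump (X : 'M[C]_(n, m)) : 0 < gdet d X ->
  \sum_i gdet (bump d i) X / gdet d X = n%:R + tgram X.
Proof.
move=> g0; pose W := X^t* *m Dmx d *m X.
have dW : \det W = (gdet d X)%:C by rewrite gdetE.
have uW : W \in unitmx by rewrite unitmxE dW unitfE fmorph_eq0 gt_eqF.
have step i : (gdet (bump d i) X / gdet d X)%:C = 1 + (X *m invmx W *m X^t*) i i.
  pose x := row i X.
  have WE : X^t* *m Dmx (bump d i) *m X = W *m (1%:M - (- (invmx W *m x^t*)) *m x).
    rewrite mulNmx opprK mulmxDr mulmx1 !mulmxA mulmxV// mul1mx.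
    have -> : Dmx (bump d i) = Dmx d + (delta_mx 0 i : 'rV_n)^t* *m (delta_mx 0 i : 'rV_n).
      apply/matrixP => a b; rewrite [RHS]mxE !Dmx_entry /bump [X in _ = _ + X]mxE big_ord1.
      rewrite !mxE eqxx /= rmorph_nat.
      have [->|ab] := eqVneq a b; last first.
        by rewrite !mulr0n add0r; case: eqP => [ai|]; rewrite ?mul0r// -ai eq_sym (negbTE ab) mulr0.
      by rewrite !mulr1n rmorphD /=; case: eqP => _; rewrite ?mulr1 ?mulr0.
    by rewrite mulmxDr mulmxDl /x rowE adjM !mulmxA.
  have -> : (gdet (bump d i) X / gdet d X)%:C =
      \det (X^t* *m Dmx (bump d i) *m X) / \det W.
    rewrite dW (gdetE X (bump_ge0 i)); exact: (fmorph_div (real_complex R)).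
  rewrite WE det_mulmx det_rank1 mulmxN mxE opprK mulrAC mulfV; last first.
    by rewrite dW fmorph_eq0 gt_eqF.
  rewrite mul1r mulmxA; congr (1 + _).
  rewrite !mxE; apply: eq_bigr => k _; rewrite !mxE; congr (_ * _).
  by apply: eq_bigr => l _; rewrite !mxE.
apply: (@complexI R); rewrite rmorph_sum /=.
rewrite (eq_bigr _ (fun i _ => step i)) big_split /= sumr_const card_ord.
by rewrite -[X in _ + X = _]/(\tr (X *m invmx W *m X^t*)) -mulmxA mxtrace_mulC
  -mulmxA mxtrace_mulC tgramE rmorphD /= rmorph_nat.
Qed.

End inverse_trace.

Lemma adde_cancel (R : realType) (x y z : \bar R) : x \is a fin_num ->
  (x + y = x + z)%E -> y = z.
Proof.
move=> fx h; rewrite -[y](addeK _ fx) -[z in RHS](addeK _ fx).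
by rewrite [(y + x)%E]addeC h [(z + x)%E]addeC.
Qed.

Lemma integral_prob_cst d (T : measurableType d) (R : realType) (P : probability T R) (c : R) :
  (\int[P]_x c%:E = c%:E)%E.
Proof.
apply: (etrans (integral_cst P measurableT c%:E)).
by rewrite [X in (_ * X)%E]probability_setT mule1.
Qed.

(** * Expectations of the two traces *)

Section expectations.
Variables (R : realType) (n m : nat) (d : 'I_n -> R).
Local Notation C := R[i].
Local Notation leb := (@lebesgue_measure R).
Local Notation ray := (`[0%R, +oo[%classic : set R).
Local Notation mu := (cgauss R n m.+1).
Hypotheses (mn : (m.+1 < n)%N) (d_gt0 : forall i, 0 < d i) (d_inj : injective d).

Let d_ge0 i : 0 <= d i. Proof. exact: ltW. Qed.
Let mn' : (m < n)%N. Proof. exact: ltnW. Qed.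

Lemma measurable_tinv k (a : 'I_k -> R) p : measurable_fun setT (@tinv R k p a).
Proof.
apply: measurable_cRe; apply: measurable_trace; apply: measurable_invmx.
by apply: measurable_mxM => //; apply: measurable_mxM => //; exact: measurable_mxtC.
Qed.

Lemma measurable_tgram k (a : 'I_k -> R) p : measurable_fun setT (@tgram R k p a).
Proof.
apply: measurable_cRe; apply: measurable_trace; apply: measurable_mxM.
  by apply: measurable_mxM => //; exact: measurable_mxtC.
apply: measurable_invmx.
by apply: measurable_mxM => //; apply: measurable_mxM => //; exact: measurable_mxtC.
Qed.

Let ratio s (X : 'M[C]_(n, m.+1)) : R := gdet d X / sdet d s X.

Let measurable_ratio s : measurable_fun setT (ratio s).
Proof.
apply: measurable_funM; first exact: measurable_gdet.
by apply: measurable_invr; exact: measurable_sdet.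
Qed.

Let ratio_ge0 s X : 0 < s -> 0 <= ratio s X.
Proof. by move=> s0; rewrite divr_ge0 ?gdet_ge0// ltW// sdet_gt0. Qed.

Let ratio_le1 s X : 0 < s -> ratio s X <= 1.
Proof.
by move=> s0; rewrite ler_pdivrMr ?sdet_gt0// mul1r gdet_le_sdet// ltW.
Qed.

Let decay s : \bar R := (\int[leb]_(r in ray) (expR (- (s * r)) * psum d m.+1 r)%:E)%E.

(** [det_ratio] and [integral_pflux_exp] give E[ratio] + s decay = 1, while E[ratio] + E[1 - ratio]
    = 1; the finite E[ratio] is cancelled. *)
Lemma integral_defect s : 0 < s ->
  (\int[mu]_X ((1 - ratio s X) / s)%:E = decay s)%E.
Proof.
move=> s0.
have h1 : (\int[mu]_X (ratio s X)%:E + s%:E * decay s = 1)%E.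
  rewrite -(integral_pflux_exp mn d_gt0 s0); congr (_ + _)%E.
  rewrite /ratio det_ratio//; apply: eq_integral => r _.
  by rewrite pfluxE.
have h2 : (\int[mu]_X (ratio s X)%:E + \int[mu]_X (1 - ratio s X)%:E = 1)%E.
  rewrite -ge0_integralD//.
  - rewrite -[RHS](integral_prob_cst mu 1); apply: eq_integral => X _.
    by rewrite -EFinD addrC subrK.
  - by move=> X _; rewrite lee_fin ratio_ge0.
  - by apply/measurable_EFinP; exact: measurable_ratio.
  - by move=> X _; rewrite lee_fin subr_ge0 ratio_le1.
  - by apply/measurable_EFinP; apply: measurable_funB => //; exact: measurable_ratio.
have fin : (\int[mu]_X (ratio s X)%:E)%E \is a fin_num.
  rewrite ge0_fin_numE; last first.
    by apply: integral_ge0 => X _; rewrite lee_fin ratio_ge0.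
  apply: (@le_lt_trans _ _ 1%E); last by rewrite ltry.
  rewrite -h2 leeDl//; apply: integral_ge0 => X _.
  by rewrite lee_fin subr_ge0 ratio_le1.
have h3 : (\int[mu]_X (1 - ratio s X)%:E = s%:E * decay s)%E.
  by apply: (adde_cancel fin); rewrite h1 h2.
transitivity (\int[mu]_X ((s^-1)%:E * (1 - ratio s X)%:E))%E.
  by apply: eq_integral => X _; rewrite -EFinM mulrC.
rewrite ge0_integralZl//; last first.
- by rewrite lee_fin invr_ge0 ltW.
- by move=> X _; rewrite lee_fin subr_ge0 ratio_le1.
- by apply/measurable_EFinP; apply: measurable_funB => //; exact: measurable_ratio.
by rewrite h3 muleA -EFinM mulVf ?mul1e// gt_eqF.
Qed.

Let measurable_psum : measurable_fun ray (psum d m.+1).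
Proof.
apply: measurable_ray => r r0.
by have := derive_psum d_gt0 m r0 => h; exact: ex_derive.
Qed.

Lemma integral_tinv : (\int[mu]_X (tinv d X)%:E = (pf_value d mn)%:E)%E.
Proof.
have mt := @measurable_tinv n d m.+1.
have mg : measurable (@gpos R n m d) := measurable_gpos d.
rewrite (@ge0_integral_gpos R n m d d_gt0)//; last 2 first.
- exact/measurable_EFinP.
- by move=> X; rewrite lee_fin tinv_ge0.
have h0 k : 0 < harmonic k :> R by exact: harmonic_gt0.
have dE k : decay (harmonic k) =
    (\int[mu]_(X in gpos d) ((1 - ratio (harmonic k) X) / harmonic k)%:E)%E.
  rewrite -integral_defect// (@ge0_integral_gpos R n m d d_gt0)//.
  - apply/measurable_EFinP; apply: measurable_funM => //.
    by apply: measurable_funB => //; exact: measurable_ratio.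
  - by move=> X; rewrite lee_fin divr_ge0 ?(ltW (h0 k))// subr_ge0 ratio_le1.
have mdef k : measurable_fun (gpos d) (fun X => ((1 - ratio (harmonic k) X) / harmonic k)%:E).
  apply: measurable_funTS; apply/measurable_EFinP; apply: measurable_funM => //.
  by apply: measurable_funB => //; exact: measurable_ratio.
have mtk k : measurable_fun (gpos d)
    (fun X : 'M[C]_(n, m.+1) => (tinv d X / (1 + harmonic k * tinv d X))%:E).
  apply: measurable_funTS; apply/measurable_EFinP; apply: measurable_funM; first exact: mt.
  by apply: measurable_invr; apply: measurable_funD => //; exact: measurable_funM.
have den k (X : 'M[C]_(n, m.+1)) : 0 < 1 + harmonic k * tinv d X.
  by rewrite ltr_pwDl// mulr_ge0 ?tinv_ge0// ltW.
(* Two inequalities from [tinv_bounds]. The integral of [psum] is a limit of means of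
   [(1 - ratio) / s], each at most the mean of [tinv]; conversely [tinv / (1 + s * tinv)] increases
   to [tinv], and its mean is at most the integral of [psum]. *)
apply/eqP; rewrite eq_le; apply/andP; split; last first.
  rewrite -integral_psum//.
  have := cvg_ray_exp (@psum_ge0 R n d d_gt0 m.+1) measurable_psum.
  move=> /cvge_to_le; apply; near=> k.
  rewrite -/(decay _) dE; apply: ge0_le_integral => //.
  - by move=> X _; rewrite lee_fin divr_ge0 ?(ltW (h0 k))// subr_ge0 ratio_le1.
  - by apply: measurable_funTS; exact/measurable_EFinP.
  - by move=> X g0; rewrite lee_fin; have /andP[] := tinv_bounds d_ge0 (h0 k) g0.
have : (\int[mu]_(X in gpos d) (tinv d X / (1 + harmonic k * tinv d X))%:E)%E @[k --> \oo] -->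
   (\int[mu]_(X in gpos d) (tinv d X)%:E)%E.
  apply: cvg_monotone_integral => //.
  - by move=> k X _; rewrite lee_fin divr_ge0 ?tinv_ge0// ltW.
  - move=> X _ i j ij; rewrite lee_fin ler_wpM2l ?tinv_ge0// lef_pV2 ?posrE//.
    by rewrite lerD2l ler_wpM2r ?tinv_ge0// harmonic_anti.
  - move=> X _; apply: cvg_EFin; first by near=> k.
    rewrite /= (_ : _ \o _ = fun k => tinv d X / (1 + harmonic k * tinv d X)); last by [].
    rewrite -[X in _ --> X]mulr1; apply: cvgM; first exact: cvg_cst.
    rewrite -[X in _ --> X]invr1; apply: cvgV; first exact: oner_neq0.
    rewrite -[X in _ --> X]addr0; apply: cvgD; first exact: cvg_cst.
    rewrite -[X in _ --> X](mul0r (tinv d X)); apply: cvgM; last exact: cvg_cst.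
    exact: cvg_harmonic.
move=> /cvge_to_le; apply; near=> k.
apply: (@le_trans _ _ (decay (harmonic k))).
  rewrite dE; apply: ge0_le_integral => //.
  - by move=> X _; rewrite lee_fin divr_ge0 ?tinv_ge0// ltW.
  - by move=> X g0; rewrite lee_fin; have /andP[] := tinv_bounds d_ge0 (h0 k) g0.
rewrite -integral_psum//; apply: le_ray_exp => //.
exact: psum_ge0.
Unshelve. all: by end_near. Qed.

Let rsum s (X : 'M[C]_(n, m.+1)) : R := \sum_i gdet (bump d i) X / sdet d s X.

Let rsum_ge0 s X : 0 < s -> 0 <= rsum s X.
Proof.
move=> s0; apply: sumr_ge0 => i _; rewrite divr_ge0 ?gdet_ge0 ?(ltW (sdet_gt0 _ d_ge0 s0))//.
exact: bump_ge0.
Qed.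

Let measurable_rsum s : measurable_fun setT (rsum s).
Proof.
apply: measurable_real_sum => i; apply: measurable_funM; first exact: measurable_gdet.
by apply: measurable_invr; exact: measurable_sdet.
Qed.

Let fterm i r : R := r ^+ m *
  ((\sum_k bump d i k * (epoly' (bump d i) k)`_m / (1 + r * d k)) * cprod d r).

Let fterm_ge0 i r : 0 <= r -> 0 <= fterm i r.
Proof.
move=> r0; rewrite !mulr_ge0 ?exprn_ge0 ?(ltW (cprod_gt0 _ _))//.
apply: sumr_ge0 => k _; rewrite divr_ge0 ?(ltW (den_gt0 _ _ _))//.
rewrite mulr_ge0 ?bump_ge0//; apply: epoly_coef_ge0; exact: bump_ge0.
Qed.

Let measurable_fterm i : measurable_fun ray (fterm i).
Proof.
apply: measurable_ray => r r0.
have h0 j := derive_mulcR (bump d i j * (epoly' (bump d i) j)`_m) (derive_den_inv d_gt0 j r0).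
have h := derive_mulR (derive_exprR m r) (derive_mulR (derive_sumR (index_enum 'I_n) h0)
  (derive_cprod d_gt0 r0)).
exact: ex_derive.
Qed.

Lemma integral_rsum s : 0 < s ->
  (\int[mu]_X (rsum s X)%:E = \int[leb]_(r in ray) (expR (- (s * r)) * flux_sum m d r)%:E)%E.
Proof.
move=> s0.
transitivity (\sum_i \int[mu]_X (gdet (bump d i) X / sdet d s X)%:E)%E.
  rewrite -ge0_integral_sum//.
  - by apply: eq_integral => X _; rewrite sumEFin.
  - move=> i; apply/measurable_EFinP; apply: measurable_funM; first exact: measurable_gdet.
    by apply: measurable_invr; exact: measurable_sdet.
  - move=> i X _; rewrite lee_fin divr_ge0 ?gdet_ge0 ?(ltW (sdet_gt0 _ d_ge0 s0))//.
    exact: bump_ge0.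
transitivity (\sum_i \int[leb]_(r in ray) (expR (- (s * r)) * fterm i r)%:E)%E.
  apply: eq_bigr => i _; rewrite det_ratio//; last exact: bump_ge0.
  by apply: eq_integral => r _; congr EFin; rewrite /fterm /cprod [_ ^+ m * expR _]mulrC -[in LHS]mulrA.
rewrite -ge0_integral_sum//.
- apply: eq_integral => r _; rewrite sumEFin; congr EFin.
  by rewrite -mulr_sumr.
- by move=> i; exact: measurable_exp_decay.
- move=> i r /=; rewrite in_itv/= andbT => r0.
  by rewrite lee_fin mulr_ge0 ?expR_ge0// fterm_ge0.
Qed.

Lemma cvg_sdet (X : 'M[C]_(n, m.+1)) : sdet d (harmonic k) X @[k --> \oo] --> gdet d X.
Proof.
have [U [w [w' [_ _ _ _ [sE gE _]]]]] := gram_inv_spectral d_ge0 X.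
rewrite gE (_ : (fun k => _) = fun k => \prod_i (harmonic k + w i)); last first.
  by apply/funext => k; rewrite sE.
have gen (r : seq 'I_m.+1) : (\prod_(i <- r) (harmonic k + w i)) @[k --> \oo] --> \prod_(i <- r) w i.
  elim: r => [|i r IH].
    rewrite big_nil (_ : (fun k => _) = cst 1); first exact: cvg_cst.
    by apply/funext => k; rewrite big_nil.
  rewrite big_cons (_ : (fun k => _) = fun k => (harmonic k + w i) * \prod_(i <- r) (harmonic k + w i)).
    apply: cvgM => //; rewrite -[X in _ --> X]add0r; apply: cvgD; last exact: cvg_cst.
    exact: cvg_harmonic.
  by apply/funext => k; rewrite big_cons.
exact: gen.
Qed.

Lemma sdet_homo s t (X : 'M[C]_(n, m.+1)) : 0 <= s -> s <= t -> sdet d s X <= sdet d t X.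
Proof.
move=> s0 st; have [U [w [w' [_ w0 _ _ [sE _ _]]]]] := gram_inv_spectral d_ge0 X.
rewrite !sE; apply: ler_prod => i _; rewrite addr_ge0//=.
by rewrite lerD2r.
Qed.

(** The mean of [rsum] has two limits as s tends to 0: the mean of n + [tgram], by monotone
    convergence and [gdet_bump], and the integral of [flux_sum]. The finite n is then cancelled. *)
Lemma integral_tgram :
  (\int[mu]_X (tgram d X)%:E = ((n - m.+1)%:R * pf_value d mn)%:E)%E.
Proof.
have mt := @measurable_tgram n d m.+1.
have mg : measurable (@gpos R n m d) := measurable_gpos d.
have h0 k : 0 < harmonic k :> R by exact: harmonic_gt0.
have c1 : (\int[mu]_(X in gpos d) (rsum (harmonic k) X)%:E)%E @[k --> \oo] -->
   (\int[mu]_(X in gpos d) (n%:R + tgram d X)%:E)%E.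
  apply: cvg_monotone_integral => //.
  - move=> k; apply: measurable_funTS; apply/measurable_EFinP; exact: measurable_rsum.
  - by move=> k X _; rewrite lee_fin rsum_ge0.
  - move=> X _ i j ij; rewrite lee_fin; apply: ler_sum => l _.
    rewrite ler_wpM2l ?gdet_ge0//; first exact: bump_ge0.
    rewrite lef_pV2 ?posrE ?sdet_gt0//; apply: sdet_homo; first exact: ltW.
    exact: harmonic_anti.
  - move=> X g0; apply: cvg_EFin; first by near=> k.
    rewrite -gdet_bump// (_ : _ \o _ = fun k => rsum (harmonic k) X); last by [].
    have -> : \sum_i gdet (bump d i) X / gdet d X = (\sum_i gdet (bump d i) X) / gdet d X.
      by rewrite mulr_suml.
    rewrite (_ : (fun k => _) = fun k => (\sum_i gdet (bump d i) X) / sdet d (harmonic k) X).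
      by apply: cvgM; [exact: cvg_cst|apply: cvgV; [rewrite gt_eqF|exact: cvg_sdet]].
    by apply/funext => k; rewrite /rsum mulr_suml.
have c2 : (\int[mu]_(X in gpos d) (rsum (harmonic k) X)%:E)%E @[k --> \oo] -->
   (n%:R + (n - m.+1)%:R * pf_value d mn)%:E%E.
  rewrite -integral_flux_sum//.
  rewrite (_ : (fun k => _) = fun k =>
     (\int[leb]_(r in ray) (expR (- (harmonic k * r)) * flux_sum m d r)%:E)%E).
    apply: cvg_ray_exp => [r r0|]; first by apply: sumr_ge0 => i _; exact: fterm_ge0.
    apply: measurable_sum => i; exact: measurable_fterm.
  apply/funext => k; rewrite -integral_rsum// (@ge0_integral_gpos R n m d d_gt0)//.
  - by apply/measurable_EFinP; exact: measurable_rsum.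
  - by move=> X; rewrite lee_fin rsum_ge0.
have E0 := etrans (esym (cvg_lim (@ereal_hausdorff R) c1)) (cvg_lim (@ereal_hausdorff R) c2).
have E : (\int[mu]_(X in gpos d) (n%:R + tgram d X)%:E =
    (n%:R + (n - m.+1)%:R * pf_value d mn)%:E)%E by exact: E0.
have n0 : (0 <= n%:R%:E :> \bar R)%E by rewrite lee_fin.
have : (\int[mu]_X (n%:R%:E + (tgram d X)%:E) = (n%:R + (n - m.+1)%:R * pf_value d mn)%:E)%E.
  apply: (etrans _ E); apply: (@ge0_integral_gpos R n m d d_gt0) => //.
  - by apply: emeasurable_funD => //; exact/measurable_EFinP.
  - by move=> X; rewrite adde_ge0// lee_fin tgram_ge0.
rewrite ge0_integralD//; last 2 first.
- by move=> X _; rewrite lee_fin tgram_ge0.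
- exact/measurable_EFinP.
rewrite integral_prob_cst.
by rewrite EFinD => /adde_cancel; apply.
Unshelve. all: by end_near. Qed.

End expectations.

(** * Reduction of the Haar integral to Gaussian matrices *)


Section frame.
Local Open Scope sesquilinear_scope.
Variables (R : realType) (n : nat).
Local Notation C := R[i].

(** The projection onto the first [i] coordinates, kept in full size so that all leading blocks live
    in one type. *)
Definition corner (i : nat) : 'M[C]_n := Dmx (fun k : 'I_n => (k < i)%:R).

(* The orthogonal projection onto the span of the first [i] rows of [G]. *)
Definition row_proj (i : nat) (G : 'M[C]_n) : 'M[C]_n :=
  G^t* *m corner i *m
  invmx (corner i *m (G *m G^t*) *m corner i + (1%:M - corner i)) *m corner i *m G.

(* If [G = T U] with [T] lower triangular and [U] unitary, this is
   [U^* Dmx d U], expressed as a measurable function of [G]. *)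
Definition frame_mx (d : 'I_n -> R) (G : 'M[C]_n) : 'M[C]_n :=
  \sum_(i < n) (d i)%:C *: (row_proj i.+1 G - row_proj i G).

Lemma corner_adj i : (corner i)^t* = corner i.
Proof. exact: adj_Dmx. Qed.

Lemma corner_idem i : corner i *m corner i = corner i.
Proof.
rewrite /corner Dmx_mul; congr Dmx; apply/funext => k.
by case: (k < i)%N; rewrite ?mulr1 ?mulr0.
Qed.

Lemma row_proj_runitary i (G V : 'M[C]_n) : V \is unitarymx ->
  row_proj i (G *m V) = V^t* *m row_proj i G *m V.
Proof.
move=> /unitarymxP VV; rewrite /row_proj adjM.
have -> : G *m V *m (V^t* *m G^t*) = G *m G^t*.
  by rewrite mulmxA -[G *m V *m _]mulmxA VV mulmx1.
by rewrite !mulmxA.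
Qed.

Lemma frame_runitary d (G V : 'M[C]_n) : V \is unitarymx ->
  frame_mx d (G *m V) = V^t* *m frame_mx d G *m V.
Proof.
move=> Vu; rewrite /frame_mx mulmx_sumr mulmx_suml; apply: eq_bigr => i _.
rewrite !row_proj_runitary// -scalemxAr -scalemxAl mulmxBr mulmxBl.
by [].
Qed.

(** Row [j] of [G] lies in the span of the rows of index at most [j] of [schmidt G], which are
    orthogonal to its row [l]. *)
Lemma schmidt_trig (G : 'M[C]_n) (j l : 'I_n) : (j < l)%N ->
  (G *m (schmidt G)^t*) j l = 0.
Proof.
move=> jl; set U := schmidt G.
have UU : U *m U^t* = 1%:M by apply/unitarymxP; exact: schmidt_unitarymx.
have : (row j G <= kermx (col l (U^t*)))%MS.
  apply: (submx_trans (row_schmidt_sub G j)); apply/sumsmx_subP => k kj.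
  rewrite genmxE; apply/sub_kermxP; apply/matrixP => a b; rewrite !ord1.
  have -> : (row k U *m col l (U^t*)) 0 0 = (U *m U^t*) k l.
    by rewrite !mxE; apply: eq_bigr => s _; rewrite !mxE.
  rewrite UU !mxE; case: eqP => // kl.
  by move: kj jl; rewrite kl leqNgt => /negbTE ->.
move=> /sub_kermxP/matrixP/(_ 0 0); rewrite [RHS]mxE => <-.
by rewrite !mxE; apply: eq_bigr => s _; rewrite !mxE.
Qed.

(** Write G = T U with T lower triangular, and E for [corner i]. Triangularity gives E T = E T E, so
    Z = E T + (1 - E) is invertible, and the matrix inverted in [row_proj] is Z Z^*, where the
    summand 1 - E completes the leading block of the Gram matrix to full size. The factors Z then
    cancel, which removes T. *)
Lemma row_proj_schmidt i (G : 'M[C]_n) : G \in unitmx ->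
  row_proj i G = (schmidt G)^t* *m corner i *m schmidt G.
Proof.
move=> uG; set U := schmidt G; pose T := G *m U^t*; pose E := corner i.
have Uu : U \is unitarymx by exact: schmidt_unitarymx.
have /unitarymxP UU := Uu; have UU' := unitarymx_tC Uu.
have GE : G = T *m U by rewrite /T -mulmxA UU' mulmx1.
have ET : E *m T = E *m T *m E.
  apply/matrixP => j l; rewrite Dmx_lmul.
  rewrite [RHS]mxE (bigD1 l)//= Dmx_lmul [X in _ = _ + X]big1 ?addr0; last first.
    by move=> k kl; rewrite Dmx_entry (negbTE kl) mulr0n mulr0.
  rewrite Dmx_entry eqxx mulr1n.
  have [ji|] := ltnP j i; last by rewrite !mul0r.
  have [li|il] := ltnP l i; first by rewrite mulr1.
  by rewrite mulr0 schmidt_trig ?mulr0//; exact: leq_trans ji il.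
have uT : T \in unitmx.
  by rewrite unitmx_mul uG /= -invmx_unitary// unitmx_inv unitarymx_unit.
have EE : E *m E = E by exact: corner_idem.
have Ea : E^t* = E by exact: corner_adj.
pose F := 1%:M - E; pose S := E *m T.
have FE : F *m E = 0 by rewrite mulmxBl mul1mx EE subrr.
have FF : F *m F = F by rewrite {2}/F mulmxBr mulmx1 FE subr0.
have SE : S *m E = S by rewrite -ET.
have SF : S *m F = 0 by rewrite mulmxBr mulmx1 SE subrr.
have FS : F *m S = 0 by rewrite mulmxA FE mul0mx.
have Fa : F^t* = F by rewrite adjB adj1 Ea.
have FD : 1%:M - E = F by [].
have SD : E *m T = S by [].
have EF : E + F = 1%:M by rewrite addrC subrK.
clearbody F S T.
pose Z := S + F; pose Y := E *m invmx T *m E + F.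
have ZY : Z *m Y = 1%:M.
  rewrite /Z /Y mulmxDl !mulmxDr FF SF addr0 !mulmxA FE !mul0mx add0r SE.
  by rewrite -SD -[E *m T *m invmx T]mulmxA mulmxV// mulmx1 EE EF.
have YZ : Y *m Z = 1%:M by exact: mulmx1C.
have YS : Y *m S = E.
  have -> : S = Z *m E by rewrite /Z mulmxDl SE FE addr0.
  by rewrite mulmxA YZ mul1mx.
clearbody Y.
have ME : E *m (G *m G^t*) *m E + F = Z *m Z^t*.
  have -> : G *m G^t* = T *m T^t*.
    by rewrite GE adjM mulmxA -[T *m U *m _]mulmxA UU mulmx1.
  have -> : E *m (T *m T^t*) *m E = S *m S^t* by rewrite -SD adjM Ea !mulmxA.
  have FSa : F *m S^t* = 0 by rewrite -{1}Fa -adjM SF trmx0 map_mx0.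
  by rewrite /Z adjD Fa mulmxDl !mulmxDr FF SF FSa addr0 add0r.
rewrite /row_proj -/E FD ME; clearbody Z U.
rewrite (@mulmx1_invmx _ _ _ (Y^t* *m Y)); last first.
  by rewrite mulmxA -[Z *m _ *m _]mulmxA -adjM YZ adj1 mulmx1.
have -> : G^t* *m E = U^t* *m S^t* by rewrite -SD (adjM E T) Ea mulmxA -adjM -GE.
rewrite -!mulmxA [E *m G](_ : _ = S *m U); last by rewrite -SD -mulmxA -GE.
transitivity (U^t* *m (Y *m S)^t* *m (Y *m S) *m U).
  by rewrite adjM !mulmxA.
by rewrite YS Ea mulmxA; congr (_ *m U); rewrite -mulmxA EE.
Qed.

(** Differences of consecutive [corner] matrices are diagonal matrix units, so [row_proj_schmidt]
    adds up to the conjugate of [Dmx d]. *)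
Lemma frame_schmidt d (G : 'M[C]_n) : G \in unitmx ->
  frame_mx d G = (schmidt G)^t* *m Dmx d *m schmidt G.
Proof.
move=> uG; have -> : Dmx d = \sum_(i < n) (d i)%:C *: (corner i.+1 - corner i).
  apply/matrixP => j l; rewrite Dmx_entry summxE.
  have ent i : ((d i)%:C *: (corner i.+1 - corner i)) j l =
      (d i * ((j < i.+1)%:R - (j < i)%:R) *+ (j == l))%:C.
    rewrite mxE [X in _ * X]mxE [X in _ + X]mxE !Dmx_entry -rmorphB -rmorphM /=.
    by case: (j == l); rewrite ?mulr1n// !mulr0n subrr mulr0.
  rewrite (eq_bigr _ (fun i _ => ent i)) -rmorph_sum sumrMnl (bigD1 j)//= big1.
    by rewrite ltnS leqnn ltnn subr0 mulr1 addr0.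
  move=> i ij; rewrite ltnS [(j <= i)%N]leq_eqVlt.
  rewrite (_ : (j == i :> nat) = false) ?subrr ?mulr0//.
  by apply/negbTE; rewrite eq_sym.
rewrite mulmx_sumr mulmx_suml; apply: eq_bigr => i _.
by rewrite !row_proj_schmidt// -scalemxAr -scalemxAl mulmxBr mulmxBl.
Qed.

End frame.

(** * Matrices with orthonormal columns *)

Section stiefel_facts.
Local Open Scope sesquilinear_scope.
Variable R : realType.
Local Notation C := R[i].

Lemma stiefel_unitary n m (Phi : 'M[C]_(n, m)) :
  stiefel R n m Phi -> Phi^t* \is unitarymx.
Proof. by move=> h; apply/unitarymxP; rewrite trmxCK. Qed.

(** The equation [e] is eliminated to type the stacked matrix as a square one. *)
Lemma col_unitary m r n (e : (m + r = n)%N) (Phi : 'M[C]_(n, m)) (Q : 'M[C]_(r, n)) :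
  Phi^t* *m Phi = 1%:M -> Q *m Q^t* = 1%:M -> Q *m Phi = 0 ->
  exists2 V : 'M[C]_n, V \is unitarymx & V *m Phi = pid_mx m.
Proof.
case: n / e Phi Q => Phi Q PP QQ QP.
exists (col_mx (Phi^t*) Q); last by rewrite mul_col_mx PP QP pid_mx_col.
apply/unitarymxP; rewrite tr_col_mx map_row_mx mul_col_row trmxCK PP QQ QP.
by rewrite -[Phi^t* *m Q^t*]adjM QP trmx0 map_mx0 -scalar_mx_block.
Qed.

(** [Phi^t*] is completed by an orthonormal basis of the row vectors that annihilate [Phi]. *)
Lemma stiefel_complete n m (Phi : 'M[C]_(n, m)) : stiefel R n m Phi ->
  exists2 V : 'M[C]_n, V \is unitarymx & V *m Phi = pid_mx m.
Proof.
move=> PP; have Pu := stiefel_unitary PP.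
pose B := kermx Phi; pose Q := schmidt (row_base B).
have rkP : \rank Phi = m.
  by rewrite -[RHS](mxrank_unitary Pu) mxrank_map mxrank_tr.
have e : (m + \rank B = n)%N.
  by rewrite mxrank_ker rkP subnKC// -[X in (X <= _)%N]rkP rank_leq_row.
apply: (@col_unitary _ _ _ e Phi Q) => //.
  by apply/unitarymxP/schmidt_unitarymx; exact: rank_leq_col.
apply/sub_kermxP; rewrite /Q.
by rewrite eqmx_schmidt_free ?row_base_free// eq_row_base.
Qed.

(** A zero eigenvalue would give a nonzero vector z with Phi z = 0, contradicting Phi^* Phi = 1. *)
Lemma stiefel_gdet_gt0 n m (d : 'I_n -> R) (Phi : 'M[C]_(n, m)) :
  (forall i, 0 < d i) -> stiefel R n m Phi -> 0 < gdet d Phi.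
Proof.
move=> d0 PP; have d0' i : 0 <= d i by exact: ltW.
have [U [w [Uu w0 WE _]]] := sdet_spectral Phi d0'.
have -> : gdet d Phi = \prod_i w i by rewrite /gdet WE det_unitary_conj// det_Dmx.
apply: prodr_gt0 => i _; rewrite lt0r w0 andbT; apply/eqP => wi0.
have /unitarymxP UU := Uu.
pose z := U^t* *m delta_mx i (0 : 'I_1).
have Uz : U *m z = delta_mx i 0 by rewrite /z mulmxA UU mul1mx.
have q0 : qform d (Phi *m z) = 0.
  rewrite (qform_mul _ WE) Uz /qform (bigD1 i)//= wi0 mul0r add0r big1// => k ki.
  by rewrite mxE (negbTE ki) /= /nsq /= expr0n/= addr0 mulr0.
have Pz : Phi *m z = 0.
  apply/matrixP => k l; rewrite ord1 [RHS]mxE.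
  have /eqP := q0; rewrite psumr_eq0; last by move=> j _; rewrite mulr_ge0// nsq_ge0.
  move=> /allP/(_ k); rewrite mem_index_enum => /(_ isT) /=.
  rewrite mulf_eq0 gt_eqF//= paddr_eq0 ?sqr_ge0// !sqrf_eq0 => /andP[/eqP a /eqP b].
  by apply/eqP; rewrite eq_complex a b eqxx.
have z0 : z = 0 by rewrite -[z]mul1mx -PP -mulmxA Pz mulmx0.
move: Uz; rewrite z0 mulmx0 => /matrixP/(_ i 0); rewrite !mxE !eqxx /=.
by move=> /eqP; rewrite eq_sym oner_eq0.
Qed.

(** Gram-Schmidt on the rows of X^*; a singular [A] would make [gdet d X] vanish. *)
Lemma gpos_stiefel n m (d : 'I_n -> R) (X : 'M[C]_(n, m)) : (m <= n)%N ->
  (forall i, 0 <= d i) -> 0 < gdet d X ->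
  exists Phi (A : 'M[C]_m), [/\ stiefel R n m Phi, A \in unitmx & X = Phi *m A].
Proof.
move=> mn d0 g0; have /submxP[B XE] := schmidt_sub (X^t*).
pose S := schmidt (X^t*).
have SS : S *m S^t* = 1%:M by apply/unitarymxP; exact: schmidt_unitarymx.
have XE' : X = S^t* *m B^t* by rewrite -adjM -XE trmxCK.
exists (S^t*), (B^t*); split => //; first by rewrite /stiefel /= trmxCK.
rewrite unitmxE unitfE; apply/eqP => detB.
have := gdetE X d0; rewrite {2}XE' mulmxA det_mulmx detB mulr0 => /esym/eqP.
by rewrite fmorph_eq0 gt_eqF.
Qed.

(** Orthonormality reduces the Gram matrix of Phi A to A^* A, and [A] then cancels by cyclicity of
    the trace. *)
Lemma trace_gram_stiefel n m (K : 'M[C]_n) (Phi : 'M[C]_(n, m)) (A : 'M[C]_m) :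
  stiefel R n m Phi -> A \in unitmx -> Phi^t* *m K *m Phi \in unitmx ->
  \tr ((Phi *m A)^t* *m (Phi *m A) *m invmx ((Phi *m A)^t* *m K *m (Phi *m A))) =
  \tr (invmx (Phi^t* *m K *m Phi)).
Proof.
move=> PP uA uM; set M := Phi^t* *m K *m Phi in uM *.
have -> : (Phi *m A)^t* *m K *m (Phi *m A) = A^t* *m M *m A.
  by rewrite adjM /M !mulmxA.
have -> : (Phi *m A)^t* *m (Phi *m A) = A^t* *m A.
  by rewrite adjM mulmxA -[A^t* *m _ *m Phi]mulmxA PP mulmx1.
clearbody M.
have AA : A *m invmx A = 1%:M by exact: mulmxV.
have AA' : (invmx A)^t* *m A^t* = 1%:M by rewrite -adjM AA adj1.
have AA2 : A^t* *m (invmx A)^t* = 1%:M by exact: mulmx1C.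
rewrite (@mulmx1_invmx _ _ _ (invmx A *m invmx M *m (invmx A)^t*)); last first.
  by rewrite -!mulmxA (mulmxA A) AA mul1mx (mulmxA M) (mulmxV uM) mul1mx.
rewrite !mulmxA -[A^t* *m A *m invmx A]mulmxA AA mulmx1.
by rewrite mxtrace_mulC mulmxA AA' mul1mx.
Qed.

Lemma measurable_stiefel n m : measurable (stiefel R n m).
Proof.
pose f (X : 'M[C]_(n, m)) : R := \sum_i \sum_j nsq ((X^t* *m X - 1%:M) i j).
have mf : measurable_fun setT f.
  apply: measurable_real_sum => i; apply: measurable_real_sum => j.
  apply: measurable_nsq; apply: (@measurableT_comp _ _ _ _ _ _ (fun M : 'M[C]_m => M i j)).
    exact: measurable_entry.
  apply: measurable_mxD; last exact: measurable_cst.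
  by apply: measurable_mxM => //; exact: measurable_mxtC.
have -> : stiefel R n m = f @^-1` [set 0].
  apply/seteqP; split => X /=.
    rewrite /stiefel /= => XX; rewrite /f XX subrr big1// => i _; rewrite big1// => j _.
    by rewrite mxE /nsq /= expr0n /= addr0.
  move=> /eqP; rewrite psumr_eq0; last by move=> i _; apply: sumr_ge0 => j _; exact: nsq_ge0.
  move=> /allP h; apply/eqP; rewrite -subr_eq0; apply/eqP/matrixP => i j; rewrite [RHS]mxE.
  have := h i; rewrite mem_index_enum => /(_ isT) /=.
  rewrite psumr_eq0; last by move=> k _; exact: nsq_ge0.
  move=> /allP/(_ j); rewrite mem_index_enum => /(_ isT) /=.
  rewrite paddr_eq0 ?sqr_ge0// !sqrf_eq0 => /andP[/eqP a /eqP b].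
  by apply/eqP; rewrite eq_complex a b eqxx.
by rewrite -[X in measurable X]setTI; exact: mf.
Qed.

End stiefel_facts.

(** * Haar averages through a random Gaussian frame *)

Section haar.
Local Open Scope sesquilinear_scope.
Variables (R : realType) (n m : nat).
Local Notation C := R[i].
Local Notation N := n.+1.
Local Notation L := m.+1.

(** The absolute value makes the integrand nonnegative for every [K], as Tonelli requires; it
    disappears at [Dmx d] by [atrace_Dmx]. The same holds for [agram]. *)
Definition atrace (A : 'M[C]_(N, L)) (K : 'M[C]_N) : R :=
  `|complex.Re (\tr (invmx (A^t* *m K *m A)))|.

Definition agram (A : 'M[C]_(N, L)) (K : 'M[C]_N) : R :=
  `|complex.Re (\tr (A^t* *m A *m invmx (A^t* *m K *m A)))|.

Section measurability.
Context dT (T : measurableType dT).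
Variables (f : T -> 'M[C]_(N, L)) (g : T -> 'M[C]_N).
Hypotheses (mf : measurable_fun setT f) (mg : measurable_fun setT g).

Let mW : measurable_fun setT (fun t => invmx ((f t)^t* *m g t *m f t)).
Proof.
apply: measurable_invmx; apply: measurable_mxM => //.
by apply: measurable_mxM => //; exact: measurable_mxtC.
Qed.

Lemma measurable_atrace : measurable_fun setT (fun t => (atrace (f t) (g t))%:E).
Proof.
apply/measurable_EFinP; apply: measurableT_comp => //.
by apply: measurable_cRe; exact: measurable_trace.
Qed.

Lemma measurable_agram : measurable_fun setT (fun t => (agram (f t) (g t))%:E).
Proof.
apply/measurable_EFinP; apply: measurableT_comp => //.
apply: measurable_cRe; apply: measurable_trace; apply: measurable_mxM => //.
by apply: measurable_mxM => //; exact: measurable_mxtC.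
Qed.

Lemma measurable_frame (d : 'I_N -> R) (h : T -> 'M[C]_N) : measurable_fun setT h ->
  measurable_fun setT (fun t => frame_mx d (h t)).
Proof.
move=> mh.
have mp i : measurable_fun setT (fun t => row_proj i (h t)).
  apply: measurable_mxM => //; apply: measurable_mxM => //.
  apply: measurable_mxM; last first.
    apply: measurable_invmx; apply: measurable_mxD => //.
    apply: measurable_mxM => //; apply: measurable_mxM => //.
    by apply: measurable_mxM => //; exact: measurable_mxtC.
  by apply: measurable_mxM => //; exact: measurable_mxtC.
apply/measurable_matrixP => a b.
rewrite (_ : (fun t => _) = fun t => \sum_(i < N) (d i)%:C *
    (row_proj i.+1 (h t) - row_proj i (h t)) a b); last first.
  by apply/funext => t; rewrite summxE; apply: eq_bigr => i _; rewrite mxE.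
apply: measurable_csum => i; apply: measurable_cM => //.
have : measurable_fun setT (fun t => row_proj i.+1 (h t) - row_proj i (h t)).
  by apply: measurable_mxD => //; exact: measurable_mxN.
by move=> /measurable_matrixP; apply.
Qed.

End measurability.

Variable d : 'I_N -> R.
Hypotheses (mn : (L < N)%N) (d_gt0 : forall i, 0 < d i) (d_inj : injective d).

Let d_ge0 i : 0 <= d i. Proof. exact: ltW. Qed.

Let atrace_ge0 A K : 0 <= atrace A K. Proof. exact: normr_ge0. Qed.
Let agram_ge0 A K : 0 <= agram A K. Proof. exact: normr_ge0. Qed.
#[local] Hint Resolve atrace_ge0 agram_ge0 : core.

Lemma atrace_conj (V : 'M[C]_N) A K :
  atrace (V *m A) K = atrace A (V^t* *m K *m V).
Proof. by rewrite /atrace adjM !mulmxA. Qed.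

Lemma agram_conj (V : 'M[C]_N) A K : V \is unitarymx ->
  agram (V *m A) K = agram A (V^t* *m K *m V).
Proof.
move=> Vu; rewrite /agram.
have -> : (V *m A)^t* *m (V *m A) = A^t* *m A.
  rewrite adjM mulmxA -[_ *m V^t* *m V]mulmxA (unitarymx_tC Vu).
  by rewrite mulmx1.
have -> : (V *m A)^t* *m K *m (V *m A) = A^t* *m (V^t* *m K *m V) *m A.
  by rewrite adjM !mulmxA.
by [].
Qed.

Lemma atrace_Dmx A : atrace A (Dmx d) = tinv d A.
Proof. by rewrite /atrace ger0_norm//; exact: tinv_ge0. Qed.

Lemma agram_Dmx A : agram A (Dmx d) = tgram d A.
Proof. by rewrite /agram ger0_norm//; exact: tgram_ge0. Qed.

Local Notation gam := (cgauss R N N).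
Local Notation Gam := (cgauss R N L).

(** Invertible matrices, written as [gpos] with unit weights so that [cgauss_gpos] gives them
    probability one. *)
Definition regular : set 'M[C]_N := @gpos R N n (fun=> 1).

Lemma regular_unitmx G : regular G -> G \in unitmx.
Proof.
rewrite /regular /gpos /= => g0; rewrite unitmxE unitfE; apply/eqP => detG.
have := @gdetE R N N (fun=> 1) G (fun=> ler01).
rewrite det_mulmx detG mulr0 => /esym/eqP.
by rewrite fmorph_eq0 gt_eqF.
Qed.

Lemma ge0_integral_regular (F : 'M[C]_N -> \bar R) :
  measurable_fun setT F -> (forall X, 0 <= F X)%E ->
  (\int[gam]_X F X = \int[gam]_(X in regular) F X)%E.
Proof. by move=> mF F0; apply: ge0_integral_gpos. Qed.

Definition frame_value : \bar R := (\int[gam]_G (atrace (pid_mx L) (frame_mx d G))%:E)%E.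

(** With V unitary and V Phi = [pid_mx L], moving V from Phi to the frame conjugates [frame_mx d G]
    into [frame_mx] at G V^*, and right invariance of the law of G absorbs V. *)
Lemma integral_atrace_frame (Phi : 'M[C]_(N, L)) : stiefel R N L Phi ->
  (\int[gam]_G (atrace Phi (frame_mx d G))%:E = frame_value)%E.
Proof.
move=> PP; have [V Vu VP] := stiefel_complete PP.
have Vu' : V^t* \is unitarymx by rewrite trmxC_unitary.
have PE : Phi = V^t* *m pid_mx L by rewrite -VP mulmxA unitarymx_tC// mul1mx.
have mF : measurable_fun setT (fun G => (atrace (pid_mx L) (frame_mx d G))%:E).
  by apply: measurable_atrace => //; exact: measurable_frame.
rewrite /frame_value -(cgauss_runitary Vu' mF); last by move=> G; rewrite lee_fin.
by apply: eq_integral => G _ /=; rewrite PE atrace_conj frame_runitary.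
Qed.

Lemma agram_frame (X : 'M[C]_(N, L)) : 0 < gdet d X ->
  exists2 Phi, stiefel R N L Phi & forall G : 'M[C]_N, G \in unitmx ->
    agram X (frame_mx d G) = atrace Phi (frame_mx d G).
Proof.
move=> g0; have [Phi [A [PP uA ->]]] := gpos_stiefel (ltnW mn) d_ge0 g0.
exists Phi => // G uG; rewrite /agram trace_gram_stiefel//.
rewrite frame_schmidt//; set U := schmidt G.
have Uu : U \is unitarymx by exact: schmidt_unitarymx.
have -> : Phi^t* *m (U^t* *m Dmx d *m U) *m Phi = (U *m Phi)^t* *m Dmx d *m (U *m Phi).
  by rewrite adjM !mulmxA.
rewrite unitmxE unitfE gdetE// fmorph_eq0 gt_eqF//; apply: stiefel_gdet_gt0 => //.
rewrite /stiefel /= adjM mulmxA -[Phi^t* *m _ *m U]mulmxA unitarymx_tC// mulmx1.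
exact: PP.
Qed.

(** The average of [agram] over independent X and G, in both orders. For almost every fixed X it is
    [frame_value], by [agram_frame]; for fixed invertible G, [frame_mx d G] is a unitary conjugate
    of [Dmx d], and left invariance of the law of X gives the mean of [tgram]. *)
Lemma frame_valueE : frame_value = (((N - L)%:R * pf_value d mn)%:E)%E.
Proof.
rewrite -integral_tgram//.
have mF : measurable_fun setT (fun p : 'M[C]_(N, L) * 'M[C]_N =>
    (agram p.1 (frame_mx d p.2))%:E).
  by apply: measurable_agram => //; exact: measurable_frame.
have F0 (p : 'M[C]_(N, L) * 'M[C]_N) : (0 <= (agram p.1 (frame_mx d p.2))%:E)%E.
  by rewrite lee_fin.
have mFX X : measurable_fun setT (fun G => (agram X (frame_mx d G))%:E).
  by apply: measurable_agram => //; exact: measurable_frame.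
transitivity (\int[Gam]_X \int[gam]_G (agram X (frame_mx d G))%:E)%E.
  have mI : measurable_fun setT (fun X => (\int[gam]_G (agram X (frame_mx d G))%:E)%E).
    exact: (@measurable_fun_fubini_tonelli_F _ _ _ _ R gam _ mF F0).
  have I0 X : (0 <= \int[gam]_G (agram X (frame_mx d G))%:E)%E.
    by apply: integral_ge0 => G _; rewrite lee_fin.
  apply: (etrans _ (esym (ge0_integral_gpos d_gt0 (ltnW mn) mI I0))); apply/esym.
  rewrite (eq_integral (cst frame_value)).
    rewrite integral_cst; last exact: measurable_gpos.
    by rewrite [X in (_ * X)%E](cgauss_gpos d_gt0 (ltnW mn)) mule1.
  move=> X /set_mem g0.
  have [Phi PP PE] := agram_frame g0.
  have mP : measurable_fun setT (fun G => (atrace Phi (frame_mx d G))%:E).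
    by apply: measurable_atrace => //; exact: measurable_frame.
  have P0 G : (0 <= (atrace Phi (frame_mx d G))%:E)%E by rewrite lee_fin.
  have X0 G : (0 <= (agram X (frame_mx d G))%:E)%E by rewrite lee_fin.
  apply: (etrans (ge0_integral_regular (mFX X) X0)).
  apply: (etrans _ (integral_atrace_frame PP)).
  apply: (etrans _ (esym (ge0_integral_regular mP P0))).
  by apply: eq_integral => G /set_mem/regular_unitmx uG; rewrite PE.
rewrite (@fubini_tonelli _ _ _ _ R Gam gam _ mF F0).
have mI := @measurable_fun_fubini_tonelli_G _ _ _ _ R Gam _ mF F0.
rewrite ge0_integral_regular//; last by move=> G; apply: integral_ge0 => X _; rewrite lee_fin.
rewrite (eq_integral (cst (\int[Gam]_X (tgram d X)%:E)%E)).
  rewrite integral_cst; last exact: measurable_gpos.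
  by rewrite [X in (_ * X)%E](cgauss_gpos (fun=> ltr01))// mule1.
move=> G /set_mem/regular_unitmx uG.
have Uu : schmidt G \is unitarymx by exact: schmidt_unitarymx.
have mt : measurable_fun setT (fun X : 'M[C]_(N, L) => (tgram d X)%:E).
  by apply/measurable_EFinP; exact: measurable_tgram.
rewrite -(cgauss_lunitary Uu mt); last by move=> X; rewrite lee_fin tgram_ge0.
apply: eq_integral => X _.
by rewrite /= frame_schmidt// -agram_conj// agram_Dmx.
Qed.

(** The same exchange with [phi] in place of the law of X: for fixed G the left invariance of [phi]
    gives the mean of [tinv], and for fixed Phi on the manifold the inner integral is
    [frame_value]. *)
Lemma integral_tinv_haar (phi : probability 'M[C]_(N, L) R) : isotropic phi ->
  (\int[phi]_Phi (tinv d Phi)%:E = ((N - L)%:R * pf_value d mn)%:E)%E.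
Proof.
move=> [phi1 phiU]; rewrite -frame_valueE.
have inv (U : 'M[C]_N) (F : 'M[C]_(N, L) -> \bar R) : U \is unitarymx ->
    measurable_fun setT F -> (forall X, 0 <= F X)%E ->
    (\int[phi]_X F (U *m X)%R = \int[phi]_X F X)%E.
  move=> Uu mF F0; have mU := @measurable_clmul R N N L U.
  rewrite -(ge0_integral_push phi mU mF F0); apply: eq_probability_integral => A mA.
  by rewrite pushE phiU.
have mt : measurable_fun setT (fun X : 'M[C]_(N, L) => (tinv d X)%:E).
  by apply/measurable_EFinP; exact: measurable_tinv.
have mF : measurable_fun setT (fun p : 'M[C]_(N, L) * 'M[C]_N =>
    (atrace p.1 (frame_mx d p.2))%:E).
  by apply: measurable_atrace => //; exact: measurable_frame.
have F0 (p : 'M[C]_(N, L) * 'M[C]_N) : (0 <= (atrace p.1 (frame_mx d p.2))%:E)%E.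
  by rewrite lee_fin.
transitivity (\int[gam]_G \int[phi]_Phi (atrace Phi (frame_mx d G))%:E)%E.
  have mI := @measurable_fun_fubini_tonelli_G _ _ _ _ R phi _ mF F0.
  apply/esym; rewrite ge0_integral_regular//; last by move=> G; apply: integral_ge0 => X _; rewrite lee_fin.
  rewrite (eq_integral (cst (\int[phi]_X (tinv d X)%:E)%E)).
    rewrite integral_cst; last exact: measurable_gpos.
    by rewrite [X in (_ * X)%E](cgauss_gpos (fun=> ltr01))// mule1.
  move=> G /set_mem/regular_unitmx uG.
  have Uu : schmidt G \is unitarymx by exact: schmidt_unitarymx.
  rewrite -(inv _ _ Uu mt); last by move=> X; rewrite lee_fin tinv_ge0.
  apply: eq_integral => X _.
  by rewrite /= frame_schmidt// -atrace_conj atrace_Dmx.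
rewrite -(@fubini_tonelli _ _ _ _ R phi gam _ mF F0).
have mI : measurable_fun setT (fun X => (\int[gam]_G (atrace X (frame_mx d G))%:E)%E).
  exact: (@measurable_fun_fubini_tonelli_F _ _ _ _ R gam _ mF F0).
have I0 X : (0 <= \int[gam]_G (atrace X (frame_mx d G))%:E)%E.
  by apply: integral_ge0 => G _; rewrite lee_fin.
have mS : measurable (stiefel R N L) by exact: measurable_stiefel.
have S0 : phi (~` stiefel R N L) = 0%E.
  by apply: (etrans (probability_setC phi mS)); rewrite phi1 subee.
rewrite (ge0_negligible_integral (measurableC mS) measurableT mI (fun X _ => I0 X) S0).
rewrite setDE setCK setTI (eq_integral (cst frame_value)).
  by rewrite integral_cst// [X in (_ * X)%E]phi1 mule1.
by move=> X /set_mem; exact: integral_atrace_frame.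
Qed.

End haar.

(** * Passage to complex integrals, the law of X, and the theorem *)

Section complex_lift.
Context dT (T : measurableType dT) (R : realType) (mu : {measure set T -> \bar R}).

Lemma cintegral_ge0 (D : set T) (f : T -> R[i]) (g : T -> R) (v : R) : measurable D ->
  measurable_fun setT g -> (forall t, f t = (g t)%:C) -> (forall t, 0 <= g t) ->
  (\int[mu]_(t in D) (g t)%:E = v%:E)%E ->
  cintegrable mu D f /\ cintegral mu D f = v%:C.
Proof.
move=> mD mg fE g0 gv.
have -> : f = fun t => (g t)%:C by apply/funext.
rewrite /cintegrable /cintegral /=; split; [split|].
- apply/integrableP; split.
    by apply: measurable_funTS; exact/measurable_EFinP.
  rewrite (eq_integral (fun t => (g t)%:E)) ?gv ?ltry// => t _.
  by rewrite /= ger0_norm.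
- exact: integrable0.
- by rewrite /Rintegral gv /= integral0 /=.
Qed.

End complex_lift.

Section gaussian_law.
Context dT (T : measurableType dT) (R : realType) (P : probability T R).
Variables (N L : nat) (X : {RV P >-> 'M[R[i]]_(N, L)}).

(** Independence over the full index set, applied to one box per entry. *)
Lemma law_is_cgauss : complex_gaussian_matrix X ->
  is_cgauss (push P (@measurable_funPT _ _ _ _ X)).
Proof.
move=> [Xg Xi] A B mA mB; rewrite pushE.
pose S (ij : 'I_N * 'I_L) := [set z : R[i] | A ij.1 ij.2 (complex.Re z) /\
  B ij.1 ij.2 (complex.Im z)].
have mS ij : measurable (S ij) by exact: measurable_cbox1.
have -> : X @^-1` cbox A B =
    \bigcap_(ij in [set` (finset.setTfor ('I_N * 'I_L)%type)])
      ((fun t => X t ij.1 ij.2) @^-1` S ij).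
  apply/seteqP; split => t /=; first by move=> h ij _; exact: (h ij.1 ij.2).
  by move=> h i j; exact: (h (i, j) (finset.in_setT _)).
rewrite (Xi _ S mS) (eq_bigl xpredT); last by move=> ij; rewrite finset.in_setT.
rewrite exchange_big pair_bigA /=; apply: eq_bigr => ij _.
exact: Xg.
Qed.

End gaussian_law.

Theorem proposition1 (R : realType) (N L : nat) (d : 'I_N -> R)
    (L_ge1 : (1 <= L)%N) (L_ltN : (L < N)%N)
    (d_gt0 : forall i, 0 < d i) (d_inj : injective d)
    (phi : probability 'M[R[i]]_(N, L) R) (phi_haar : isotropic phi)
    (disp : measure_display) (T : measurableType disp) (P : probability T R)
    (X : {RV P >-> 'M[R[i]]_(N, L)}) (X_gauss : complex_gaussian_matrix X) :
  (cintegrable phi (stiefel R N L) (trace_inv d) /\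
   cintegral phi (stiefel R N L) (trace_inv d) =
     ((N - L)%:R * (\det (Gmx L d) / \det (vandermonde d)))%:C) /\
  (cintegrable P setT (fun t => trace_inv d (X t)) /\
   cintegral P setT (fun t => trace_inv d (X t)) =
     (\det (Gmx L d) / \det (vandermonde d))%:C).
Proof.
have d_ge0 i : 0 <= d i by exact: ltW.
destruct N as [|n]; first by [].
destruct L as [|m]; first by [].
have mt : measurable_fun setT (@tinv R n.+1 m.+1 d) by exact: measurable_tinv.
have mtE : measurable_fun setT (fun A => (@tinv R n.+1 m.+1 d A)%:E).
  exact/measurable_EFinP.
have t0 A : (0 <= (@tinv R n.+1 m.+1 d A)%:E)%E by rewrite lee_fin tinv_ge0.
rewrite -(pf_valueE L_ltN d_gt0 d_inj); split; apply: cintegral_ge0.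
- exact: measurable_stiefel.
- exact: mt.
- exact: trace_invE.
- exact: tinv_ge0.
- rewrite -(integral_tinv_haar L_ltN d_gt0 d_inj phi_haar).
  (* [phi] gives no mass to the complement of the manifold, so the integral over all matrices
     restricts to it. *)
  have mS : measurable (stiefel R n.+1 m.+1) by exact: measurable_stiefel.
  have S0 : phi (~` stiefel R n.+1 m.+1) = 0%E.
    by apply: (etrans (probability_setC phi mS)); rewrite (proj1 phi_haar) subee.
  rewrite (ge0_negligible_integral (measurableC mS) measurableT mtE (fun A _ => t0 A) S0).
  by rewrite setDE setCK setTI.
- by [].
- exact: (measurableT_comp mt (@measurable_funPT _ _ _ _ X)).
- by move=> t; exact: trace_invE.
- by move=> t; exact: tinv_ge0.
- rewrite -(ge0_integral_push P (@measurable_funPT _ _ _ _ X) mtE t0).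
  rewrite -(integral_tinv L_ltN d_gt0 d_inj); apply: eq_probability_integral => E mE.
  have c := @cgauss_is_cgauss R n.+1 m.+1.
  exact: (is_cgauss_unique (law_is_cgauss X_gauss) c mE).
Qed.
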